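(* Let $\eta:(A,v_A)\to M$ be a special affine bundle, $\mathbb BA$ its double affine dual bundle with the action $\psi=(\psi_1,\psi_2)$ of $\mathbb R\times\mathbb R$, and $\beta:\mathbb BA\to\mathbb BA^\#$ the canonical isomorphism. There is a canonical isomorphism $$\tau:\mathbb BA/(\{0\}\times\mathbb R)\to\mathbb BA/(\mathbb R\times\{0\}).$$ The composition $$\mathsf CA\simeq\mathbb BA/(\{0\}\times\mathbb R)\xrightarrow{\ \tau\ }\mathbb BA/(\mathbb R\times\{0\})\xrightarrow{\ \beta\ }\mathbb BA^\#/(\{0\}\times\mathbb R)\simeq\mathsf CA^\#$$ is an isomorphism of double affine bundles. However, it moves the distinguished section $(0,1_{\underline A})$ of the model vector bundle $T^*\underline A\oplus\mathbb R$ into the section $(0,-1_{\underline{A^\#}})$, and so it establishes an isomorphism of special affine bundles $$\mathsf C\bar A\simeq\mathsf CA^\#,$$ where $\bar A=(A,-v_A)$ is the adjoint of $A$.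
   Context: All manifolds and maps are smooth, bundles have finite rank, and the base $M$ is connected. Double affine bundle $(A;A_1,A_2;M)$: a commuting diagram of four affine bundles $\pi_1:A\to A_1$, $\pi_2:A\to A_2$, $\pi_1':A_2\to M$, $\pi_2':A_1\to M$ such that $(\pi_1,\pi_1')$ and $(\pi_2,\pi_2')$ are morphisms of affine bundles (from $\pi_2$ to $\pi_2'$, resp. from $\pi_1$ to $\pi_1'$), $(\pi_1,\pi_2):A\to A_1\times_MA_2$ is surjective, and the fibrewise affine combinations for $\pi_i$ are affine bundle morphisms for the other structure. Isomorphisms between double affine bundles are understood up to exchanging the order of the two side bundles (flip). Special affine bundle: affine bundle $\eta:A\to M$ with a nowhere vanishing section $v_A$ of the model bundle $\mathcal V(A)$. Its vector hull $E=\widehat A$ is the vector bundle whose fibres are spanned by symbols $x_a$, $a\in A_m$, modulo $x_{\lambda a+(1-\lambda)b}=\lambda x_a+(1-\lambda)x_b$; $\alpha_A\in\mathrm{Sec}(E^* )$ is the linear function with $\alpha_A(x_a)=1$, $A=\{\alpha_A=1\}$, $\mathcal V(A)=\{\alpha_A=0\}\subset E$. $A^\#$ is the affine dual: affine functions $f$ on $A_m$ with linear part satisfying $f^v(v_A)=1$, with distinguished section the constant function $1_A$; $A^\#=\{f\in E^*:f(v_A)=1\}$ and $\widehat{A^\#}\simeq E^*$, with canonical linear function $\alpha_{A^\#}=v_A$. Quotients: $\underline A=A/\langle v_A\rangle$ with $\zeta:A\to\underline A$, $\underline{A^\#}=A^\#/\langle1_A\rangle$. Contact bundle $\mathsf CA$: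 for sections $\sigma,\sigma'$ of $\zeta$ let $\sigma-\sigma'$ denote the function $h$ on $\underline A$ with $\sigma=\sigma'+h\cdot(-v_A)$ (the distinguished section of $\zeta$ is by convention $-v_A$). $\mathsf CA$ is the set of first jets $\mathbf c_{\underline a}\sigma$, where $\sigma\sim\sigma'$ at $\underline a$ iff $\sigma(\underline a)=\sigma'(\underline a)$ and $d_{\underline a}(\sigma-\sigma')=0$. It is an affine bundle over $\underline A$ modelled on $T^*\underline A\oplus\mathbb R$ via $\mathbf c_{\underline a}\sigma_2-\mathbf c_{\underline a}\sigma_1=(d_{\underline a}(\sigma_2-\sigma_1),\sigma_2(\underline a)-\sigma_1(\underline a))$, with distinguished section $(0,1)$. Put $f_\sigma:A\to\mathbb R$, $f_\sigma(x)v_A=[\sigma(\zeta(x)),x]$ (the vector from $\sigma(\zeta(x))$ to $x$). The second projection $\mathsf CA\to\underline{A^\#}$ is $\mathbf c_{\underline a}\sigma\mapsto$ class of $f_{\sigma|A_m}$, for an affine section $\sigma$ representing the jet. Affine structure in a fibre of it over $m$: fix an affine section $\sigma_0$ with $f_{\sigma_0|A_m}$ in the given class; each element is uniquely $\mathbf c_{\underline a}\sigma_0+(\alpha,r)$ with $\underline a\in\underline A_m$, $\alpha\in T_m^*M$ (pulled back), $r\in\mathbb R$, and the combination of $\mathbf c_{\underline a_i}\sigma_0+(\alpha_i,r_i)$, $i=1,2$, with weights $\lambda,1-\lambda$ is $\mathbf c_{\underline a}\sigma_0+(\lambda\alpha_1+(1-\lambda)\alpha_2,\lambda r_1+(1-\lambda)r_2)$,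 $\underline a=\lambda\underline a_1+(1-\lambda)\underline a_2$. This makes $(\mathsf CA;\underline A,\underline{A^\#};M)$ a (special) double affine bundle with core $(T^*M\oplus\mathbb R,(0,1_M))$. $\mathsf CA$ is embedded in $T^*A$ by $\mathbf c_{\underline a}\sigma\mapsto d_{\sigma(\underline a)}f_\sigma$; the image is the set of $\omega\in T_a^*A$, $a\in A$, with $\langle\omega,X_A(a)\rangle=1$, where $X_A$ is the vertical lift of $v_A$. Double affine dual: $\mathbb BA=\{\omega_x\in T_x^*E:x\in A\subset E,\ \langle\omega_x,X_A(x)\rangle=1\}$, where $X_A$ is the vertical lift of $v_A$ to $E$; it is a double affine bundle over $A$ and $A^\#$, a double affine subbundle of the double vector bundle $(T^*E;E,E^*;M)$ (the projection $T^*E\to E^*$ restricts a covector to the vertical space $T_xE_m\simeq E_m$). The commuting actions on $T^*E$, $(\psi_1)_t=(\varphi_{-t})^*$ with $\varphi_t(v)=v+t\,v_A$, and $\psi_2(t,\omega_v)=\omega_v+t\,d_v\alpha_A$, preserve $\mathbb BA$; the first factor of $\mathbb R\times\mathbb R$ acts by $\psi_1$, the second by $\psi_2$. The same construction applied to $A^\#$ gives $\mathbb BA^\#\subset T^*E^*$. The identification $\mathsf CA\simeq\mathbb BA/(\{0\}\times\mathbb R)$ is induced by restricting covectors $\omega_x\in T_x^*E$ to $T_xA$; similarly for $A^\#$. The isomorphism $\beta_E:T^*E\to T^*E^*$ is, in adapted coordinates $(x_a;y_i;p_b;\pi_j)$ on $T^*E$ and $(x_a;\xi_i;q_b;z_j)$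 on $T^*E^*$ (with $\xi_i$ dual to $y_i$ and $p,\pi$, resp. $q,z$, the conjugate momenta), given by $\beta_E(x_a;y_i;p_b;\pi_j)=(x_a;\pi_i;-p_b;y_j)$. Its restriction is an isomorphism $\beta:\mathbb BA\to\mathbb BA^\#$ of double affine bundles (up to flip) which carries orbits of $\psi_1$ to orbits of $\psi_2$ and vice versa, and hence induces the map denoted again $\beta:\mathbb BA/(\mathbb R\times\{0\})\to\mathbb BA^\#/(\{0\}\times\mathbb R)$. *)

(* Defs.v *)
From HB Require Import structures.
From mathcomp Require Import all_boot all_order all_algebra.
From mathcomp Require Import all_classical all_reals all_analysis.
From mathcomp Require Import ring.

Set Implicit Arguments.
Unset Strict Implicit.
Unset Printing Implicit Defensive.

Import Order.TTheory GRing.Theory Num.Theory.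
Import numFieldNormedType.Exports.

Local Open Scope classical_set_scope.
Local Open Scope ring_scope.
Local Open Scope quotient_scope.

(* [the x0 P] is the element of P when P is a singleton; x0 is only a default.
   It is the analogue of [xget] for an arbitrary Type. *)
Definition the (T : Type) (x0 : T) (P : set T) : T :=
  if pselect (exists x, P x) is left e then projT1 (cid e) else x0.

(** * Linear algebra: subspaces as types, dual spaces, vector hulls *)

Section Sublmodule.
Variables (R : realType) (V : lmodType R).

Definition submod (P : set V) : Prop :=
  P 0 /\ forall (a : R) x y, P x -> P y -> P (a *: x + y).

Definition submod_pred (P : set V) (_ : submod P) : {pred V} :=
  fun x => `[< P x >].

Lemma submod_pred_closed (P : set V) (HP : submod P) :
  GRing.submod_closed (submod_pred HP).
Proof.
case: (HP) => P0 PD; split; first exact/asboolP.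
by move=> a x y /asboolP Px /asboolP Py; apply/asboolP; exact: PD.
Qed.

HB.instance Definition _ (P : set V) (HP : submod P) :=
  GRing.isSubmodClosed.Build R V (submod_pred HP) (submod_pred_closed HP).

Record sublmod (P : set V) (HP : submod P) : Type :=
  Sublmod { sublmod_val : V; _ : sublmod_val \in submod_pred HP }.

HB.instance Definition _ (P : set V) (HP : submod P) :=
  [isSub for @sublmod_val P HP].
HB.instance Definition _ (P : set V) (HP : submod P) :=
  [Choice of sublmod HP by <:].
HB.instance Definition _ (P : set V) (HP : submod P) :=
  [SubChoice_isSubLmodule of sublmod HP by <:].

End Sublmodule.

Section Dual.
Variables (R : realType) (V : lmodType R).

Definition linear_form : set (V -> R^o) :=
  [set f | forall (a : R) x y, f (a *: x + y) = a * f x + f y].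

Lemma linear_form_submod : submod linear_form.
Proof.
split=> [a x y|a f g Hf Hg b x y].
  by change (0 = a * 0 + 0 :> R); rewrite mulr0 addr0.
change (a * f (b *: x + y) + g (b *: x + y) =
        b * (a * f x + g x) + (a * f y + g y)).
by rewrite Hf Hg; ring.
Qed.

Definition dual : lmodType R := sublmod linear_form_submod.
Definition dapp (f : dual) : V -> R := sublmod_val f.

End Dual.

(* The vector space spanned by symbols x_a, a in T, modulo the relations
   x_(l a + (1 - l) b) = l x_a + (1 - l) x_b, for an operation [cb l a b]
   standing for l a + (1 - l) b.  A formal sum is a list of pairs
   (coefficient, symbol). *)
Section Hull.
Variables (R : realType) (T : Type) (cb : R -> T -> T -> T).

Definition fsum : Type := seq (R * {classic T}).
HB.instance Definition _ := Choice.on fsum.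

Definition fscale (c : R) (s : fsum) : fsum := [seq (c * p.1, p.2) | p <- s].

Inductive hull_rel : fsum -> fsum -> Prop :=
| hull_refl s : hull_rel s s
| hull_sym s t : hull_rel s t -> hull_rel t s
| hull_trans s t r : hull_rel s t -> hull_rel t r -> hull_rel s r
| hull_perm s t : perm_eq s t -> hull_rel s t
| hull_cat s s' t t' :
    hull_rel s s' -> hull_rel t t' -> hull_rel (s ++ t) (s' ++ t')
| hull_fscale c s t : hull_rel s t -> hull_rel (fscale c s) (fscale c t)
| hull_zero (a : T) : hull_rel [:: (0, a)] [::]
| hull_plus (l l' : R) (a : T) :
    hull_rel [:: (l, a); (l', a)] [:: (l + l', a)]
| hull_comb (l : R) (a b : T) :
    hull_rel [:: (1, cb l a b)] [:: (l, a); (1 - l, b)].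

Definition hull_relb (s t : fsum) : bool := `[< hull_rel s t >].

Lemma hull_relb_equiv : equiv_class_of hull_relb.
Proof.
split.
- by move=> s; apply/asboolP; exact: hull_refl.
- by move=> s t; apply/asboolP/asboolP; exact: hull_sym.
- by move=> t s r /asboolP st /asboolP tr; apply/asboolP; exact: hull_trans st tr.
Qed.

Canonical hull_equiv := EquivRelPack hull_relb_equiv.

Definition hull := {eq_quot hull_equiv}.
HB.instance Definition _ := Choice.on hull.
HB.instance Definition _ := EqQuotient.on hull.

Lemma hull_piP (s t : fsum) : hull_rel s t -> \pi_hull s = \pi_hull t.
Proof. by move=> st; apply/eqmodP/asboolP. Qed.

Lemma hull_reprP (s : fsum) : hull_rel (repr (\pi_hull s)) s.
Proof. by apply/asboolP; have /eqmodP := reprK (\pi_hull s). Qed.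

Definition hadd (e f : hull) : hull := \pi_hull (repr e ++ repr f).
Definition hscale (c : R) (e : hull) : hull := \pi_hull (fscale c (repr e)).
Definition hzero : hull := \pi_hull [::].
Definition hopp (e : hull) : hull := hscale (-1) e.

Lemma hadd_pi s t : hadd (\pi_hull s) (\pi_hull t) = \pi_hull (s ++ t).
Proof. by apply: hull_piP; apply: hull_cat; exact: hull_reprP. Qed.

Lemma hscale_pi c s : hscale c (\pi_hull s) = \pi_hull (fscale c s).
Proof. by apply: hull_piP; apply: hull_fscale; exact: hull_reprP. Qed.

Lemma hull_ind (P : hull -> Prop) : (forall s, P (\pi_hull s)) -> forall e, P e.
Proof. by move=> H e; rewrite -[e]reprK. Qed.

Lemma haddA : associative hadd.
Proof.
elim/hull_ind => s; elim/hull_ind => t; elim/hull_ind => r.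
by rewrite !hadd_pi catA.
Qed.

Lemma haddC : commutative hadd.
Proof.
elim/hull_ind => s; elim/hull_ind => t; rewrite !hadd_pi.
by apply: hull_piP; apply: hull_perm; rewrite perm_catC.
Qed.

Lemma hadd0 : left_id hzero hadd.
Proof. by elim/hull_ind => s; rewrite /hzero hadd_pi. Qed.

Lemma fscale_addl (c d : R) (s : fsum) :
  hull_rel (fscale c s ++ fscale d s) (fscale (c + d) s).
Proof.
elim: s => [|[l a] s IH]; first exact: hull_refl.
apply: (@hull_trans _ ([:: (c * l, a); (d * l, a)] ++
                       (fscale c s ++ fscale d s))).
  apply: hull_perm; rewrite /= perm_cons.
  by rewrite -[(d * l, a) :: fscale d s]cat1s perm_catCA.
change (hull_rel ([:: (c * l, a); (d * l, a)] ++ (fscale c s ++ fscale d s))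
  ([:: ((c + d) * l, a)] ++ fscale (c + d) s)).
by apply: hull_cat => //; rewrite mulrDl; exact: hull_plus.
Qed.

Lemma fscale0 (s : fsum) : hull_rel (fscale 0 s) [::].
Proof.
elim: s => [|[l a] s IH]; first exact: hull_refl.
rewrite /= mul0r -cat1s -[X in hull_rel _ X]cat0s.
by apply: hull_cat => //; exact: hull_zero.
Qed.

Lemma fscale1 (s : fsum) : fscale 1 s = s.
Proof. by elim: s => //= -[l a] s ->; rewrite mul1r. Qed.

Lemma haddN : left_inverse hzero hopp hadd.
Proof.
elim/hull_ind => s; rewrite /hopp hscale_pi hadd_pi; apply: hull_piP.
rewrite -[X in _ ++ X]fscale1; apply: hull_trans (fscale_addl _ _ _) _.
by rewrite addNr; exact: fscale0.
Qed.

HB.instance Definition _ :=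
  GRing.isZmodule.Build hull haddA haddC hadd0 haddN.

Lemma hscaleA (a b : R) (e : hull) : hscale a (hscale b e) = hscale (a * b) e.
Proof.
elim/hull_ind: e => s; rewrite !hscale_pi /fscale -map_comp; congr (\pi_hull _).
by apply: eq_map => p /=; rewrite mulrA.
Qed.

Lemma hscale1 : left_id 1 hscale.
Proof. by elim/hull_ind => s; rewrite hscale_pi fscale1. Qed.

Lemma hscaleDr : right_distributive hscale +%R.
Proof.
move=> c; elim/hull_ind => s; elim/hull_ind => t.
by rewrite [LHS]/hscale /GRing.add /= hadd_pi !hscale_pi hadd_pi -map_cat
  -/(hscale c (\pi_hull (s ++ t))) hscale_pi.
Qed.

Lemma hscaleDl (e : hull) : {morph hscale^~ e : a b / a + b}.
Proof.
move=> a b; elim/hull_ind: e => s.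
rewrite !hscale_pi /GRing.add /= hadd_pi; apply/esym/hull_piP.
exact: fscale_addl.
Qed.

HB.instance Definition _ :=
  GRing.Zmodule_isLmodule.Build R hull hscaleA hscale1 hscaleDr hscaleDl.

Definition hgen (a : T) : hull := \pi_hull [:: (1, a)].

End Hull.

(** * Smooth calculus, atlases, cotangent bundles *)

Section Smooth.
Variable R : realType.

Fixpoint Ck (n k : nat) (U : set 'rV[R]_n) (f : 'rV[R]_n -> R) : Prop :=
  match k with
  | 0 => forall z, U z -> {for z, continuous f}
  | k'.+1 => (forall z, U z -> differentiable f z) /\
             forall i, Ck k' U (fun z => 'D_(delta_mx 0 i) f z)
  end.

(* Meant for open U only. *)
Definition smooth_on (n : nat) (U : set 'rV[R]_n) (f : 'rV[R]_n -> R) : Prop :=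
  forall k, Ck k U f.

Record chart (T : Type) (N : nat) : Type :=
  Chart { cdom : set T; cmap :> T -> 'rV[R]_N }.

(* Spaces (manifolds) are given as subsets [scar] of a type of "raw" points,
   with an atlas.  The topology is the one of the atlas. *)
Record space : Type := Space {
  spt :> Type;
  scar : set spt;
  sdim : nat;
  satl : set (chart spt sdim) }.

(* f read in the chart c (0 outside of the image of c) *)
Definition crep (T : Type) (N : nat) (c : chart T N) (f : T -> R) :
    'rV[R]_N -> R :=
  fun z => get [set f q | q in [set q | cdom c q /\ c q = z]].

Definition grad (T : Type) (N : nat) (c : chart T N) (f : T -> R) (p : T) :
    'rV[R]_N :=
  \row_i 'D_(delta_mx 0 i) (crep c f) (c p).

Definition smooth_at (X : space) (f : X -> R) (p : X) : Prop :=
  exists (c : chart X (sdim X)) (W : set 'rV[R]_(sdim X)),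
    [/\ satl c, cdom c p, open W & W (c p)] /\
    (W `<=` c @` cdom c /\ smooth_on W (crep c f)).

Definition smooth_map_at (X Y : space) (F : X -> Y) (p : X) : Prop :=
  exists (c : chart X (sdim X)) (d : chart Y (sdim Y))
         (W : set 'rV[R]_(sdim X)),
    [/\ satl c, satl d, cdom c p, open W & W (c p)] /\
    (W `<=` c @` (cdom c `&` F @^-1` cdom d) /\
     forall i, smooth_on W (crep c (fun q => d (F q) 0 i))).

Definition smooth_map (X Y : space) (F : X -> Y) : Prop :=
  forall p, scar p -> scar (F p) /\ smooth_map_at F p.

Definition diffeo (X Y : space) (F : X -> Y) : Prop :=
  smooth_map F /\ exists G : Y -> X,
    [/\ smooth_map G, forall p, scar p -> G (F p) = p &
        forall q, scar q -> F (G q) = q].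

(* d_p f = 0 *)
Definition dzero (X : space) (f : X -> R) (p : X) : Prop :=
  forall c : chart X (sdim X), satl c -> cdom c p -> grad c f p = 0.

(* The covector d_p f is the class of f among the functions smooth near p. *)
Definition dcov (X : space) (p : X) (f : X -> R) : X * set (X -> R) :=
  (p, [set g | smooth_at g p /\ dzero (fun q => g q - f q) p]).

Definition is_covector (X : space) (w : X * set (X -> R)) : Prop :=
  scar w.1 /\ exists f, smooth_at f w.1 /\ w = dcov w.1 f.

(* (x; p), with p the components of the covector in the basis dx *)
Definition cotangent_chart (X : space) (c : chart X (sdim X)) :
    chart (X * set (X -> R)) (sdim X + sdim X) :=
  Chart [set w | is_covector w /\ cdom c w.1]
        (fun w => row_mx (c w.1) (get [set grad c f w.1 | f in w.2])).

Definition cotangent (X : space) : space :=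
  Space [set w : X * set (X -> R) | is_covector w]
        [set cotangent_chart c | c in @satl X].

(** * Manifolds and bundles *)

(* The point of [mpt] plays no role: it only makes M nonempty. *)
Record manifold : Type := Manifold {
  mpt :> ptopologicalType;
  mdim : nat;
  matl : set (chart mpt mdim) }.

Definition chart_ok (T : topologicalType) (N : nat) (c : chart T N) : Prop :=
  [/\ open (cdom c), set_inj (cdom c) c,
      forall V, open V -> open (cdom c `&` c @^-1` V) &
      forall U, open U -> U `<=` cdom c -> open (c @` U)].

Definition is_manifold (M : manifold) : Prop :=
  [/\ hausdorff_space M, @second_countable M, connected [set: M] &
   [/\ forall c, @matl M c -> chart_ok c,
       forall m : M, exists2 c, @matl M c & cdom c m &
       forall c c', @matl M c -> @matl M c' ->
         forall i, smooth_on (c @` (cdom c `&` cdom c'))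
                             (crep c (fun m => c' m 0 i))]].

Definition mspace (M : manifold) : space := Space [set: M] (@matl M).

Section Bundles.
Variable M : manifold.

Record triv (F : M -> Type) (r : nat) : Type :=
  Triv { tdom : set M; tmap :> forall m, F m -> 'rV[R]_r }.

(* (x; y) *)
Definition bchart (F : M -> Type) (C : forall m, set (F m)) (r : nat)
    (c : chart M (mdim M)) (t : triv F r) : chart {m : M & F m} (mdim M + r) :=
  Chart [set p | C (tag p) (tagged p) /\ (cdom c (tag p) /\ tdom t (tag p))]
        (fun p => row_mx (c (tag p)) (t (tag p) (tagged p))).

(* The total space of the bundle whose fibre over m is C m, a subset of F m. *)
Definition bspace (F : M -> Type) (C : forall m, set (F m)) (r : nat)
    (ts : set (triv F r)) : space :=
  @Space {m : M & F m} [set p | C (tag p) (tagged p)] (mdim M + r)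
    [set b | exists c t, [/\ matl c, ts t & b = bchart C c t]].

Definition triv_compat (F : M -> Type) (r : nat) (t t' : triv F r) : Prop :=
  forall c, matl c -> forall i,
    let b := bchart (fun m => [set: F m]) c t in
    smooth_on (b @` (cdom b `&` [set p | tdom t' (tag p)]))
              (crep b (fun p => t' (tag p) (tagged p) 0 i)).

Record vbundle : Type := VBundle {
  vrk : nat;
  vfib :> M -> lmodType R;
  vtrivs : set (triv (fun m => vfib m) vrk) }.

Definition vspace (V : vbundle) : space :=
  bspace (fun m => [set: V m]) (@vtrivs V).

(* coordinates dual to those of t *)
Definition dual_triv (V : vbundle) (t : triv (fun m => V m) (vrk V)) :
    triv (fun m => dual (V m)) (vrk V) :=
  Triv (tdom t) (fun m f =>
    get [set xi : 'rV[R]_(vrk V) | forall e, dapp f e = \sum_i xi 0 i * t m e 0 i]).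

Definition dual_bundle (V : vbundle) : vbundle :=
  @VBundle (vrk V) (fun m => dual (V m)) [set dual_triv t | t in @vtrivs V].

Definition vshift (V : vbundle) (p : {m : M & V m}) (w : V (tag p)) :
    {m : M & V m} :=
  existT _ (tag p) (tagged p + w).

(* <w, X> for X the vertical lift of u at the base point of w *)
Definition vpair (V : vbundle) (w : cotangent (vspace V)) (u : V (tag w.1)) :
    R :=
  get [set derive1 (fun s : R => f (vshift (s *: u)) : R^o) 0 | f in w.2].

(* (x; y; p; pi) |-> (x; pi; - p; y) *)
Definition beta_coord (n k : nat) (z : 'rV[R]_((n + k) + (n + k))) :
    'rV[R]_((n + k) + (n + k)) :=
  row_mx (row_mx (lsubmx (lsubmx z)) (rsubmx (rsubmx z)))
         (row_mx (- lsubmx (rsubmx z)) (rsubmx (lsubmx z))).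

Definition vchart (V : vbundle) (c : chart M (mdim M))
    (t : triv (fun m => V m) (vrk V)) : chart (vspace V) (sdim (vspace V)) :=
  bchart (fun m => [set: V m]) c t.

(* beta : T^*V -> T^*V^*, characterised by its form in every system of adapted
   coordinates around the base point *)
Definition beta (V : vbundle) (w : cotangent (vspace V)) :
    cotangent (vspace (dual_bundle V)) :=
  @the (cotangent (vspace (dual_bundle V)))
    (existT (fun m => dual (V m)) (tag w.1) 0, set0)
    [set w' : cotangent (vspace (dual_bundle V)) |
      [/\ is_covector w', tag w'.1 = tag w.1 &
       forall c t, matl c -> vtrivs t -> cdom c (tag w.1) -> tdom t (tag w.1) ->
         cotangent_chart (vchart (V := dual_bundle V) c (dual_triv t)) w' =
         beta_coord (cotangent_chart (vchart c t) w)]].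

(** * Special affine bundles *)

(* Raw data; the axioms are in [is_sabundle] below.
   Each fibre [afib m] is an affine space modelled on [amod m], and [adist] is
   the distinguished section of the model bundle.  The rank is r + 1, since a
   bundle of rank 0 has no nowhere vanishing section. *)
Record sabundle : Type := SABundle {
  ark : nat;
  afib : M -> Type;
  amod : M -> lmodType R;
  aadd : forall m, afib m -> amod m -> afib m;
  asub : forall m, afib m -> afib m -> amod m;   (* asub b a = b - a *)
  atrivs : set (triv afib (1 + ark));
  adist : forall m, amod m }.

Section OneBundle.
Variable A : sabundle.

(* l a + (1 - l) b *)
Definition acomb (m : M) (l : R) (a b : afib A m) : afib A m :=
  aadd b (l *: asub a b).

(* a + s v_A *)
Definition avshift (m : M) (a : afib A m) (s : R) : afib A m :=
  aadd a (s *: adist A m).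

(* a bijective affine map onto R^(1+r), with its linear part *)
Definition affine_iso_with (m : M) (phi : afib A m -> 'rV[R]_(1 + ark A))
    (L : amod A m -> 'rV[R]_(1 + ark A)) : Prop :=
  [/\ bijective phi, forall (s : R) u w, L (s *: u + w) = s *: L u + L w &
      forall a u, phi (aadd a u) = phi a + L u].

Definition tlin (t : triv (afib A) (1 + ark A)) (m : M) (u : amod A m) :
    'rV[R]_(1 + ark A) :=
  get [set t m (aadd a u) - t m a | a in [set: afib A m]].

Definition affine_triv (t : triv (afib A) (1 + ark A)) : Prop :=
  open (tdom t) /\
  forall m, tdom t m -> exists L, affine_iso_with (t m) L.

Definition is_sabundle : Prop :=
  [/\ forall m : M,
        [/\ forall a : afib A m, aadd a 0 = a,
            forall (a : afib A m) u w, aadd (aadd a u) w = aadd a (u + w),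
            forall a b : afib A m, aadd b (asub a b) = a &
            forall (a : afib A m) u, asub (aadd a u) a = u],
      forall t, atrivs t -> affine_triv t,
      forall m, exists2 t, atrivs t & @tdom (afib A) _ t m,
      forall t t', @atrivs A t -> atrivs t' -> triv_compat t t' &
      (forall m, adist A m != 0) /\
      forall t c, @atrivs A t -> matl c -> forall i,
        smooth_on (c @` (cdom c `&` tdom t))
                  (crep c (fun m => tlin t (adist A m) 0 i))].

(* Trivialisations in the maximal atlas with coordinates (u; y) in which v_A
   is the first basis vector.  As v_A vanishes nowhere, they cover M, and they
   define the same smooth structure as [atrivs]. *)
Definition adapted : set (triv (afib A) (1 + ark A)) :=
  [set t | [/\ affine_triv t,
               forall t', atrivs t' -> triv_compat t t' /\ triv_compat t' t &
               forall m, tdom t m ->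
                 tlin t (adist A m) = row_mx (const_mx 1) 0]].

Definition ucoord (t : triv (afib A) (1 + ark A)) (p : {m : M & afib A m}) : R :=
  t (tag p) (tagged p) 0 (lshift (ark A) 0).

Definition aspace : space := bspace (fun m => [set: afib A m]) adapted.

(** The quotient A/<v_A>: its points over m are the lines a + R v_A. *)

Definition zeta (m : M) (a : afib A m) : set (afib A m) :=
  [set avshift a s | s in [set: R]].

Definition is_line (m : M) (S : set (afib A m)) : Prop := exists a, S = zeta a.

Definition line_triv (t : triv (afib A) (1 + ark A)) :
    triv (fun m => set (afib A m)) (ark A) :=
  Triv (tdom t) (fun m S => get [set rsubmx (t m a) | a in S]).

Definition line_pt : Type := {m : M & set (afib A m)}.

Definition line_space : space :=
  bspace (fun m => [set S : set (afib A m) | is_line S])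
         [set line_triv t | t in adapted].

(* l p + (1 - l) q, for p and q over the same point *)
Definition line_comb (l : R) (p q : line_pt) : line_pt :=
  existT _ (tag p) [set x | exists a S b,
    [/\ tagged p a, q = existT _ (tag p) S, S b & x = acomb l a b]].

(** Sections of zeta *)

Definition section : Type := forall m, set (afib A m) -> afib A m.

Definition is_section (sg : section) : Prop :=
  forall m (S : set (afib A m)), is_line S -> zeta (sg m S) = S.

Definition sec_map (sg : section) : line_space -> aspace :=
  fun p => existT _ (tag p) (sg (tag p) (tagged p)).

(* Sections are only required to be smooth near the point where the jet is
   taken. *)
Definition section_at (p : line_space) (sg : section) : Prop :=
  is_section sg /\ smooth_map_at (sec_map sg) p.

(* sg - sg' is the function h such that sg = sg' + h (- v_A) *)
Definition sec_sub (sg sg' : section) : line_space -> R :=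
  fun p => get [set h | sg (tag p) (tagged p) =
                        avshift (sg' (tag p) (tagged p)) (- h)].

(* sg + h (- v_A) *)
Definition sec_add (sg : section) (h : line_space -> R) : section :=
  fun m S => avshift (sg m S) (- h (existT _ m S)).

(* f_sg x v_A = x - sg (zeta x) *)
Definition fsec (sg : section) : aspace -> R :=
  fun x => get [set s | avshift (sg (tag x) (zeta (tagged x))) s = tagged x].

(* smooth sections over a neighbourhood of m, affine on fibres *)
Definition affine_section (m : M) (sg : section) : Prop :=
  is_section sg /\
  exists U : set M, [/\ open U, U m &
    forall m', U m' ->
      (forall S, is_line S -> smooth_map_at (sec_map sg) (existT _ m' S)) /\
      forall (l : R) (S S' : set (afib A m')), is_line S -> is_line S' ->
        sg m' (tagged (line_comb l (existT _ m' S) (existT _ m' S'))) =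
        acomb l (sg m' S) (sg m' S')].

(** The contact bundle *)

Definition cpt : Type := line_pt * set section.

(* c_p sg, as a pair (p, class of sg) *)
Definition jet (p : line_space) (sg : section) : cpt :=
  (p, [set sg' | [/\ section_at p sg', sec_map sg' p = sec_map sg p &
                     dzero (sec_sub sg' sg) p]]).

Definition is_jet (c : cpt) : Prop :=
  is_line (tagged c.1) /\ exists sg, section_at c.1 sg /\ c = jet c.1 sg.

Definition line_chart (c : chart M (mdim M))
    (t : triv (afib A) (1 + ark A)) : chart line_space (sdim line_space) :=
  bchart (fun m => [set S : set (afib A m) | is_line S]) c (line_triv t).

(* (x, y; u(sg); du(sg)/dx, du(sg)/dy) *)
Definition jet_chart (c : chart M (mdim M)) (t : triv (afib A) (1 + ark A)) :
    chart cpt ((sdim line_space) + (1 + sdim line_space)) :=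
  Chart [set j | is_jet j /\ cdom (line_chart c t) j.1]
    (fun j => row_mx (line_chart c t j.1)
      (get [set row_mx (const_mx (ucoord t (sec_map sg j.1)))
                       (grad (line_chart c t) (ucoord t \o sec_map sg) j.1)
           | sg in j.2])).

Definition contact_space : space :=
  Space [set j : cpt | is_jet j]
    [set b | exists c t, [/\ matl c, adapted t & b = jet_chart c t]].

(* j + (w, r), for a covector w on A/<v_A> at the base point of j and r in R *)
Definition jet_add (j : cpt) (w : cotangent line_space) (r : R) : cpt :=
  (j.1, [set sg' | exists sg h, [/\ j.2 sg, w.2 h &
     (jet j.1 (sec_add sg (fun q => h q - h j.1 + r))).2 sg']]).

(* translation by r times the distinguished section (0, 1) *)
Definition jet_shift (r : R) (j : cpt) : cpt :=
  jet_add j (dcov (X := line_space) j.1 (fun=> 0)) r.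

(* j1 = j2 + (d h, h), hence j2 + l (j1 - j2) is given by l h *)
Definition contact_comb1 (l : R) (j1 j2 : cpt) : cpt :=
  (j1.1, [set sg' | exists sg1 sg2, [/\ j1.2 sg1, j2.2 sg2 &
     (jet j1.1 (sec_add sg2 (fun q => l * sec_sub sg1 sg2 q))).2 sg']]).

End OneBundle.

(** The adjoint and the affine dual *)

Definition adjoint (A : sabundle) : sabundle :=
  @SABundle (ark A) (afib A) (amod A) (@aadd A) (@asub A) (@atrivs A)
            (fun m => - adist A m).

Section AffineDual.
Variable A : sabundle.

Definition affine_fun (m : M) (f : afib A m -> R) : Prop :=
  forall (l : R) a b, f (acomb l a b) = l * f a + (1 - l) * f b.

(* affine functions whose linear part takes the value s on v_A *)
Definition sharp_pred (s : R) (m : M) : set (afib A m -> R^o) :=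
  [set f | affine_fun f /\ forall a, f (aadd a (adist A m)) - f a = s].

Lemma sharp_pred_comb (r s s' : R) (m : M) (f g : afib A m -> R^o) :
  sharp_pred s f -> sharp_pred s' g ->
  sharp_pred (r * s + s') (fun a => r * f a + g a).
Proof.
move=> [Hf fs] [Hg gs]; split=> [l a b|a].
  by rewrite Hf Hg; ring.
by rewrite -(fs a) -(gs a); ring.
Qed.

Lemma sharp_mod_submod (m : M) : submod (@sharp_pred 0 m).
Proof.
split=> [|r f g Hf Hg].
  split=> [l a b|a]; first by change (0 = l * 0 + (1 - l) * 0 :> R); ring.
  by change (0 - 0 = 0 :> R); rewrite subr0.
have := sharp_pred_comb r Hf Hg; by rewrite mulr0 addr0.
Qed.

Definition sharp_fib (m : M) : Type := {f : afib A m -> R^o | sharp_pred 1 f}.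
Definition sharp_mod (m : M) : lmodType R := sublmod (sharp_mod_submod m).

Lemma sharp_add_subproof (m : M) (f : sharp_fib m) (g : sharp_mod m) :
  sharp_pred 1 (fun a => 1 * sublmod_val g a + sval f a).
Proof.
case: f g => [f Hf] [g Hg] /=; move/asboolP: Hg => Hg.
by have := sharp_pred_comb 1 Hg Hf; rewrite mulr0 add0r.
Qed.

Lemma sharp_sub_subproof (m : M) (f f' : sharp_fib m) :
  sharp_pred 0 (fun a => -1 * sval f' a + sval f a).
Proof.
case: f f' => [f Hf] [f' Hf'] /=.
by have := sharp_pred_comb (-1) Hf' Hf; rewrite mulN1r addNr.
Qed.

Lemma sharp_one_subproof (m : M) : sharp_pred 0 (fun _ : afib A m => 1).
Proof. by split=> [l a b|a]; [ring|rewrite subrr]. Qed.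

(* For adapted coordinates (u; y) of A, the function c + u + eta y has
   coordinates (c; eta). *)
Definition sharp_triv (t : triv (afib A) (1 + ark A)) :
    triv sharp_fib (1 + ark A) :=
  Triv (tdom t) (fun m f => get [set z : 'rV[R]_(1 + ark A) |
    forall a, sval f a = z 0 (lshift _ 0) + t m a 0 (lshift _ 0) +
      \sum_(j < ark A) z 0 (rshift 1 j) * t m a 0 (rshift 1 j)]).

Definition sharp : sabundle :=
  @SABundle (ark A) sharp_fib sharp_mod
    (fun m f g => exist _ _ (sharp_add_subproof f g))
    (fun m f f' => Sublmod (introT (asboolP _) (sharp_sub_subproof f f')))
    [set sharp_triv t | t in @adapted A]
    (fun m => Sublmod (introT (asboolP _) (sharp_one_subproof m))).

End AffineDual.

(** The second fibration of the contact bundle, over A^#/<1_A> *)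

Section Contact.
Variable A : sabundle.

Definition contact_proj2 (j : cpt A) : line_pt (sharp A) :=
  existT _ (tag j.1) [set g : afib (sharp A) (tag j.1) | exists sg s,
    [/\ affine_section (tag j.1) sg, j.2 sg &
        forall x, sval g x = fsec sg (existT _ (tag j.1) x) + s]].

(* j + (alpha, r), with alpha = d g pulled back from M *)
Definition jet_add_base (j : cpt A) (g : M -> R) (r : R) : cpt A :=
  jet_add j (dcov (X := line_space A) j.1 (fun q => g (tag q))) r.

Definition contact_comb2 (l : R) (j1 j2 : cpt A) : cpt A :=
  the j1 [set j | exists sg0 (g1 g2 : M -> R) (r1 r2 : R),
    [/\ affine_section (tag j1.1) sg0,
        exists f : afib (sharp A) (tag j1.1), tagged (contact_proj2 j1) f /\
          forall x, sval f x = fsec sg0 (existT _ (tag j1.1) x),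
        smooth_at (X := mspace M) g1 (tag j1.1) /\
        smooth_at (X := mspace M) g2 (tag j1.1),
        j1 = jet_add_base (jet j1.1 sg0) g1 r1 /\
        j2 = jet_add_base (jet j2.1 sg0) g2 r2 &
        j = jet_add_base (jet (line_comb l j1.1 j2.1) sg0)
              (fun m => l * g1 m + (1 - l) * g2 m) (l * r1 + (1 - l) * r2)]].

End Contact.

(** * Double affine bundles over M *)

Record dabundle : Type := DABundle {
  dtot : space;
  dside1 : space;
  dside2 : space;
  dp1 : dtot -> dside1;
  dp2 : dtot -> dside2;
  dq1 : dside1 -> M;
  dq2 : dside2 -> M;
  dcomb1 : R -> dtot -> dtot -> dtot;        (* in the fibres of dp1 *)
  dcomb2 : R -> dtot -> dtot -> dtot;        (* in the fibres of dp2 *)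
  dscomb1 : R -> dside1 -> dside1 -> dside1; (* in the fibres of dq1 *)
  dscomb2 : R -> dside2 -> dside2 -> dside2  (* in the fibres of dq2 *) }.

Definition flip (D : dabundle) : dabundle :=
  DABundle (@dp2 D) (@dp1 D) (@dq2 D) (@dq1 D)
           (@dcomb2 D) (@dcomb1 D) (@dscomb2 D) (@dscomb1 D).

(* isomorphisms over the identity of M; exchanging the side bundles is expressed
   with [flip] *)
Definition dab_iso (D D' : dabundle) (Phi : dtot D -> dtot D') : Prop :=
  exists (Phi1 : dside1 D -> dside1 D') (Phi2 : dside2 D -> dside2 D'),
  [/\ diffeo Phi /\ (diffeo Phi1 /\ diffeo Phi2),
      forall c, scar c ->
        dp1 (Phi c) = Phi1 (dp1 c) /\ dp2 (Phi c) = Phi2 (dp2 c),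
      (forall a, scar a -> dq1 (Phi1 a) = dq1 a) /\
      (forall a, scar a -> dq2 (Phi2 a) = dq2 a),
      (forall l c c', scar c -> scar c' -> dp1 c = dp1 c' ->
         Phi (dcomb1 l c c') = dcomb1 l (Phi c) (Phi c')) /\
      (forall l c c', scar c -> scar c' -> dp2 c = dp2 c' ->
         Phi (dcomb2 l c c') = dcomb2 l (Phi c) (Phi c')) &
      (forall l a a', scar a -> scar a' -> dq1 a = dq1 a' ->
         Phi1 (dscomb1 l a a') = dscomb1 l (Phi1 a) (Phi1 a')) /\
      (forall l a a', scar a -> scar a' -> dq2 a = dq2 a' ->
         Phi2 (dscomb2 l a a') = dscomb2 l (Phi2 a) (Phi2 a'))].

(* the structure of D carried over to Y by mutually inverse f : D -> Y and g *)
Definition dab_transport (D : dabundle) (Y : space) (f : dtot D -> Y)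
    (g : Y -> dtot D) : dabundle :=
  @DABundle Y (dside1 D) (dside2 D) (@dp1 D \o g) (@dp2 D \o g)
    (@dq1 D) (@dq2 D)
    (fun l y y' => f (dcomb1 l (g y) (g y')))
    (fun l y y' => f (dcomb2 l (g y) (g y')))
    (@dscomb1 D) (@dscomb2 D).

Definition contact (A : sabundle) : dabundle :=
  @DABundle (contact_space A) (line_space A) (line_space (sharp A))
    fst (@contact_proj2 A) (fun p => tag p) (fun p => tag p)
    (@contact_comb1 A) (@contact_comb2 A) (@line_comb A) (@line_comb (sharp A)).

(** * Double affine duals *)

(* A as an affine hyperplane bundle {ealpha = 1} in a vector bundle *)
Record embedding (A : sabundle) : Type := Embedding {
  evb :> vbundle;
  emap : forall m, afib A m -> evb m;
  evec : forall m, evb m;             (* v_A *)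
  ealpha : forall m, evb m -> R }.

Section DoubleDual.
Variables (A : sabundle) (E : embedding A).

Definition etot (x : aspace A) : vspace E :=
  existT _ (tag x) (emap E (tagged x)).

Definition is_B (w : cotangent (vspace E)) : Prop :=
  [/\ is_covector w, exists x, w.1 = etot x & vpair (evec E (tag w.1)) = 1].

(* phi_s *)
Definition translate (s : R) (p : vspace E) : vspace E :=
  vshift (s *: evec E (tag p)).

(* (phi_(-s))^* *)
Definition psi1 (s : R) (w : cotangent (vspace E)) : cotangent (vspace E) :=
  (translate s w.1, [set f \o translate (- s) | f in w.2]).

(* w + s d alpha *)
Definition psi2 (s : R) (w : cotangent (vspace E)) : cotangent (vspace E) :=
  (w.1, [set (fun p => f p + s * @ealpha A E _ (tagged p)) | f in w.2]).

Definition orbit1 (w : cotangent (vspace E)) : set (cotangent (vspace E)) :=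
  [set psi1 s w | s in [set: R]].
Definition orbit2 (w : cotangent (vspace E)) : set (cotangent (vspace E)) :=
  [set psi2 s w | s in [set: R]].

(* The psi2-orbit corresponding to the jet j = c_a sg consists of the covectors
   in BA at sg(a) whose restriction to T A is d f_sg. *)
Definition kappa (j : cpt A) : set (cotangent (vspace E)) :=
  [set w | is_B w /\ exists sg F,
    [/\ j.2 sg, w.2 F, w.1 = etot (sec_map sg j.1) &
        dzero (fun x : aspace A => F (etot x) - fsec sg x) (sec_map sg j.1)]].

Definition kappa_inv (O : set (cotangent (vspace E))) : cpt A :=
  the (existT _ point set0, set0) [set j | is_jet j /\ kappa j = O].

(* A psi2-orbit in BA meets in exactly one point the hypersurface where the
   covector vanishes on the Euler vector field of E, and this hypersurface is
   also transversal to the psi1-orbits; tau sends a psi2-orbit to the psi1-orbit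
   of this point. *)
Definition tau (O : set (cotangent (vspace E))) : set (cotangent (vspace E)) :=
  [set w | exists w0, [/\ O w0, vpair (tagged w0.1) = 0 & orbit1 w0 w]].

End DoubleDual.

(** The vector hull and its dual *)

Section HullBundle.
Variable A : sabundle.

Definition hfib (m : M) : lmodType R := hull (@acomb A m).

(* the linear function on the hull with value f a on x_a *)
Definition linext (m : M) (f : afib A m -> R) : dual (hfib m) :=
  the 0 [set g | forall a, dapp g (hgen (@acomb A m) a) = f a].

(* coordinates (alpha; u; y) *)
Definition hull_triv (t : triv (afib A) (1 + ark A)) :
    triv (fun m => hfib m) (1 + (1 + ark A)) :=
  Triv (tdom t) (fun m e =>
    row_mx (const_mx (dapp (linext (fun=> 1)) e))
           (\row_i dapp (linext (fun a => t m a 0 i)) e)).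

Definition hull_bundle : vbundle :=
  VBundle [set hull_triv t | t in @adapted A].

Definition hull_embedding : embedding A :=
  @Embedding A hull_bundle (fun m a => hgen (@acomb A m) a)
    (fun m => the 0 [set e | exists a : afib A m,
       e = hgen (@acomb A m) (aadd a (adist A m)) - hgen (@acomb A m) a])
    (fun m e => dapp (linext (fun=> 1)) e).

(* A^# = {f in E^* : f(v_A) = 1}, with distinguished section alpha_A *)
Definition dual_embedding : embedding (sharp A) :=
  @Embedding (sharp A) (dual_bundle hull_bundle)
    (fun m f => linext (sval f))
    (fun m => linext (fun=> 1))
    (fun m f => dapp f (evec hull_embedding m)).

(** The quotients of BA, with coordinates induced from those of T^*E,
    (x; alpha, u, y; p; pi_alpha, pi_u, pi_y), where alpha = pi_u = 1 on BA *)

Definition cov : space := cotangent (vspace hull_bundle).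
Definition is_BA (w : cov) : Prop := is_B (E := hull_embedding) w.
Definition BA_orbit1 (w : cov) : set cov := orbit1 (E := hull_embedding) w.
Definition BA_orbit2 (w : cov) : set cov := orbit2 (E := hull_embedding) w.

(* u is dropped: (x, y; p; pi_alpha, pi_y) *)
Definition quot1_coord (n k : nat)
    (z : 'rV[R]_((n + (1 + (1 + k))) + (n + (1 + (1 + k))))) :
    'rV[R]_((n + k) + (n + (1 + k))) :=
  row_mx (row_mx (lsubmx (lsubmx z)) (rsubmx (rsubmx (rsubmx (lsubmx z)))))
    (row_mx (lsubmx (rsubmx z))
      (row_mx (lsubmx (rsubmx (rsubmx z)))
              (rsubmx (rsubmx (rsubmx (rsubmx z)))))).

(* pi_alpha is dropped: (x, u, y; p; pi_y) *)
Definition quot2_coord (n k : nat)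
    (z : 'rV[R]_((n + (1 + (1 + k))) + (n + (1 + (1 + k))))) :
    'rV[R]_((n + (1 + k)) + (n + k)) :=
  row_mx (row_mx (lsubmx (lsubmx z)) (rsubmx (rsubmx (lsubmx z))))
    (row_mx (lsubmx (rsubmx z)) (rsubmx (rsubmx (rsubmx (rsubmx z))))).

Definition quot_space (orb : cov -> set cov) (N : nat)
    (q : 'rV[R]_((mdim M + (1 + (1 + ark A))) + (mdim M + (1 + (1 + ark A)))) ->
         'rV[R]_N) : space :=
  @Space (set cov) [set O | exists2 w, is_BA w & O = orb w] N
    [set b | exists c t, [/\ matl c, @adapted A t &
       b = Chart [set O | exists w, [/\ is_BA w, O = orb w,
                            cdom c (tag w.1) & tdom t (tag w.1)]]
             (fun O => get [set q (cotangent_chart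
                (vchart (V := hull_bundle) c (hull_triv t)) w) | w in O])]].

(* BA/(R x {0}) and BA/({0} x R) *)
Definition quot1 : space :=
  quot_space BA_orbit1 (@quot1_coord (mdim M) (ark A)).
Definition quot2 : space :=
  quot_space BA_orbit2 (@quot2_coord (mdim M) (ark A)).

Definition kappaA : contact_space A -> quot2 := kappa (E := hull_embedding).
Definition kappaA_inv : quot2 -> contact_space A :=
  kappa_inv (E := hull_embedding).
Definition tauA : quot2 -> quot1 := tau (E := hull_embedding).

(* beta on psi1-orbits, with values in the psi2-orbits of BA^#, and its inverse *)
Definition beta_quot (O : quot1) :
    set (cotangent (vspace (dual_bundle hull_bundle))) :=
  beta (V := hull_bundle) @` O.
Definition beta_quot_inv
    (O : set (cotangent (vspace (dual_bundle hull_bundle)))) : quot1 :=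
  [set w | is_BA w /\ O (beta (V := hull_bundle) w)].

(* The double affine structures of the quotients: those of CA and of CA^#. *)
Definition dab_quot2 : dabundle :=
  @dab_transport (contact A) quot2 kappaA kappaA_inv.
Definition dab_quot1 : dabundle :=
  @dab_transport (flip (contact (sharp A))) quot1
    (fun j => beta_quot_inv (kappa (E := dual_embedding) j))
    (fun O => kappa_inv (E := dual_embedding) (beta_quot O)).

Definition contact_iso (j : cpt A) : cpt (sharp A) :=
  kappa_inv (E := dual_embedding) (beta_quot (tauA (kappaA j))).

End HullBundle.

(* an isomorphism of double affine bundles respecting the distinguished sections,
   that is, commuting with translation by (0, 1) *)
Definition special_contact_iso (A' B : sabundle)
    (Phi : cpt A' -> cpt B) : Prop :=
  dab_iso (D := contact A') (D' := flip (contact B)) Phi /\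
  forall j : cpt A', is_jet j ->
    Phi (jet_shift (A := A') 1 j) = jet_shift (A := B) 1 (Phi j).

End Bundles.
End Smooth.

(* Main.v *)
(* In a frame, that is, a chart x of M and adapted coordinates (u; y) of A, the
   bundle BA consists of the covectors (x; 1, u, y; p; b, 1, w): psi_1 moves u,
   psi_2 moves b, the Euler vector field takes the value b + u + <w, y>, and beta
   exchanges (1, u, y) with (b, 1, w) and changes the sign of p.  A jet of CA is
   given by (y; s; x', w), with s the value and (x', w) the differential of the
   u-coordinate of a section at y, and corresponds to the psi_2-orbit of
   (x; 1, s, y; -x'; b, 1, -w).  Hence CA -> CA^# is the Legendre transformation
   (y; s; x', w) |-> (-w; <w, y> - s; -x', -y) in every frame.  It is a
   diffeomorphism, it is affine in (s, x', w) for fixed y and in (y, s, x') for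
   fixed w, and it reverses translations in s.  Passing to the adjoint of A
   changes the signs of s, x' and w in the coordinates of a jet, so that the
   translations in s are then preserved. *)

(* The objects of the statement are chart-free: jets and covectors are classes of sections or
   functions, and [beta], [kappa_inv] and many coordinates are chosen by [get] or [the]. Such a
   choice computes only once a member of the defining set is exhibited and shown to be unique. Each
   object is therefore given a normal form in a frame ([cjet] for jets, [ccov] and [BAc] for
   covectors), and each construction is shown to send normal forms to normal forms. Two of them need
   a genuine argument. The formula for [beta] must hold in all adapted coordinates at once; this
   follows from a frame-free description by critical points of the pairing of a bundle with its
   dual. The map [kappa] must be injective for [kappa_inv] to be its inverse; this is proved for an
   abstract embedding, which covers both A in its hull and the affine dual in the dual of the hull.
   Since the final map has the same expression in every frame, pairs of charts over a common frame
   suffice, and no transition between jet charts or between charts of the quotients is computed.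
   That [tau] respects the double affine structures is deduced by conjugation from the map of
   contact bundles. *)
From HB Require Import structures.
From mathcomp Require Import all_boot all_order all_algebra.
From mathcomp Require Import all_classical all_reals all_analysis.
From mathcomp Require Import ring.
Require Import Defs.

Set Implicit Arguments.
Unset Strict Implicit.
Unset Printing Implicit Defensive.

Import Order.TTheory GRing.Theory Num.Theory.
Import numFieldNormedType.Exports.

Local Open Scope classical_set_scope.
Local Open Scope ring_scope.

(** * Smooth functions of row vectors *)

Section Calculus.
Variable R : realType.

(** The difference [g - f] vanishes near [z], so its expansion with differential zero has a
    remainder that is zero near the origin; hence [g = f + (g - f)] is a sum of differentiable
    functions. *)
Lemma near_eq_differentiable (V W : normedModType R) (f g : V -> W) (z : V) :
  (\near z, f z = g z) -> differentiable f z -> differentiable g z.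
Proof.
move=> fg df; have fgz : f z = g z by exact: nbhs_singleton fg.
have -> : g = f + (g - f) by apply/funext => x; rewrite !fctE addrC subrK.
apply: differentiableD => //.
have E : (g - f) \o shift z = cst ((g - f) z) + (\0 : V -> W) +o_ 0 id.
  apply/eqaddoP => e e0; near=> x.
  change (`|(g (x + z) - f (x + z)) - ((g z - f z) + 0)| <= e * `|x|).
  rewrite fgz subrr addr0 subr0.
  suff -> : g (x + z) - f (x + z) = 0 by rewrite normr0 mulr_ge0 // ltW.
  apply/eqP; rewrite subr_eq0 eq_sym; apply/eqP; near: x.
  by move: fg; rewrite (near_shift 0) /= subr0.
have zc : continuous (\0 : {linear V -> W}) by move=> x; exact: cvg_cst.
apply/diff_locallyP; rewrite (diff_unique zc E); split => //.
Unshelve. all: by end_near. Qed.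

Lemma row_fun_sum (T : Type) n (g : T -> 'rV[R]_n) :
  g = (\sum_(j < n) (fun z => g z 0 j *: (delta_mx 0 j : 'rV[R]_n))).
Proof. by apply/funext => z; rewrite fct_sumE -row_sum_delta. Qed.

Lemma differentiable_row (V : normedModType R) n (g : V -> 'rV[R]_n) z :
  (forall j, differentiable (fun z => g z 0 j) z) -> differentiable g z.
Proof.
move=> H; rewrite [g]row_fun_sum; apply: differentiable_sum => j.
exact: differentiableZl.
Qed.

Lemma continuous_row (V : topologicalType) n (g : V -> 'rV[R]_n) z :
  (forall j, {for z, continuous (fun z => g z 0 j)}) -> {for z, continuous g}.
Proof.
move=> H; rewrite [g]row_fun_sum; elim/big_ind : _ => [|a b ca cb|j _].
- exact: cvg_cst.
- exact: continuousD.
- by apply: cvgZr_tmp; exact: H.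
Qed.

Lemma derive_comp_row n m (f : 'rV[R]_n -> R) (g : 'rV[R]_m -> 'rV[R]_n) z v :
  differentiable f (g z) -> (forall j, differentiable (fun z => g z 0 j) z) ->
  'D_v (f \o g) z = \sum_j 'D_(delta_mx 0 j) f (g z) * 'D_v (fun z => g z 0 j) z.
Proof.
move=> df dg; have dG := differentiable_row dg.
rewrite deriveE; last exact: differentiable_comp.
have E : 'd g z v = 'D_v g z by rewrite deriveE.
rewrite diff_comp //= E (row_sum_delta ('D_v g z)) linear_sum /=.
apply: eq_bigr => j _; rewrite linearZ /= -deriveE // mulrC; congr (_ * _).
by rewrite derive_mx ?mxE //; exact: diff_derivable.
Qed.

End Calculus.

(** * Closure properties of functions of class C^k *)

Section Ck.
Variable R : realType.
Implicit Types (n m k : nat).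

Lemma Ck_sub n k (U W : set 'rV[R]_n) f : W `<=` U -> Ck k U f -> Ck k W f.
Proof.
elim: k U W f => /= [U W f WU H z /WU|k IH U W f WU [H1 H2]]; first exact: H.
by split=> [z /WU/H1//|i]; exact: IH (H2 i).
Qed.

(** Every condition in [Ck] is imposed point by point on total functions, namely [f] and its
    iterated partial derivatives. So the points of [U] can be treated one at a time, and [W] may be
    any set through [z], open or not. *)
Lemma Ck_pointwise n k (U : set 'rV[R]_n) f :
  (forall z, U z -> exists2 W : set 'rV[R]_n, W z & Ck k W f) -> Ck k U f.
Proof.
elim: k U f => /= [U f H z /H [W Wz]|k IH U f H]; first exact.
split=> [z /H [W Wz [H1 _]]|i]; first exact: H1.
by apply: IH => z /H [W Wz [_ H2]]; exists W.
Qed.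

Lemma Ck_near n k (U : set 'rV[R]_n) f g :
  (forall z, U z -> \near z, f z = g z) -> Ck k U f -> Ck k U g.
Proof.
elim: k U f g => /= [U f g fg H z Uz|k IH U f g fg [H1 H2]].
  have fgz := fg _ Uz; rewrite /prop_for /continuous_at -(nbhs_singleton fgz).
  exact: cvg_trans (near_eq_cvg fgz) (H z Uz).
split=> [z Uz|i]; first exact: near_eq_differentiable (fg z Uz) (H1 z Uz).
apply: IH (H2 i) => z Uz.
(* Equality of the derivatives near [z] needs equality of the functions near each point near [z];
   [nbhs_interior] supplies it. *)
have := nbhs_interior (fg _ Uz); apply: filterS => y; exact: near_eq_derive.
Qed.

Lemma Ck_ext n k (U : set 'rV[R]_n) f g :
  open U -> (forall z, U z -> f z = g z) -> Ck k U f -> Ck k U g.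
Proof.
move=> oU fg; apply: Ck_near => z Uz.
by apply: filterS (open_nbhs_nbhs (conj oU Uz)).
Qed.

Lemma Ck_pred n k (U : set 'rV[R]_n) f : Ck k.+1 U f -> Ck k U f.
Proof.
elim: k f => [f [H _] z /H|k IH f [H1 H2]]; first exact: differentiable_continuous.
by split=> // i; exact: IH (H2 i).
Qed.

Lemma Ck_cst n k (U : set 'rV[R]_n) (a : R) : Ck k U (fun=> a).
Proof.
elim: k a => [a z _|k IH a]; first exact: cst_continuous.
split=> [z _|i]; first exact: differentiable_cst.
have -> : 'D_('e_i) (fun=> a) = (fun=> 0) :> ('rV[R]_n -> R) by
  apply/funext => z; exact: derive_cst.
exact: IH.
Qed.

Lemma derive_coord n (i : 'I_n) (v z : 'rV[R]_n) :
  'D_v (fun z : 'rV[R]_n => z 0 i) z = v 0 i.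
Proof.
have := @derive_mx R _ 1 n id z v (@derivable_id _ _ z v); rewrite derive_id.
by move=> /(congr1 (fun A : 'rV[R]_n => A 0 i)); rewrite mxE.
Qed.

Lemma Ck_coord n k (U : set 'rV[R]_n) (i : 'I_n) : Ck k U (fun z => z 0 i).
Proof.
case: k => [|k].
  by move=> z _; exact/differentiable_continuous/differentiable_coord.
split=> [z _|j]; first exact: differentiable_coord.
have -> : 'D_('e_j) (fun z : 'rV[R]_n => z 0 i) =
    (fun=> (delta_mx 0 j : 'rV[R]_n) 0 i) by apply/funext => z; rewrite derive_coord.
exact: Ck_cst.
Qed.

Lemma CkD n k (U : set 'rV[R]_n) f g :
  open U -> Ck k U f -> Ck k U g -> Ck k U (fun z => f z + g z).
Proof.
move=> oU; elim: k f g => /= [f g Hf Hg z Uz|k IH f g [Hf1 Hf2] [Hg1 Hg2]].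
  by apply: continuousD; [exact: Hf|exact: Hg].
split=> [z Uz|i]; first by apply: differentiableD; [exact: Hf1|exact: Hg1].
apply: (@Ck_ext _ _ _ (fun z => 'D_('e_i) f z + 'D_('e_i) g z)) => //.
  move=> z Uz; rewrite -deriveD //; apply: diff_derivable; auto.
exact: IH.
Qed.

(** The product rule brings back [f] and [g] undifferentiated, so the hypotheses of order [k.+1] are
    kept whole and lowered with [Ck_pred] where only order [k] is wanted. *)
Lemma CkM n k (U : set 'rV[R]_n) f g :
  open U -> Ck k U f -> Ck k U g -> Ck k U (fun z => f z * g z).
Proof.
move=> oU; elim: k f g => [f g Hf Hg z Uz|k IH f g Hf Hg].
  by apply: continuousM; [exact: Hf|exact: Hg].
have [Hf1 Hf2] : _ /\ forall i, Ck k U ('D_('e_i) f) := Hf.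
have [Hg1 Hg2] : _ /\ forall i, Ck k U ('D_('e_i) g) := Hg.
split=> [z Uz|i]; first by apply: differentiableM; [exact: Hf1|exact: Hg1].
apply: (@Ck_ext _ _ _ (fun z => f z * 'D_('e_i) g z + g z * 'D_('e_i) f z)) => //.
  by move=> z Uz; rewrite -(@deriveM _ _ f g) //; apply: diff_derivable; auto.
by apply: CkD => //; apply: IH => //; apply: Ck_pred.
Qed.

Lemma Ck_sum n k (U : set 'rV[R]_n) (I : Type) (r : seq I) (F : I -> 'rV[R]_n -> R) :
  open U -> (forall i, Ck k U (F i)) -> Ck k U (fun z => \sum_(i <- r) F i z).
Proof.
move=> oU H; elim: r => [|i r IH].
  by under eq_fun do rewrite big_nil; exact: Ck_cst.
by under eq_fun do rewrite big_cons; exact: CkD.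
Qed.

Lemma Ck_comp n m k (U : set 'rV[R]_n) (V : set 'rV[R]_m) f (g : 'rV[R]_m -> 'rV[R]_n) :
  open V -> (forall z, V z -> U (g z)) -> Ck k U f ->
  (forall i, Ck k V (fun z => g z 0 i)) -> Ck k V (fun z => f (g z)).
Proof.
move=> oV VU; elim: k f => [f Hf Hg z Vz|k IH f Hf Hg].
  apply: (@continuous_comp _ _ _ g f); last exact/Hf/VU.
  by apply: continuous_row => j; exact: Hg.
have [Hf1 Hf2] : _ /\ forall i, Ck k U ('D_('e_i) f) := Hf.
have dg z j : V z -> differentiable (fun z => g z 0 j) z by case: (Hg j) => + _; apply.
split=> [z Vz|i].
  apply: (@differentiable_comp _ _ _ _ g f); last exact/Hf1/VU.
  by apply: differentiable_row => j; exact: dg.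
apply: (@Ck_ext _ _ _ (fun z => \sum_j 'D_(delta_mx 0 j) f (g z) *
                                   'D_('e_i) (fun z => g z 0 j) z)) => //.
  by move=> z Vz; rewrite -derive_comp_row //; [exact/Hf1/VU|move=> j; exact: dg].
apply: Ck_sum => // j; apply: CkM => //.
  by apply: (IH ('D_('e_j) f) (Hf2 j)) => j'; apply: Ck_pred; exact: Hg.
by case: (Hg j) => _; apply.
Qed.

(** The derivative of the inverse is a polynomial in the inverse itself and the derivative of [f],
    so regularity of order [k] of the inverse yields order [k.+1]. *)
Lemma CkV n k (U : set 'rV[R]_n) f : open U -> (forall z, U z -> f z != 0) ->
  Ck k U f -> Ck k U (fun z => (f z)^-1).
Proof.
move=> oU f0; elim: k => [Hf z Uz|k IH Hf].
  by apply: continuousV; [exact: f0|exact: Hf].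
have [Hf1 Hf2] : _ /\ forall i, Ck k U ('D_('e_i) f) := Hf.
split=> [z Uz|i]; first by apply: differentiableV; [exact: Hf1|exact: f0].
have H := IH (Ck_pred Hf).
apply: (@Ck_ext _ _ _ (fun z => (-1) * ((f z)^-1 * (f z)^-1) * 'D_('e_i) f z)) => //.
  move=> z Uz; rewrite (@deriveV _ _ f) ?f0 //; last exact/diff_derivable/Hf1.
  by rewrite /GRing.scale /= -exprVn expr2 mulN1r.
apply: CkM => //; apply: CkM => //; [exact: Ck_cst|exact: CkM].
Qed.

End Ck.

(** * Germs of smooth functions, gradients and the scalar product of rows *)

Section SmoothNear.
Variable R : realType.
Implicit Types (n m k : nat).

(** The germ version of [smooth_on]: closure properties can be stated at a point, with no domain to
    carry along. *)
Definition smooth_near n (a : 'rV[R]_n) (f : 'rV[R]_n -> R) : Prop :=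
  exists W : set 'rV[R]_n, [/\ open W, W a & smooth_on W f].

Definition gradv n (f : 'rV[R]_n -> R) (a : 'rV[R]_n) : 'rV[R]_n :=
  \row_i 'D_(delta_mx 0 i) f a.

Lemma near_openP (T : topologicalType) (a : T) (P : set T) :
  (\forall z \near a, P z) -> exists V, [/\ open V, V a & V `<=` P].
Proof.
move=> H; have : nbhs a P := H.
by rewrite nbhsE => -[V [oV Va] HV]; exists V.
Qed.

Lemma smooth_on_sub n (U W : set 'rV[R]_n) f :
  W `<=` U -> smooth_on U f -> smooth_on W f.
Proof. by move=> WU H k; apply: Ck_sub WU _. Qed.

Lemma smooth_on_near n (U : set 'rV[R]_n) f :
  (forall z, U z -> smooth_near z f) -> smooth_on U f.
Proof. by move=> H k; apply: Ck_pointwise => z /H [W [_ Wz +]]; exists W. Qed.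

Lemma smooth_near_on n (U : set 'rV[R]_n) f z :
  open U -> U z -> smooth_on U f -> smooth_near z f.
Proof. by exists U. Qed.

Lemma smooth_near_ext n (a : 'rV[R]_n) f g :
  (\near a, f a = g a) -> smooth_near a f -> smooth_near a g.
Proof.
move=> fg [W [oW Wa H]].
have : \forall z \near a, W z /\ f z = g z.
  by apply: filterI => //; exact: open_nbhs_nbhs.
move/near_openP => [V [oV Va HV]]; exists V; split => // k.
apply: (@Ck_ext _ _ _ _ f) => // [z /HV[]//|].
by apply: Ck_sub (H k) => z /HV[].
Qed.

Lemma smooth_near_nbhs n (a : 'rV[R]_n) f :
  smooth_near a f -> \forall z \near a, smooth_near z f.
Proof.
move=> [W [oW Wa H]]; have := open_nbhs_nbhs (conj oW Wa).
by apply: filterS => z Wz; exists W.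
Qed.

Lemma smooth_near_diff n (a : 'rV[R]_n) f : smooth_near a f -> differentiable f a.
Proof. by move=> [W [_ Wa /(_ 1%N) [+ _]]]; apply. Qed.

Lemma smooth_near_cst n (a : 'rV[R]_n) (r : R) : smooth_near a (fun=> r).
Proof. by exists setT; split=> //; [exact: openT|move=> k; exact: Ck_cst]. Qed.

Lemma smooth_near_coord n (a : 'rV[R]_n) i : smooth_near a (fun z => z 0 i).
Proof. by exists setT; split=> //; [exact: openT|move=> k; exact: Ck_coord]. Qed.

Lemma smooth_near2 n (a : 'rV[R]_n) f g :
  smooth_near a f -> smooth_near a g ->
  exists W : set 'rV[R]_n, [/\ open W, W a, smooth_on W f & smooth_on W g].
Proof.
move=> [U [oU Ua Hf]] [V [oV Va Hg]]; exists (U `&` V); split=> //.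
- exact: openI.
- by apply: smooth_on_sub Hf => z [].
- by apply: smooth_on_sub Hg => z [].
Qed.

Lemma smooth_nearD n (a : 'rV[R]_n) f g :
  smooth_near a f -> smooth_near a g -> smooth_near a (fun z => f z + g z).
Proof.
move=> /smooth_near2 H /H [W [oW Wa Hf Hg]]; exists W; split=> // k.
exact: CkD.
Qed.

Lemma smooth_nearM n (a : 'rV[R]_n) f g :
  smooth_near a f -> smooth_near a g -> smooth_near a (fun z => f z * g z).
Proof.
move=> /smooth_near2 H /H [W [oW Wa Hf Hg]]; exists W; split=> // k.
exact: CkM.
Qed.

Lemma smooth_nearZ n (a : 'rV[R]_n) (r : R) f :
  smooth_near a f -> smooth_near a (fun z => r * f z).
Proof. by apply: smooth_nearM; exact: smooth_near_cst. Qed.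

Lemma smooth_nearN n (a : 'rV[R]_n) f :
  smooth_near a f -> smooth_near a (fun z => - f z).
Proof. by move/(smooth_nearZ (-1)); under eq_fun do rewrite mulN1r. Qed.

Lemma smooth_nearB n (a : 'rV[R]_n) f g :
  smooth_near a f -> smooth_near a g -> smooth_near a (fun z => f z - g z).
Proof. by move=> Hf Hg; apply: smooth_nearD => //; exact: smooth_nearN. Qed.

Lemma smooth_near_sum n (a : 'rV[R]_n) (I : Type) (r : seq I) F :
  (forall i : I, smooth_near a (F i)) -> smooth_near a (fun z => \sum_(i <- r) F i z).
Proof.
move=> H; elim: r => [|i r IH].
  by under eq_fun do rewrite big_nil; exact: smooth_near_cst.
by under eq_fun do rewrite big_cons; exact: smooth_nearD.
Qed.

Definition smooth_row n m (a : 'rV[R]_n) (g : 'rV[R]_n -> 'rV[R]_m) : Prop :=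
  forall i, smooth_near a (fun z => g z 0 i).

Lemma smooth_row_continuous n m (a : 'rV[R]_n) (g : 'rV[R]_n -> 'rV[R]_m) :
  smooth_row a g -> {for a, continuous g}.
Proof.
by move=> H; apply: continuous_row => j; exact/differentiable_continuous/smooth_near_diff.
Qed.

Lemma smooth_near_comp n m (a : 'rV[R]_n) (g : 'rV[R]_n -> 'rV[R]_m) f :
  smooth_near (g a) f -> smooth_row a g -> smooth_near a (fun z => f (g z)).
Proof.
move=> [U [oU Ua Hf]] Hg.
(* One neighbourhood has to serve all orders [k] and all components of [g]: continuity of [g] at [a]
   is combined with a finite intersection over the components. *)
have N : \forall z \near a, U (g z) /\ forall i, smooth_near z (fun y => g y 0 i).
  have /filter_forall H : forall i, \forall z \near a, smooth_near z (fun y => g y 0 i).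
    by move=> i; exact: smooth_near_nbhs (Hg i).
  apply: filterI H.
  by apply: (smooth_row_continuous Hg); exact: open_nbhs_nbhs.
move: N => /near_openP [V [oV Va HV]]; exists V; split=> // k.
apply: (@Ck_comp _ _ _ _ U) => // [z /HV[]//|i].
by apply: smooth_on_near => z /HV[_]; apply.
Qed.

Lemma smooth_nearV n (a : 'rV[R]_n) f :
  f a != 0 -> smooth_near a f -> smooth_near a (fun z => (f z)^-1).
Proof.
move=> fa Hf; have [W [oW Wa H]] := Hf.
have N : \forall z \near a, W z /\ f z != 0.
  apply: filterI; first exact: open_nbhs_nbhs.
  have /differentiable_continuous := smooth_near_diff Hf.
  by move=> /(_ _ (open_nbhs_nbhs (conj (@open_neq R 0) fa))).
move: N => /near_openP [V [oV Va HV]]; exists V; split=> // k.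
by apply: CkV => // [z /HV[]//|]; apply: Ck_sub (H k) => z /HV[].
Qed.

Lemma smooth_row_id n (a : 'rV[R]_n) : smooth_row a id.
Proof. by move=> i; exact: smooth_near_coord. Qed.

Lemma smooth_row_cst n m (a : 'rV[R]_n) (b : 'rV[R]_m) : smooth_row a (fun=> b).
Proof. by move=> i; exact: smooth_near_cst. Qed.

Lemma smooth_row_const n m (a : 'rV[R]_n) f :
  smooth_near a f -> smooth_row a (fun z => const_mx (f z) : 'rV[R]_m).
Proof. by move=> H i; under eq_fun do rewrite mxE. Qed.

Lemma smooth_row_mx n m m' (a : 'rV[R]_n) (f : _ -> 'rV[R]_m) (g : _ -> 'rV[R]_m') :
  smooth_row a f -> smooth_row a g -> smooth_row a (fun z => row_mx (f z) (g z)).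
Proof.
move=> Hf Hg i; case: (splitP i) => j ij.
  have -> : i = lshift m' j by exact/val_inj.
  by under eq_fun do rewrite row_mxEl; exact: Hf.
have -> : i = rshift m j by exact/val_inj.
by under eq_fun do rewrite row_mxEr; exact: Hg.
Qed.

Lemma smooth_row_l n m m' (a : 'rV[R]_n) (f : _ -> 'rV[R]_(m + m')) :
  smooth_row a f -> smooth_row a (fun z => lsubmx (f z)).
Proof. by move=> H i; under eq_fun do rewrite mxE; exact: H. Qed.

Lemma smooth_row_r n m m' (a : 'rV[R]_n) (f : _ -> 'rV[R]_(m + m')) :
  smooth_row a f -> smooth_row a (fun z => rsubmx (f z)).
Proof. by move=> H i; under eq_fun do rewrite mxE; exact: H. Qed.

Lemma smooth_rowD n m (a : 'rV[R]_n) (f g : _ -> 'rV[R]_m) :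
  smooth_row a f -> smooth_row a g -> smooth_row a (fun z => f z + g z).
Proof. by move=> Hf Hg i; under eq_fun do rewrite mxE; exact: smooth_nearD. Qed.

Lemma smooth_rowN n m (a : 'rV[R]_n) (f : _ -> 'rV[R]_m) :
  smooth_row a f -> smooth_row a (fun z => - f z).
Proof. by move=> H i; under eq_fun do rewrite mxE; exact: smooth_nearN. Qed.

Lemma smooth_rowZ n m (a : 'rV[R]_n) h (f : _ -> 'rV[R]_m) :
  smooth_near a h -> smooth_row a f -> smooth_row a (fun z => h z *: f z).
Proof. by move=> Hh H i; under eq_fun do rewrite mxE; exact: smooth_nearM. Qed.

Lemma smooth_row_comp n m k (a : 'rV[R]_n) (g : _ -> 'rV[R]_m) (f : _ -> 'rV[R]_k) :
  smooth_row (g a) f -> smooth_row a g -> smooth_row a (fun z => f (g z)).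
Proof. by move=> Hf Hg i; exact: (smooth_near_comp (Hf i) Hg). Qed.

Lemma smooth_row_ext n m (a : 'rV[R]_n) (f g : _ -> 'rV[R]_m) :
  (\forall z \near a, f z = g z) -> smooth_row a f -> smooth_row a g.
Proof. by move=> fg H i; apply: smooth_near_ext (H i); apply: filterS fg => z ->. Qed.

Definition dotv n (u v : 'rV[R]_n) : R := \sum_i u 0 i * v 0 i.

Lemma dotvC n (u v : 'rV[R]_n) : dotv u v = dotv v u.
Proof. by apply: eq_bigr => i _; rewrite mulrC. Qed.

Lemma dotvDl n (u v w : 'rV[R]_n) : dotv (u + v) w = dotv u w + dotv v w.
Proof. by rewrite -big_split; apply: eq_bigr => i _; rewrite mxE mulrDl. Qed.

Lemma dotvZl n r (u w : 'rV[R]_n) : dotv (r *: u) w = r * dotv u w.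
Proof. by rewrite /dotv mulr_sumr; apply: eq_bigr => i _; rewrite mxE mulrA. Qed.

Lemma dotvDr n (u v w : 'rV[R]_n) : dotv w (u + v) = dotv w u + dotv w v.
Proof. by rewrite dotvC dotvDl !(dotvC w). Qed.

Lemma dotvZr n r (u w : 'rV[R]_n) : dotv w (r *: u) = r * dotv w u.
Proof. by rewrite dotvC dotvZl (dotvC w). Qed.

Lemma dotvNl n (u w : 'rV[R]_n) : dotv (- u) w = - dotv u w.
Proof. by rewrite -scaleN1r dotvZl mulN1r. Qed.

Lemma dotvNr n (u w : 'rV[R]_n) : dotv w (- u) = - dotv w u.
Proof. by rewrite dotvC dotvNl dotvC. Qed.

Lemma dotv0l n (w : 'rV[R]_n) : dotv 0 w = 0.
Proof. by rewrite -[0](scale0r w) dotvZl mul0r. Qed.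

Lemma dotv0r n (w : 'rV[R]_n) : dotv w 0 = 0.
Proof. by rewrite dotvC dotv0l. Qed.

Lemma dotv_row_mx n m (u u' : 'rV[R]_n) (v v' : 'rV[R]_m) :
  dotv (row_mx u v) (row_mx u' v') = dotv u u' + dotv v v'.
Proof.
rewrite /dotv big_split_ord /=; congr (_ + _); apply: eq_bigr => i _.
  by rewrite !row_mxEl.
by rewrite !row_mxEr.
Qed.

Lemma dotv_delta n (u : 'rV[R]_n) i : dotv u (delta_mx 0 i) = u 0 i.
Proof.
rewrite /dotv (bigD1 i) //= mxE !eqxx mulr1 big1 ?addr0 // => j ji.
by rewrite mxE (negPf ji) mulr0.
Qed.

Lemma dotv_const (r s : R) : dotv (const_mx r : 'rV_1) (const_mx s) = r * s.
Proof. by rewrite /dotv big_ord1 !mxE. Qed.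

Lemma dotv_row1 n (z : 'rV[R]_(1 + n)) r v :
  dotv z (row_mx (const_mx r) v) = z 0 (lshift n 0) * r + dotv (rsubmx z) v.
Proof. by rewrite -{1}[z]hsubmxK dotv_row_mx {1}/dotv big_ord1 !mxE. Qed.

Lemma smooth_near_dot n m (a : 'rV[R]_n) (f g : _ -> 'rV[R]_m) :
  smooth_row a f -> smooth_row a g -> smooth_near a (fun z => dotv (f z) (g z)).
Proof. by move=> Hf Hg; apply: smooth_near_sum => i; exact: smooth_nearM. Qed.

Lemma gradv_ext n (a : 'rV[R]_n) f g :
  (\near a, f a = g a) -> gradv f a = gradv g a.
Proof. by move=> fg; apply/rowP => i; rewrite !mxE; exact: near_eq_derive. Qed.

Lemma gradvD n (a : 'rV[R]_n) f g : differentiable f a -> differentiable g a ->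
  gradv (fun z => f z + g z) a = gradv f a + gradv g a.
Proof.
by move=> df dg; apply/rowP => i; rewrite !mxE -deriveD //; exact: diff_derivable.
Qed.

Lemma gradvZ n (a : 'rV[R]_n) r (f : 'rV[R]_n -> R) : differentiable f a ->
  gradv (fun z => r * f z) a = r *: gradv f a.
Proof.
move=> df; apply/rowP => i; rewrite !mxE.
by rewrite -[RHS](@deriveZ _ _ _ f) //; exact: diff_derivable.
Qed.

Lemma gradv_cst n (a : 'rV[R]_n) r : gradv (fun=> r) a = 0.
Proof. by apply/rowP => i; rewrite !mxE; exact: derive_cst. Qed.

Lemma gradvN n (a : 'rV[R]_n) f : differentiable f a ->
  gradv (fun z => - f z) a = - gradv f a.
Proof.
move=> df; rewrite -scaleN1r -gradvZ //; congr gradv.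
by apply/funext => z; rewrite mulN1r.
Qed.

Lemma gradvB n (a : 'rV[R]_n) f g : differentiable f a -> differentiable g a ->
  gradv (fun z => f z - g z) a = gradv f a - gradv g a.
Proof.
by move=> df dg; rewrite gradvD ?gradvN //; exact: differentiableN.
Qed.

Lemma gradv_coord n (a : 'rV[R]_n) i : gradv (fun z => z 0 i) a = delta_mx 0 i.
Proof. by apply/rowP => j; rewrite !mxE derive_coord mxE eq_sym. Qed.

Lemma gradv_comp n m (a : 'rV[R]_n) (g : 'rV[R]_n -> 'rV[R]_m) f :
  differentiable f (g a) -> (forall j, differentiable (fun z => g z 0 j) a) ->
  gradv (fun z => f (g z)) a =
  \sum_j gradv f (g a) 0 j *: gradv (fun z => g z 0 j) a.
Proof.
move=> df dg; apply/rowP => i; rewrite mxE (derive_comp_row _ df dg) summxE.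
by apply: eq_bigr => j _; rewrite !mxE.
Qed.

Lemma gradv_dot n (a p : 'rV[R]_n) : gradv (fun z => dotv z p) a = p.
Proof.
apply/rowP => i; rewrite mxE /dotv.
have -> : (fun z : 'rV[R]_n => \sum_j z 0 j * p 0 j) =
    \sum_j (fun z : 'rV[R]_n => p 0 j *: (z 0 j : R^o)).
  by apply/funext => z; rewrite fct_sumE; apply: eq_bigr => j _; rewrite mulrC.
rewrite derive_sum => [|j]; last first.
  by apply/diff_derivable/differentiableZ; exact: differentiable_coord.
under eq_bigr => j _.
  rewrite deriveZ; last exact/diff_derivable/differentiable_coord.
  rewrite derive_coord; over.
by rewrite -[RHS](dotv_delta p).
Qed.

Lemma smooth_near_dotl n (a p : 'rV[R]_n) : smooth_near a (fun z => dotv z p).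
Proof. by apply: smooth_near_dot; [exact: smooth_row_id|exact: smooth_row_cst]. Qed.

End SmoothNear.
Lemma get_eq (T : pointedType) (P : set T) x :
  P x -> (forall y, P y -> y = x) -> get P = x.
Proof. by move=> Px H; exact: xget_unique. Qed.

Lemma the_eq (T : Type) (x0 : T) (P : set T) x :
  P x -> (forall y, P y -> y = x) -> the x0 P = x.
Proof.
by move=> Px H; rewrite /the; case: pselect => [e|[]]; [apply/H/(projT2 (cid e))|exists x].
Qed.

(** * Gradients of linear, bilinear and composite functions *)

Section Linear.
Variable R : realType.
Implicit Types n m : nat.

Definition linear_row n m (L : 'rV[R]_n -> 'rV[R]_m) : Prop :=
  forall (r : R) u v, L (r *: u + v) = r *: L u + L v.

Lemma linear_row0 n m (L : 'rV[R]_n -> 'rV[R]_m) : linear_row L -> L 0 = 0.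
Proof.
by move=> H; have := H (-1) 0 0; rewrite scaler0 addr0 scaleN1r addNr.
Qed.

Lemma linear_rowE n m (L : 'rV[R]_n -> 'rV[R]_m) z : linear_row L ->
  L z = \sum_i z 0 i *: L (delta_mx 0 i).
Proof.
move=> H; rewrite {1}(row_sum_delta z).
elim/big_rec2: _ => [|i y1 y2 _ IH]; first exact: linear_row0.
by rewrite H IH.
Qed.

Lemma dotv_ext n (u w : 'rV[R]_n) : (forall v, dotv u v = dotv w v) -> u = w.
Proof. by move=> H; apply/rowP => i; rewrite -!dotv_delta. Qed.

Lemma smooth_row_lin n m (L : 'rV[R]_n -> 'rV[R]_m) a : linear_row L -> smooth_row a L.
Proof.
move=> H i; under eq_fun do rewrite (linear_rowE _ H) summxE.
apply: smooth_near_sum => j; under eq_fun do rewrite mxE.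
by apply: smooth_nearM; [exact: smooth_near_coord|exact: smooth_near_cst].
Qed.

Lemma dotv_gradv_lin n m (L : 'rV[R]_n -> 'rV[R]_m) a v j : linear_row L ->
  dotv (gradv (fun z => L z 0 j) a) v = L v 0 j.
Proof.
move=> HL; have -> : (fun z => L z 0 j) = (fun z => dotv z (\row_i L (delta_mx 0 i) 0 j)).
  apply/funext => z; rewrite (linear_rowE _ HL) summxE.
  by apply: eq_bigr => i _; rewrite !mxE.
rewrite gradv_dot dotvC (linear_rowE v HL) summxE.
by apply: eq_bigr => i _; rewrite !mxE.
Qed.

Lemma gradvM n (f g : 'rV[R]_n -> R) a : differentiable f a -> differentiable g a ->
  gradv (fun z => f z * g z) a = f a *: gradv g a + g a *: gradv f a.
Proof.
by move=> df dg; apply/rowP => i; rewrite !mxE -(@deriveM _ _ f g) //; exact: diff_derivable.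
Qed.

(** The Leibniz rule for a pairing of two linear maps. The sum is first generalised to an arbitrary
    list of indices, so that the product rule can be applied term by term. *)
Lemma dotv_gradv_bilin n m (A B : 'rV[R]_n -> 'rV[R]_m) a v : linear_row A -> linear_row B ->
  dotv (gradv (fun z => dotv (A z) (B z)) a) v = dotv (A a) (B v) + dotv (A v) (B a).
Proof.
move=> HA HB; have sA j := smooth_row_lin a HA j; have sB j := smooth_row_lin a HB j.
have H r : dotv (gradv (fun z => \sum_(j <- r) A z 0 j * B z 0 j) a) v =
    \sum_(j <- r) (A a 0 j * B v 0 j + A v 0 j * B a 0 j).
  elim: r => [|j r IH].
    by under eq_fun do rewrite big_nil; rewrite big_nil gradv_cst dotv0l.
  under eq_fun do rewrite big_cons; rewrite big_cons gradvD.
  - rewrite dotvDl IH gradvM; try exact: smooth_near_diff.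
    by rewrite dotvDl !dotvZl !dotv_gradv_lin // (mulrC (B a 0 j)).
  - by apply: smooth_near_diff; exact: smooth_nearM.
  - by apply: smooth_near_diff; apply: smooth_near_sum => i; exact: smooth_nearM.
by rewrite /dotv -big_split; exact: H.
Qed.

Lemma dotv_gradv n (f : 'rV[R]_n -> R) a v : differentiable f a ->
  dotv (gradv f a) v = 'D_v f a.
Proof.
move=> df; rewrite [in RHS](row_sum_delta v) deriveE // linear_sum.
by apply: eq_bigr => i _; rewrite linearZ /= -deriveE // mxE mulrC.
Qed.

(** The gradient of the composite is the transpose of [L] applied to the gradient of [f]; testing
    both sides against [v] with [dotv] avoids writing the matrix of [L]. *)
Lemma gradv_comp_aff n m (F L : 'rV[R]_n -> 'rV[R]_m) f a : linear_row L ->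
  (forall z v, F (z + v) = F z + L v) -> differentiable f (F a) ->
  forall v, dotv (gradv (fun z => f (F z)) a) v = dotv (gradv f (F a)) (L v).
Proof.
move=> HL HF df v.
have FE z : F z = F 0 + L z by rewrite -HF add0r.
have dF j : differentiable (fun z => F z 0 j) a.
  under eq_fun do rewrite FE.
  by apply: smooth_near_diff; apply: smooth_rowD; [exact: smooth_row_cst|exact: smooth_row_lin].
have dLj j : dotv (gradv (fun z => F z 0 j) a) v = L v 0 j.
  have -> : (fun z => F z 0 j) = (fun z => F 0 0 j + L z 0 j).
    by apply/funext => z; rewrite FE mxE.
  rewrite gradvD ?gradv_cst ?add0r; first exact: dotv_gradv_lin.
  - exact: smooth_near_diff (smooth_near_cst _ _).
  - exact: smooth_near_diff (smooth_row_lin _ HL _).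
rewrite gradv_comp //.
have -> : dotv (\sum_j gradv f (F a) 0 j *: gradv (fun z => F z 0 j) a) v =
    \sum_j gradv f (F a) 0 j * dotv (gradv (fun z => F z 0 j) a) v.
  elim/big_rec2: _ => [|j y1 y2 _ <-]; first by rewrite dotv0l.
  by rewrite dotvDl dotvZl.
by apply: eq_bigr => j _; rewrite dLj.
Qed.

End Linear.

(** * Spaces with a smooth atlas *)

Section Spaces.
Variable R : realType.

(** The properties of an atlas on which calculus in charts rests. Openness is asked of images in
    coordinate space, because a [space] carries no topology apart from its charts. *)
Record atlas_ok (X : space R) : Prop := AtlasOk {
  ao_scar : forall c (q : X), @satl R X c -> cdom c q -> scar q;
  ao_inj : forall c, @satl R X c -> set_inj (cdom c) c;
  ao_open : forall c c', @satl R X c -> @satl R X c' ->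
    open (c @` (cdom c `&` cdom c'));
  ao_smooth : forall c c' i, @satl R X c -> @satl R X c' ->
    smooth_on (c @` (cdom c `&` cdom c')) (crep c (fun q => c' q 0 i)) }.

Lemma crepE (T : Type) N (c : chart R T N) f q :
  set_inj (cdom c) c -> cdom c q -> crep c f (c q) = f q.
Proof.
move=> ci cq; apply: get_eq => [|y [q' [cq' E] <-]]; first by exists q.
by rewrite (ci q' q) ?inE.
Qed.

(** Quantifying over all points of the chart above [z] makes the condition vacuous off the image of
    [c]. Thus it can be established without knowing that the image is open; openness enters only in
    [near_ptE], when a point above [z] is needed. *)
Definition near_pt (X : space R) (c : chart R X (sdim X)) (p : X) (P : X -> Prop) :=
  \forall z \near c p, forall q, cdom c q -> c q = z -> P q.

Section OneSpace.
Variables (X : space R) (Xok : atlas_ok X).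
Implicit Types (c : chart R X (sdim X)) (p q : X) (f g : X -> R).

Lemma near_ptW c p (P Q : X -> Prop) :
  near_pt c p P -> (forall q, cdom c q -> P q -> Q q) -> near_pt c p Q.
Proof.
by rewrite /near_pt => H PQ; apply: filterS H => z Hz q cq E; apply: PQ => //; exact: Hz.
Qed.

Lemma near_ptT c p (P : X -> Prop) : (forall q, cdom c q -> P q) -> near_pt c p P.
Proof. by rewrite /near_pt => H; apply: filterE => z q cq _; exact: H. Qed.

Lemma near_pt_img c p : satl c -> cdom c p ->
  \forall z \near c p, exists2 q, cdom c q & c q = z.
Proof.
move=> sc cp; have := ao_open Xok sc sc; rewrite setIid => oc.
have : nbhs (c p) (c @` cdom c) by apply: open_nbhs_nbhs; split => //; exists p.
by apply: filterS => z [q cq <-]; exists q.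
Qed.

Lemma near_ptE c p P : satl c -> cdom c p -> near_pt c p P ->
  \forall z \near c p, exists q, [/\ cdom c q, c q = z & P q].
Proof.
move=> sc cp H; near=> z.
have [q cq E] : exists2 q, cdom c q & c q = z by near: z; exact: near_pt_img.
exists q; split=> //; have : forall q, cdom c q -> c q = z -> P q by near: z.
by apply.
Unshelve. all: by end_near. Qed.

Lemma crep_near c p f phi : satl c -> cdom c p ->
  near_pt c p (fun q => f q = phi (c q)) -> \forall z \near c p, crep c f z = phi z.
Proof.
move=> sc cp /near_ptE -/(_ sc cp); apply: filterS => z [q [cq <- E]].
by rewrite crepE //; exact: ao_inj.
Qed.

Definition trans c c' (z : 'rV[R]_(sdim X)) : 'rV[R]_(sdim X) :=
  \row_i crep c (fun q => c' q 0 i) z.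

Lemma transE c c' q : satl c -> cdom c q -> trans c c' (c q) = c' q.
Proof. by move=> sc cq; apply/rowP => i; rewrite mxE crepE //; exact: ao_inj. Qed.

Lemma smooth_trans c c' q : satl c -> satl c' -> cdom c q -> cdom c' q ->
  smooth_row (c q) (trans c c').
Proof.
move=> sc sc' cq cq' i; under eq_fun do rewrite mxE.
exact: smooth_near_on (ao_open Xok sc sc') (ex_intro2 _ _ q (conj cq cq') erefl)
  (ao_smooth Xok _ sc sc').
Qed.

Lemma near_pt_dom c c' p : satl c -> satl c' -> cdom c p -> cdom c' p ->
  near_pt c p (cdom c').
Proof.
move=> sc sc' cp cp'.
have : nbhs (c p) (c @` (cdom c `&` cdom c')).
  by apply: open_nbhs_nbhs; split; [exact: ao_open|exists p].
apply: filterS => z [q [cq cq'] <-] q' cq2 E.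
by rewrite (ao_inj Xok sc (x := q') (y := q)) ?inE.
Qed.

(** Independence of the chart: the chart provided by [smooth_at] is exchanged for [c] by composing
    with the smooth transition map, and any chart [c] of the atlas around [p] may be used from here
    on. *)
Lemma smooth_atE c p f : satl c -> cdom c p ->
  smooth_at f p <-> smooth_near (c p) (crep c f).
Proof.
move=> sc cp; split=> [[c1 [W [[sc1 cp1 oW Wp] [WI H]]]]|[W [oW Wp H]]].
  apply: (@smooth_near_ext _ _ _ (fun z => crep c1 f (trans c c1 z))).
    have := near_ptE sc cp (near_pt_dom sc sc1 cp cp1).
    apply: filterS => z [q [cq <- cq1]].
    by rewrite transE // !crepE //; exact: ao_inj.
  apply: smooth_near_comp; last exact: smooth_trans.
  by rewrite transE //; exists W.
exists c, (W `&` c @` cdom c); split.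
  split; [done|done| |by split=> //; exists p].
  by apply: openI => //; have := ao_open Xok sc sc; rewrite setIid.
by split=> [z []//|]; apply: smooth_on_sub H => z [].
Qed.

Lemma smooth_at_rep c p f phi : satl c -> cdom c p ->
  near_pt c p (fun q => f q = phi (c q)) ->
  smooth_at f p <-> smooth_near (c p) phi.
Proof.
move=> sc cp /crep_near-/(_ sc cp) H; rewrite (smooth_atE _ sc cp).
split; apply: smooth_near_ext => //.
by apply: filterS H => z ->.
Qed.

Lemma grad_rep c p f phi : satl c -> cdom c p ->
  near_pt c p (fun q => f q = phi (c q)) -> grad c f p = gradv phi (c p).
Proof. by move=> sc cp /crep_near-/(_ sc cp) H; exact: gradv_ext. Qed.

Lemma smooth_at_diff c p f : satl c -> cdom c p -> smooth_at f p ->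
  differentiable (crep c f) (c p).
Proof. by move=> sc cp /(smooth_atE _ sc cp)/smooth_near_diff. Qed.

Lemma smooth_at_ext c p f g : satl c -> cdom c p ->
  near_pt c p (fun q => f q = g q) -> smooth_at f p -> smooth_at g p.
Proof.
move=> sc cp fg; rewrite !(smooth_atE _ sc cp); apply: smooth_near_ext.
have := near_ptE sc cp fg; apply: filterS => z [q [cq <- E]].
by rewrite !crepE //; exact: ao_inj.
Qed.

Lemma grad_ext c p f g : satl c -> cdom c p ->
  near_pt c p (fun q => f q = g q) -> grad c f p = grad c g p.
Proof.
move=> sc cp fg; apply: gradv_ext.
have := near_ptE sc cp fg; apply: filterS => z [q [cq <- E]].
by rewrite !crepE //; exact: ao_inj.
Qed.

Section Algebra.
Variables (c : chart R X (sdim X)) (p : X) (sc : satl c) (cp : cdom c p).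

Lemma smooth_at_cst (r : R) : smooth_at (X := X) (fun=> r) p.
Proof.
by apply/(smooth_at_rep (phi := fun=> r) sc cp); [exact: near_ptT|exact: smooth_near_cst].
Qed.

Lemma grad_cst (r : R) : grad c (fun=> r) p = 0.
Proof. by rewrite (grad_rep (phi := fun=> r) sc cp) ?gradv_cst //; exact: near_ptT. Qed.

Lemma smooth_atD f g : smooth_at f p -> smooth_at g p ->
  smooth_at (fun q => f q + g q) p.
Proof.
move=> /(smooth_atE _ sc cp) Hf /(smooth_atE _ sc cp) Hg.
apply/(smooth_at_rep (phi := fun z => crep c f z + crep c g z) sc cp).
  by apply: near_ptT => q cq; rewrite !crepE //; exact: ao_inj.
exact: smooth_nearD.
Qed.

Lemma gradD f g : smooth_at f p -> smooth_at g p ->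
  grad c (fun q => f q + g q) p = grad c f p + grad c g p.
Proof.
move=> Hf Hg; rewrite (grad_rep (phi := fun z => crep c f z + crep c g z) sc cp).
  by rewrite gradvD //; exact: smooth_at_diff.
by apply: near_ptT => q cq; rewrite !crepE //; exact: ao_inj.
Qed.

Lemma smooth_atZ r f : smooth_at f p -> smooth_at (fun q => r * f q) p.
Proof.
move=> /(smooth_atE _ sc cp) Hf.
apply/(smooth_at_rep (phi := fun z => r * crep c f z) sc cp).
  by apply: near_ptT => q cq; rewrite !crepE //; exact: ao_inj.
exact: smooth_nearZ.
Qed.

Lemma gradZ r f : smooth_at f p -> grad c (fun q => r * f q) p = r *: grad c f p.
Proof.
move=> Hf; rewrite (grad_rep (phi := fun z => r * crep c f z) sc cp).
  by rewrite gradvZ //; exact: smooth_at_diff.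
by apply: near_ptT => q cq; rewrite !crepE //; exact: ao_inj.
Qed.

Lemma smooth_atN f : smooth_at f p -> smooth_at (fun q => - f q) p.
Proof. by move/(smooth_atZ (-1)); under eq_fun do rewrite mulN1r. Qed.

Lemma gradN f : smooth_at f p -> grad c (fun q => - f q) p = - grad c f p.
Proof.
by move=> Hf; rewrite -scaleN1r -gradZ //; under eq_fun do rewrite -mulN1r.
Qed.

Lemma smooth_atB f g : smooth_at f p -> smooth_at g p ->
  smooth_at (fun q => f q - g q) p.
Proof. by move=> Hf Hg; apply: smooth_atD => //; exact: smooth_atN. Qed.

Lemma gradB f g : smooth_at f p -> smooth_at g p ->
  grad c (fun q => f q - g q) p = grad c f p - grad c g p.
Proof. by move=> Hf Hg; rewrite gradD ?gradN //; exact: smooth_atN. Qed.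

Lemma smooth_at_dot w : smooth_at (X := X) (fun q => dotv (c q) w) p.
Proof.
apply/(smooth_at_rep (phi := fun z => dotv z w) sc cp); first exact: near_ptT.
exact: smooth_near_dotl.
Qed.

Lemma grad_dot w : grad c (fun q => dotv (c q) w) p = w.
Proof.
rewrite (grad_rep (phi := fun z => dotv z w) sc cp) ?gradv_dot //.
exact: near_ptT.
Qed.

Lemma grad_change c' f : satl c' -> cdom c' p -> smooth_at f p ->
  grad c' f p = \sum_j grad c f p 0 j *: gradv (fun z => trans c' c z 0 j) (c' p).
Proof.
move=> sc' cp' Hf.
rewrite (grad_rep (c := c') (phi := fun z => crep c f (trans c' c z))) //.
  rewrite gradv_comp ?transE //; first exact: smooth_at_diff.
  by move=> j; exact/smooth_near_diff/smooth_trans.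
apply: near_ptW (near_pt_dom sc' sc cp' cp) _ => q cq' cq.
by rewrite transE // crepE //; exact: ao_inj.
Qed.

(** Gradients in two charts differ by the Jacobian of the transition ([grad_change]), so vanishing
    in one chart implies vanishing in all of them. *)
Lemma dzeroP f : smooth_at f p -> dzero f p <-> grad c f p = 0.
Proof.
move=> Hf; split=> [|H c' sc' cp']; first exact.
by rewrite grad_change // H big1 // => j _; rewrite mxE scale0r.
Qed.

(** The covector at [p] with components [w] in the chart [c], in the encoding of [dcov] as a class
    of functions; equality of covectors then becomes equality of rows. *)
Definition covec (w : 'rV[R]_(sdim X)) : X * set (X -> R) :=
  (p, [set g | smooth_at g p /\ grad c g p = w]).

Lemma dcovE f : smooth_at f p -> dcov p f = covec (grad c f p).
Proof.
move=> Hf; congr pair; apply/seteqP; split=> g [Hg H]; split=> //.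
  have /dzeroP := smooth_atB Hg Hf.
  by move=> /iffLR /(_ H); rewrite gradB // => /eqP; rewrite subr_eq0 => /eqP.
by apply/(dzeroP (smooth_atB Hg Hf)); rewrite gradB // H subrr.
Qed.

Lemma covecE w : covec w = dcov p (fun q => dotv (c q) w).
Proof. by rewrite dcovE ?grad_dot //; exact: smooth_at_dot. Qed.

Lemma covec_is w : is_covector (covec w).
Proof.
split; first exact: ao_scar Xok _ _ sc cp.
by exists (fun q => dotv (c q) w); split; [exact: smooth_at_dot|exact: covecE].
Qed.

Lemma cotangent_chartE w : cotangent_chart c (covec w) = row_mx (c p) w.
Proof.
rewrite /cotangent_chart /=; congr row_mx; apply: get_eq; last by move=> y [f [_ <-]].
by exists (fun q => dotv (c q) w); [split; [exact: smooth_at_dot|exact: grad_dot]|exact: grad_dot].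
Qed.

End Algebra.

Lemma covectorP c (w : X * set (X -> R)) : satl c -> cdom c w.1 -> is_covector w ->
  w = covec c w.1 (rsubmx (cotangent_chart c w)).
Proof.
move=> sc cp [_ [f [Hf E]]].
have E' : w = covec c w.1 (grad c f w.1) by rewrite {1}E (dcovE sc cp).
have := cotangent_chartE sc cp (grad c f w.1); rewrite -E' => ->.
by rewrite row_mxKr.
Qed.

End OneSpace.

Section Maps.
Variables (X Y : space R) (Xok : atlas_ok X) (Yok : atlas_ok Y).
Variables (F : X -> Y) (c : chart R X (sdim X)) (d : chart R Y (sdim Y)) (p : X).
Hypotheses (sc : satl c) (sd : satl d) (cp : cdom c p).

Lemma smooth_map_rep (phi : 'rV[R]_(sdim X) -> 'rV[R]_(sdim Y)) :
  near_pt c p (fun q => cdom d (F q) /\ d (F q) = phi (c q)) ->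
  smooth_row (c p) phi -> smooth_map_at F p.
Proof.
move=> H Hphi.
have : \forall z \near c p, (exists q, [/\ cdom c q, c q = z &
    cdom d (F q) /\ d (F q) = phi (c q)]) /\
    forall i, smooth_near z (crep c (fun q => d (F q) 0 i)).
  apply: filterI; first exact: (near_ptE Xok sc cp H).
  suff /filter_forall : forall i, \forall z \near c p,
    smooth_near z (crep c (fun q => d (F q) 0 i)) by [].
  move=> i; apply: smooth_near_nbhs.
  apply: smooth_near_ext (Hphi i).
  suff E : \forall z \near c p, crep c (fun q => d (F q) 0 i) z = phi z 0 i.
    by apply: filterS E => z ->.
  by apply: crep_near => //; apply: near_ptW H _ => q cq [_ ->].
move/near_openP => [V [oV Vp HV]]; exists c, d, V; split=> //; split.
  by move=> z /HV[[q [cq <- [dq _]]] _]; exists q.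
by move=> i; apply: smooth_on_near => z /HV[_]; apply.
Qed.

End Maps.

Lemma smooth_map_comp_at (X Y : space R) (Xok : atlas_ok X) (Yok : atlas_ok Y)
    (F : X -> Y) p (g : Y -> R) :
  smooth_map_at F p -> smooth_at g (F p) -> smooth_at (fun q => g (F q)) p.
Proof.
move=> [c [d [W [[sc sd cp oW Wp] [WI HF]]]]] Hg.
have dF q : cdom c q -> W (c q) -> cdom d (F q).
  move=> cq /WI [q' [cq' dq'] E].
  by rewrite -(ao_inj Xok sc (x := q') (y := q)) ?inE.
apply/(smooth_at_rep Xok (phi := fun z => crep d g (\row_i crep c (fun q => d (F q) 0 i) z))
  sc cp).
  have := open_nbhs_nbhs (conj oW Wp); apply: filterS => z Wz q cq E.
  have -> : \row_i crep c (fun q => d (F q) 0 i) (c q) = d (F q).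
    by apply/rowP => i; rewrite mxE crepE //; exact: ao_inj Xok _ sc.
  by rewrite crepE //; [exact: ao_inj Yok _ sd|apply: dF => //; rewrite E].
have dp := dF _ cp Wp.
apply: smooth_near_comp.
  have -> : \row_i crep c (fun q => d (F q) 0 i) (c p) = d (F p).
    by apply/rowP => i; rewrite mxE crepE //; exact: ao_inj Xok _ sc.
  exact/(smooth_atE Yok _ sd dp).
by move=> i; under eq_fun do rewrite mxE; exists W.
Qed.

End Spaces.

(** * Bundle atlases and adapted trivialisations *)

Section BundleAtlas.
Lemma near_lsub (R : realType) n m (a : 'rV[R]_(n + m)) (P : set 'rV[R]_n) :
  nbhs (lsubmx a) P -> nbhs a (fun z => P (lsubmx z)).
Proof. exact: (smooth_row_continuous (smooth_row_l (smooth_row_id a))). Qed.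

Variables (R : realType) (M : manifold R) (hM : is_manifold M).

Lemma matl_inj (c : chart R M (mdim M)) : matl c -> set_inj (cdom c) c.
Proof. by case: hM => _ _ _ [H _ _] /H[]. Qed.

Lemma matl_img (c : chart R M (mdim M)) U : matl c -> open U -> U `<=` cdom c ->
  open (c @` U).
Proof. by case: hM => _ _ _ [H _ _] /H[_ _ _]; apply. Qed.

Lemma matl_open (c : chart R M (mdim M)) : matl c -> open (cdom c).
Proof. by case: hM => _ _ _ [H _ _] /H[]. Qed.

Lemma matl_pre (c : chart R M (mdim M)) V : matl c -> open V -> open (cdom c `&` c @^-1` V).
Proof. by case: hM => _ _ _ [H _ _] /H[_ _ + _]; apply. Qed.

Lemma matl_cover (m : M) : exists2 c, @matl R M c & cdom c m.
Proof. by case: hM => _ _ _ [_ H _]. Qed.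

Lemma mspace_ok : atlas_ok (mspace M).
Proof.
split => //.
- by move=> c sc; exact: matl_inj.
- move=> c c' sc sc'; apply: matl_img => //; by apply: openI; exact: matl_open.
- by move=> c c' i sc sc'; case: hM => _ _ _ [_ _]; exact.
Qed.

Lemma near_base (c : chart R M (mdim M)) (m : M) (U : set M) :
  matl c -> cdom c m -> open U -> U m ->
  \forall x \near c m, exists m', [/\ cdom c m', U m' & c m' = x].
Proof.
move=> sc cm oU Um.
have : nbhs (c m) (c @` (cdom c `&` U)).
  apply: open_nbhs_nbhs; split; last by exists m.
  by apply: matl_img => //; apply: openI => //; exact: matl_open.
by apply: filterS => x [m' [cm' Um'] <-]; exists m'.
Qed.

Section Fibre.
Variables (F : M -> Type) (C : forall m, set (F m)) (r : nat).
Implicit Types (t : triv F r) (c : chart R M (mdim M)).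

Definition triv_ok t : Prop :=
  open (tdom t) /\ forall m, tdom t m ->
    set_inj (@C m) (t m) /\ forall y, exists2 x, C x & t m x = y.

(* the transition from t to t', as a function of the coordinates (c, t) *)
Definition tc c t t' (z : 'rV[R]_(mdim M + r)) : 'rV[R]_r :=
  \row_i crep (bchart C c t) (fun p => t' (tag p) (tagged p) 0 i) z.

Lemma bchart_inj c t : matl c -> triv_ok t ->
  set_inj (cdom (bchart C c t)) (bchart C c t).
Proof.
move=> sc [_ tok] [m x] [m' x'] /set_mem [/= Cx [cm tm]] /set_mem [/= Cx' [cm' tm']].
move=> /eq_row_mx [/(matl_inj sc) E Et].
have {}E : m = m' by apply: E; rewrite inE.
by subst m'; congr existT; apply: (tok m tm).1 => //; rewrite inE.
Qed.

Lemma tcE c t t' m x : matl c -> triv_ok t -> cdom c m -> tdom t m -> C x ->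
  tc c t t' (row_mx (c m) (t m x)) = t' m x.
Proof.
move=> sc tok cm tm Cx; apply/rowP => i; rewrite mxE.
exact: (crepE (q := existT _ m x) _ (bchart_inj sc tok)).
Qed.

Lemma near_fibre c t m y (U : set M) : matl c -> triv_ok t -> cdom c m ->
  open U -> U m -> U `<=` tdom t ->
  \forall z \near row_mx (c m) (y : 'rV_r), exists m' x',
    [/\ cdom c m', U m', C x' & row_mx (c m') (t m' x') = z].
Proof.
move=> sc tok cm oU Um Ut.
have : nbhs (lsubmx (row_mx (c m) y))
    [set x | exists m', [/\ cdom c m', U m' & c m' = x]].
  by rewrite row_mxKl; exact: near_base.
move=> /near_lsub; apply: filterS => z [m' [cm' Um' E]].
have [x' Cx' E'] := (tok.2 m' (Ut _ Um')).2 (rsubmx z).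
by exists m', x'; rewrite E E' hsubmxK.
Qed.

(** [tc] is only accessible through [crep]. Since the trivialisation fills whole fibres, near the
    given coordinates it may be replaced by any formula [phi] that is correct on the fibres over
    [U]. *)
Lemma tc_intro c t t' m y (U : set M) phi : matl c -> triv_ok t -> open (tdom t') ->
  cdom c m -> tdom t m -> tdom t' m -> open U -> U m ->
  (forall m' x', U m' -> cdom c m' -> tdom t m' -> tdom t' m' -> C x' ->
    t' m' x' = phi (row_mx (c m') (t m' x'))) ->
  smooth_row (row_mx (c m) y) phi -> smooth_row (row_mx (c m) y) (tc c t t').
Proof.
move=> sc tok ot' cm tm tm' oU Um H; apply: smooth_row_ext.
have oV : open (U `&` (tdom t `&` tdom t')).
  by apply: openI => //; apply: openI => //; case: tok.
have := near_fibre y sc tok cm oV (conj Um (conj tm tm')) (fun m' h => h.2.1).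
apply: filterS => z [m' [x' [cm' [Um' [tm1 tm1']] Cx' <-]]].
by rewrite tcE // -H.
Qed.

Record bundle_ok (ts : set (triv F r)) : Prop := BundleOk {
  bo_triv : forall t, ts t -> triv_ok t;
  bo_cover : forall m, exists2 t, ts t & tdom t m;
  bo_smooth : forall c t t' m y, matl c -> ts t -> ts t' -> cdom c m ->
    tdom t m -> tdom t' m -> smooth_row (row_mx (c m) y) (tc c t t') }.

Lemma bspace_ok ts : bundle_ok ts -> atlas_ok (bspace C ts).
Proof.
move=> bok; split.
- by move=> _ q [c [t [sc tt ->]]] [].
- by move=> _ [c [t [sc tt ->]]]; apply: bchart_inj => //; exact: bo_triv bok _ _.
- move=> _ _ [c [t [sc tt ->]]] [c' [t' [sc' tt' ->]]].
  have tok := bo_triv bok tt; have tok' := bo_triv bok tt'.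
  set D := cdom c `&` cdom c' `&` (tdom t `&` tdom t').
  have oD : open D.
    by apply: openI; apply: openI; [exact: matl_open|exact: matl_open|case: tok|case: tok'].
  (* The overlap is a full cylinder over the image of [D] under [c], because [t] maps each fibre
     onto the whole coordinate space. *)
  rewrite (_ : _ @` _ = lsubmx @^-1` (c @` D)).
    apply: open_comp; first by move=> ? _; exact: continuous_lsubmx.
    by apply: matl_img => // m [[]].
  apply/seteqP; split=> [_ [[m x] [[/= Cx [cm tm]] [_ [cm' tm']]] <-]|z [m [[cm cm'] [tm tm']] E]].
    by rewrite /= row_mxKl; exists m.
  have [x Cx E'] := (tok.2 m tm).2 (rsubmx z).
  by exists (existT _ m x) => //=; rewrite E E' hsubmxK.
- move=> _ _ i [c [t [sc tt ->]]] [c' [t' [sc' tt' ->]]].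
  have tok := bo_triv bok tt; have tok' := bo_triv bok tt'.
  apply: smooth_on_near => _ [[m x] [[/= Cx [cm tm]] [_ [cm' tm']]] <-] /=.
  set phi := fun z => row_mx (trans (X := mspace M) c c' (lsubmx z)) (tc c t t' z).
  apply: (@smooth_near_ext _ _ _ (fun z => phi z 0 i)); last first.
    suff : smooth_row (row_mx (c m) (t m x)) phi by exact.
    apply: smooth_row_mx; last exact: (bo_smooth bok).
    apply: (@smooth_row_comp _ _ _ _ _ lsubmx); last exact: smooth_row_l (smooth_row_id _).
    by rewrite row_mxKl; exact: (smooth_trans mspace_ok).
  have oV : open ((cdom c' `&` tdom t) `&` tdom t').
    by apply: openI; [apply: openI; [exact: matl_open|case: tok]|case: tok'].
  have := near_fibre (t m x) sc tok cm oV (conj (conj cm' tm) tm') (fun m' h => h.1.2).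
  apply: filterS => z [m' [x' [cm1 [[cm1' tm1] tm1'] Cx' <-]]].
  rewrite (crepE (c := bchart C c t) (q := existT _ m' x') _ (bchart_inj sc tok)) //.
  by rewrite /phi tcE // row_mxKl (transE mspace_ok).
Qed.

End Fibre.

Lemma triv_compatP F r (t t' : triv F r) : triv_ok (fun m => [set: F m]) t ->
  open (tdom t') ->
  triv_compat t t' <-> forall c m y, matl c -> cdom c m -> tdom t m -> tdom t' m ->
    smooth_row (row_mx (c m) y) (tc (fun m => [set: F m]) c t t').
Proof.
move=> tok ot'; split=> [H c m y sc cm tm tm' i|H c sc i b].
  under eq_fun do rewrite mxE.
  have [x _ E] := (tok.2 m tm).2 y.
  apply: smooth_near_on (H c sc i); last by exists (existT _ m x); rewrite //= E.
  rewrite (_ : _ @` _ = lsubmx @^-1` (c @` (cdom c `&` (tdom t `&` tdom t')))).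
    apply: open_comp; first by move=> ? _; exact: continuous_lsubmx.
    apply: matl_img => //.
    by apply: openI; [exact: matl_open|apply: openI => //; case: tok].
  apply/seteqP; split=> [_ [[m1 x1] [[/= _ [cm1 tm1]] tm1'] <-]|z [m1 [cm1 [tm1 tm1']] Ez]].
    by rewrite /= row_mxKl; exists m1.
  have [x1 Cx E'] := (tok.2 m1 tm1).2 (rsubmx z).
  by exists (existT _ m1 x1) => //=; rewrite Ez E' hsubmxK.
apply: smooth_on_near => _ [[m x] [[/= _ [cm tm]] tm'] <-].
have := H c m (t m x) sc cm tm tm' i; apply: smooth_near_ext.
by apply: filterE => z; rewrite mxE.
Qed.

Section Product.
Variables (F G : M -> Type) (C : forall m, set (F m)) (D : forall m, set (G m)).
Variables (r s : nat) (I : Type) (ts : I -> triv F r) (ts' : I -> triv G s).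

(** Used to form the fibre product of a vector bundle with its dual, where the canonical pairing
    lives. *)
Definition prod_triv (i : I) : triv (fun m => (F m * G m)%type) (r + s) :=
  Triv (tdom (ts i)) (fun m x => row_mx (ts i m x.1) (ts' i m x.2)).

Lemma prod_bundle_ok (P : set I) : (forall i, tdom (ts' i) = tdom (ts i)) ->
  bundle_ok C [set ts i | i in P] -> bundle_ok D [set ts' i | i in P] ->
  bundle_ok (fun m => [set x | C x.1 /\ D x.2]) [set prod_triv i | i in P].
Proof.
move=> Ed ok1 ok2.
have prok i : P i -> triv_ok (fun m => [set x | C x.1 /\ D x.2]) (prod_triv i).
  move=> Pi; have [oU H1] := bo_triv ok1 (ex_intro2 _ _ i Pi erefl).
  have [_ H2] := bo_triv ok2 (ex_intro2 _ _ i Pi erefl).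
  split=> // m tm; have [i1 s1] := H1 m tm.
  have [|i2 s2] := H2 m; first by rewrite Ed.
  split=> [[x y] [x' y'] /set_mem [/= Cx Dy] /set_mem [/= Cx' Dy'] /eq_row_mx [E E']|z].
    by congr pair; [apply: i1|apply: i2] => //; rewrite inE.
  have [x Cx E] := s1 (lsubmx z); have [y Dy E'] := s2 (rsubmx z).
  by exists (x, y); rewrite //= E E' hsubmxK.
split=> [_ [i Pi <-]|m|c _ _ m y sc [i Pi <-] [j Pj <-] cm tm tm'].
- exact: prok.
- have [_ [i Pi <-] tm] := bo_cover ok1 m.
  by exists (prod_triv i) => //; exists i.
- have ti := bo_triv ok1 (ex_intro2 _ _ i Pi erefl).
  have ti' := bo_triv ok2 (ex_intro2 _ _ i Pi erefl).
  have tj := bo_triv ok1 (ex_intro2 _ _ j Pj erefl).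
  pose phi z := row_mx (tc C c (ts i) (ts j) (row_mx (lsubmx z) (lsubmx (rsubmx z))))
     (tc D c (ts' i) (ts' j) (row_mx (lsubmx z) (rsubmx (rsubmx z)))).
  apply: (@tc_intro _ _ _ c (prod_triv i) (prod_triv j) m y setT phi) => //.
  + exact: prok.
  + by case: tj.
  + exact: openT.
  + move=> m' [x1 x2] _ cm' tm1 tm1' [/= Cx Dx].
    by rewrite /phi /= !(row_mxKl, row_mxKr) !tcE // Ed.
  + have sl := smooth_row_l (smooth_row_id (row_mx (c m) y)).
    have sr := smooth_row_r (smooth_row_id (row_mx (c m) y)).
    apply: smooth_row_mx.
      apply: (@smooth_row_comp _ _ _ _ _ (fun z => row_mx (lsubmx z) (lsubmx (rsubmx z)))).
        by rewrite row_mxKl row_mxKr; apply: (bo_smooth ok1) => //; [exists i|exists j].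
      by apply: smooth_row_mx => //; exact: smooth_row_l.
    apply: (@smooth_row_comp _ _ _ _ _ (fun z => row_mx (lsubmx z) (rsubmx (rsubmx z)))).
      by rewrite row_mxKl row_mxKr; apply: (bo_smooth ok2); rewrite ?Ed //; [exists i|exists j].
    by apply: smooth_row_mx => //; exact: smooth_row_r.
Qed.

End Product.
End BundleAtlas.

(** * Existence and compatibility of adapted trivialisations *)

Section AffineTriv.
Variables (R : realType) (M : manifold R) (hM : is_manifold M).
Variables (A : sabundle M) (hA : is_sabundle A).
Notation k := (ark A).
Notation full := (fun m => [set: afib A m]).
Implicit Types (t : triv (afib A) (1 + k)) (c : chart R M (mdim M)).

Lemma aadd0 m (a : afib A m) : aadd a 0 = a.
Proof. by case: hA => /(_ m)[]. Qed.

Lemma asubK m (a b : afib A m) : aadd b (asub a b) = a.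
Proof. by case: hA => /(_ m)[]. Qed.

Lemma aaddK m (a : afib A m) u : asub (aadd a u) a = u.
Proof. by case: hA => /(_ m)[]. Qed.

Section Affine.
Variables (t : triv (afib A) (1 + k)) (tok : affine_triv t).

Lemma tlin_affine m : tdom t m -> affine_iso_with (t m) (@tlin _ _ _ t m).
Proof.
case: tok => _ /[apply] -[L [bij linL tL]].
suff -> : @tlin _ _ _ t m = L by [].
apply/funext => u; case: (bij) => g _ gK.
(* Every base point gives the same difference [L u]; the point [g 0] shows that there is at least
   one base point. *)
apply: get_eq; first by exists (g 0); rewrite // tL addrAC subrr add0r.
by move=> y [a _ <-]; rewrite tL addrAC subrr add0r.
Qed.

Lemma triv_aadd m (a : afib A m) u : tdom t m -> t m (aadd a u) = t m a + tlin t u.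
Proof. by case/tlin_affine. Qed.

Lemma tlin_linear m s (u w : amod A m) : tdom t m ->
  tlin t (s *: u + w) = s *: tlin t u + tlin t w.
Proof. by case/tlin_affine. Qed.

Lemma tlin0 m : tdom t m -> tlin t (0 : amod A m) = 0.
Proof.
by move=> tm; have := tlin_linear (-1) 0 0 tm; rewrite scaler0 addr0 scaleN1r addNr.
Qed.

Lemma tlinZ m s (u : amod A m) : tdom t m -> tlin t (s *: u) = s *: tlin t u.
Proof. by move=> tm; rewrite -[s *: u]addr0 tlin_linear // tlin0 // addr0. Qed.

Lemma triv_inj m : tdom t m -> injective (t m).
Proof. by case/tlin_affine => /bij_inj. Qed.

Lemma triv_surj m z : tdom t m -> exists a, t m a = z.
Proof. by case/tlin_affine => -[g _ gK] _ _; exists (g z). Qed.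

Lemma triv_asub m (a b : afib A m) : tdom t m -> tlin t (asub a b) = t m a - t m b.
Proof. by move=> tm; rewrite -[in t m a](asubK a b) triv_aadd // addrAC subrr add0r. Qed.

Lemma triv_acomb m l (a b : afib A m) : tdom t m ->
  t m (acomb l a b) = l *: t m a + (1 - l) *: t m b.
Proof.
move=> tm; rewrite /acomb triv_aadd // tlinZ // triv_asub //.
by rewrite scalerBr scalerBl scale1r addrCA.
Qed.

Lemma affine_triv_ok : triv_ok full t.
Proof.
split=> [|m tm]; first by case: tok.
split; first by move=> x y _ _; exact: triv_inj.
by move=> y; have [a <-] := triv_surj y tm; exists a.
Qed.

End Affine.

Lemma atriv_affine t : atrivs t -> affine_triv t.
Proof. by case: hA => _ + _ _ _; apply. Qed.

Lemma atrivs_ok : bundle_ok full (@atrivs _ _ A).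
Proof.
split=> [t /atriv_affine/affine_triv_ok //|m|c t t' m y sc tt tt' cm tm tm'].
  by case: hA => _ _ + _ _; apply.
have ok := atriv_affine tt; have ok' := atriv_affine tt'.
have /(triv_compatP hM (affine_triv_ok ok) ok'.1) : triv_compat t t'.
  by case: hA => _ _ _ + _; apply.
exact.
Qed.

Lemma atrivs_compat t t' : atrivs t -> atrivs t' -> triv_compat t t' /\ triv_compat t' t.
Proof. by case: hA => _ _ _ H _ tt tt'; split; apply: H. Qed.

Lemma adapted_affine t : adapted t -> affine_triv t.
Proof. by case. Qed.

Lemma adapted_triv_ok t : adapted t -> triv_ok full t.
Proof. by move/adapted_affine/affine_triv_ok. Qed.

Lemma tlin_dist t m : adapted t -> tdom t m ->
  tlin t (adist A m) = row_mx (const_mx 1) 0.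
Proof. by case=> _ _; apply. Qed.

(* A change of fibre coordinates [S], with inverse [S'], which is smooth in the
   base coordinates as well. *)
Lemma adapted_change t t1 S S' : affine_triv t ->
  (forall t', atrivs t' -> triv_compat t t' /\ triv_compat t' t) -> affine_triv t1 ->
  tdom t1 `<=` tdom t ->
  (forall m, tdom t1 m -> tlin t1 (adist A m) = row_mx (const_mx 1) 0) ->
  (forall c m a, matl c -> cdom c m -> tdom t1 m ->
     t m a = S c (row_mx (c m) (t1 m a)) /\ t1 m a = S' c (row_mx (c m) (t m a))) ->
  (forall c m y, matl c -> cdom c m -> tdom t1 m ->
     smooth_row (row_mx (c m) y) (S c) /\ smooth_row (row_mx (c m) y) (S' c)) ->
  adapted t1.
Proof.
move=> ok tt ok1 sub H1 H2 H3; split=> // t' tt'.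
have ok' := atriv_affine tt'; have [tt1 tt2] := tt _ tt'.
move/(triv_compatP hM (affine_triv_ok ok) ok'.1): tt1 => tt1.
move/(triv_compatP hM (affine_triv_ok ok') ok.1): tt2 => tt2.
split.
  apply/(triv_compatP hM (affine_triv_ok ok1) ok'.1) => c m y sc cm tm1 tm'.
  have [s1 s2] := H3 c m y sc cm tm1.
  apply: (tc_intro hM (U := tdom t1)
    (phi := fun z => tc full c t t' (row_mx (lsubmx z) (S c z)))) => //.
  - exact: affine_triv_ok.
  - exact: ok'.1.
  - exact: ok1.1.
  - move=> m' a _ cm' tm1' tm'' _; have [E _] := H2 c m' a sc cm' tm1'.
    rewrite row_mxKl -E tcE //; [exact: affine_triv_ok|exact: sub].
  - apply: (@smooth_row_comp _ _ _ _ _ (fun z => row_mx (lsubmx z) (S c z))).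
      by rewrite row_mxKl; apply: tt1 => //; exact: sub.
    by apply: smooth_row_mx => //; exact/smooth_row_l/smooth_row_id.
apply/(triv_compatP hM (affine_triv_ok ok') ok1.1) => c m y sc cm tm' tm1.
apply: (tc_intro hM (U := tdom t1)
  (phi := fun z => S' c (row_mx (lsubmx z) (tc full c t' t z)))) => //.
- exact: affine_triv_ok.
- exact: ok1.1.
- exact: ok1.1.
- move=> m' a _ cm' tm'' tm1' _; have [_ E] := H2 c m' a sc cm' tm1'.
  by rewrite row_mxKl tcE //; exact: affine_triv_ok.
- have sT : smooth_row (row_mx (c m) y) (tc full c t' t).
    by apply: tt2 => //; exact: sub.
  apply: (@smooth_row_comp _ _ _ _ _ (fun z => row_mx (lsubmx z) (tc full c t' t z))).
    by rewrite row_mxKl; exact: (H3 _ _ _ sc cm tm1).2.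
  by apply: smooth_row_mx => //; exact/smooth_row_l/smooth_row_id.
Qed.

Lemma tlin_inj t m (u : amod A m) : affine_triv t -> tdom t m -> tlin t u = 0 -> u = 0.
Proof.
move=> tok tm u0; have [a _] := triv_surj tok 0 tm.
have E : aadd a u = a by apply: (triv_inj tok tm); rewrite triv_aadd // u0 addr0.
by rewrite -(aaddK a u) E -{1}(aadd0 a) aaddK.
Qed.

Definition dist_row t c : 'rV[R]_(mdim M) -> 'rV[R]_(1 + k) :=
  fun x => \row_i crep c (fun m => tlin t (adist A m) 0 i) x.

Lemma dist_rowE t c m : matl c -> cdom c m -> dist_row t c (c m) = tlin t (adist A m).
Proof.
by move=> sc cm; apply/rowP => i; rewrite mxE crepE //; exact: matl_inj.
Qed.

Lemma smooth_dist_row t c m : atrivs t -> matl c -> cdom c m -> tdom t m ->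
  smooth_row (c m) (dist_row t c).
Proof.
move=> tt sc cm tm i; under eq_fun do rewrite mxE.
case: hA => _ _ _ _ [_ /(_ t c tt sc i)]; apply: smooth_near_on; last by exists m.
apply: matl_img => //; apply: openI; first exact: matl_open.
exact: (atriv_affine tt).1.
Qed.

Section Straighten.
Variables (t : triv (afib A) (1 + k)) (tt : atrivs t) (i0 : 'I_(1 + k)).
Notation w := (fun m => tlin t (adist A m)).

(* Linear coordinates in which w becomes the first basis vector: the ratio
   z_i0 / w_i0 and the remaining components of z - (z_i0 / w_i0) w. *)
Definition straight (w z : 'rV[R]_(1 + k)) : 'rV[R]_(1 + k) :=
  let q := z 0 i0 / w 0 i0 in
  row_mx (const_mx q) (\row_j (z - q *: w) 0 (lift (i0 : 'I_k.+1) j)).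

Definition unstraight (w z : 'rV[R]_(1 + k)) : 'rV[R]_(1 + k) :=
  lsubmx z 0 0 *: w +
  \row_i if unlift (i0 : 'I_k.+1) i is Some j then rsubmx z 0 j else 0.

Lemma straightK (u z : 'rV[R]_(1 + k)) : u 0 i0 != 0 -> unstraight u (straight u z) = z.
Proof.
move=> u0; apply/rowP => i; rewrite /unstraight row_mxKl row_mxKr !mxE.
case: unliftP => [j ->|->]; first by rewrite !mxE addrC subrK.
by rewrite addr0 divfK.
Qed.

Lemma unstraightK (u z : 'rV[R]_(1 + k)) : u 0 i0 != 0 -> straight u (unstraight u z) = z.
Proof.
move=> u0.
have E0 : unstraight u z 0 i0 / u 0 i0 = lsubmx z 0 0.
  by rewrite !mxE unlift_none addr0 mulfK.
rewrite /straight E0 -[RHS]hsubmxK; congr row_mx; apply/rowP => j.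
  by rewrite ord1 mxE.
by rewrite mxE /unstraight addrAC subrr add0r mxE liftK.
Qed.

Lemma straight_linear u : linear_row (straight u).
Proof.
move=> r x y; rewrite /straight scale_row_mx add_row_mx; congr row_mx.
  by apply/rowP => j; rewrite !mxE mulrDl mulrA.
by apply/rowP => j; rewrite !mxE !mulrDl; ring.
Qed.

Definition straight_triv : triv (afib A) (1 + k) :=
  Triv [set m | tdom t m /\ w m 0 i0 != 0] (fun m a => straight (w m) (t m a)).

Lemma straight_affine m : tdom straight_triv m ->
  affine_iso_with (straight_triv m) (fun u => straight (w m) (tlin t u)).
Proof.
move=> [tm w0]; have ok := atriv_affine tt.
have [[g gK Kg] linL aL] := tlin_affine ok tm.
split.
- exists (fun z => g (unstraight (w m) z)) => [a|z] /=.
    by rewrite straightK // gK.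
  by rewrite Kg unstraightK.
- by move=> s u v; rewrite linL straight_linear.
- by move=> a u; rewrite /= aL -[in LHS](scale1r (t m a)) straight_linear scale1r.
Qed.

Lemma straight_adapted : adapted straight_triv.
Proof.
have ok := atriv_affine tt.
have od : open (tdom straight_triv).
  (* The locus where the component [i0] of the distinguished section is nonzero must be open.
     Smoothness of that section is known in charts of the base, so the neighbourhood is found in the
     chart [c] and pulled back. *)
  rewrite openE => m [tm w0]; have [c sc cm] := matl_cover hM m.
  have N : nbhs (c m) [set x | dist_row t c x 0 i0 != 0].
    have C := differentiable_continuous
      (smooth_near_diff (smooth_dist_row tt sc cm tm i0)).
    have : nbhs (dist_row t c (c m) 0 i0) [set x | x != 0].
      by apply: open_nbhs_nbhs; split; [exact: open_neq|rewrite /= dist_rowE].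
    by move=> /C.
  have [V [oV Vm HV]] := near_openP N.
  have : nbhs m ((cdom c `&` c @^-1` V) `&` tdom t).
    by apply: open_nbhs_nbhs; split; [apply: openI ok.1; exact: matl_pre|].
  by apply: filterS => m' [[cm' /HV /=]]; rewrite dist_rowE.
have af : affine_triv straight_triv.
  by split=> // m tm; exists (fun u => straight (w m) (tlin t u)); exact: straight_affine.
have tE m : tdom straight_triv m ->
    forall u, tlin straight_triv u = straight (w m) (tlin t (u : amod A m)).
  move=> tm u; have [a _] := triv_surj af 0 tm.
  have [_ _ aL] := straight_affine tm.
  by have := triv_aadd af a u tm; rewrite aL => /addrI.
apply: (@adapted_change t straight_triv
  (fun c z => unstraight (dist_row t c (lsubmx z)) (rsubmx z))
  (fun c z => straight (dist_row t c (lsubmx z)) (rsubmx z))) => //.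
- by move=> t'; exact: atrivs_compat.
- by move=> m [].
- move=> m [tm w0]; rewrite tE; last by split.
  rewrite /straight divff // scale1r subrr; congr row_mx.
  by apply/rowP => j; rewrite !mxE.
- move=> c m a sc cm [tm w0]; rewrite !row_mxKl !row_mxKr dist_rowE //.
  by rewrite /= straightK.
- move=> c m y sc cm [tm w0].
  set z := row_mx _ _.
  have sl : smooth_row z (fun z => lsubmx z) by exact/smooth_row_l/smooth_row_id.
  have sr : smooth_row z (fun z => rsubmx z) by exact/smooth_row_r/smooth_row_id.
  have sw : smooth_row z (fun z => dist_row t c (lsubmx z)).
    by apply: smooth_row_comp sl; rewrite row_mxKl; exact: smooth_dist_row.
  split.
    apply: smooth_rowD.
      by apply: smooth_rowZ => //; exact: (smooth_row_l sr).
    move=> i; under eq_fun do rewrite mxE.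
    by case: unliftP => [j _|_]; [exact: (smooth_row_r sr)|exact: smooth_near_cst].
  have sq : smooth_near z (fun z => rsubmx z 0 i0 / dist_row t c (lsubmx z) 0 i0).
    apply: smooth_nearM; first exact: sr.
    by apply: smooth_nearV (sw i0); rewrite row_mxKl dist_rowE.
  apply: smooth_row_mx; first exact: smooth_row_const.
  have S := smooth_rowD sr (smooth_rowN (smooth_rowZ sq sw)).
  by move=> j; under eq_fun do rewrite mxE; exact: S.
Qed.

End Straighten.

(** The distinguished vector is nonzero at [m], so one of its components is nonzero there, and the
    trivialisation is straightened along that component. *)
Lemma adapted_cover m : exists2 t, @adapted _ _ A t & tdom t m.
Proof.
have [t tt tm] := bo_cover atrivs_ok m.
have ok := atriv_affine tt.
have /eqP w0 : tlin t (adist A m) != 0.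
  have [_ _ _ _ [/(_ m) d0 _]] := hA.
  by apply: contra_neq d0 => /(tlin_inj ok tm).
have [i wi] : exists i, tlin t (adist A m) 0 i != 0.
  apply: contrapT => H; apply: w0; apply/rowP => i; rewrite mxE.
  by apply/eqP; apply: contrapT => /negP wi; apply: H; exists i.
by exists (straight_triv t i); [exact: straight_adapted|].
Qed.

Lemma adapted_ok : bundle_ok full (@adapted _ _ A).
Proof.
split=> [t|m|c t t' m y sc tt tt' cm tm tm']; first exact: adapted_triv_ok.
  exact: adapted_cover.
(* An adapted trivialisation is only known to be compatible with the original ones, so the
   transition between two adapted ones is factored through an original [t2]. *)
have [t2 tt2 tm2] := bo_cover atrivs_ok m.
have ok := adapted_triv_ok tt; have ok' := adapted_triv_ok tt'.
have ok2 := atriv_affine tt2.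
have [_ /(_ _ tt2) [C1 _] _] := tt.
have [_ /(_ _ tt2) [_ C2] _] := tt'.
move/(triv_compatP hM ok ok2.1): C1 => C1.
move/(triv_compatP hM (affine_triv_ok ok2) ok'.1): C2 => C2.
apply: (tc_intro hM (U := tdom t2)
  (phi := fun z => tc full c t2 t' (row_mx (lsubmx z) (tc full c t t2 z)))) => //.
- exact: ok'.1.
- exact: ok2.1.
- move=> m' a tm2' cm' tm1' tm1 _; rewrite row_mxKl !tcE //.
  exact: affine_triv_ok.
- apply: (@smooth_row_comp _ _ _ _ _ (fun z => row_mx (lsubmx z) (tc full c t t2 z))).
    by rewrite row_mxKl; exact: C2.
  by apply: smooth_row_mx; [exact/smooth_row_l/smooth_row_id|exact: C1].
Qed.

Lemma aspace_ok : atlas_ok (aspace A).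
Proof. exact: bspace_ok adapted_ok. Qed.

End AffineTriv.

(** * Points and lines in adapted coordinates *)

Section Frames.
Variables (R : realType) (M : manifold R) (hM : is_manifold M).

Lemma row1E (z : 'rV[R]_1) : z = const_mx (z 0 0).
Proof. by apply/rowP => i; rewrite ord1 mxE. Qed.

Section OneBundle.
Variables (A : sabundle M) (hA : is_sabundle A).
Notation k := (ark A).
Notation full := (fun m => [set: afib A m]).
Implicit Types (c : chart R M (mdim M)).

Definition uc (t : triv (afib A) (1 + k)) m (a : afib A m) : R := t m a 0 (lshift k 0).
Definition yc (t : triv (afib A) (1 + k)) m (a : afib A m) : 'rV[R]_k := rsubmx (t m a).

Section Adapted.
Variables (t : triv (afib A) (1 + k)) (tt : adapted t) (m : M) (tm : tdom t m).
Implicit Types (a b : afib A m) (S : set (afib A m)) (y : 'rV[R]_k).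

Lemma tsplit a : t m a = row_mx (const_mx (uc t a)) (yc t a).
Proof. by rewrite -[LHS]hsubmxK [lsubmx _]row1E mxE. Qed.

Lemma t_eq a b : uc t a = uc t b -> yc t a = yc t b -> a = b.
Proof.
by move=> E1 E2; apply: (triv_inj (adapted_affine tt) tm); rewrite !tsplit E1 E2.
Qed.

Lemma t_point u y : exists a, uc t a = u /\ yc t a = y.
Proof.
have [a E] := triv_surj (adapted_affine tt) (row_mx (const_mx u) y) tm.
by exists a; rewrite /uc /yc E row_mxKr row_mxEl mxE.
Qed.

Lemma t_shift a s : t m (avshift a s) = row_mx (const_mx (uc t a + s)) (yc t a).
Proof.
rewrite /avshift (triv_aadd (adapted_affine tt)) // (tlinZ (adapted_affine tt)) //.
rewrite tlin_dist // tsplit scale_row_mx add_row_mx scaler0 addr0; congr row_mx.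
by apply/rowP => i; rewrite !mxE mulr1.
Qed.

Lemma uc_shift a s : uc t (avshift a s) = uc t a + s.
Proof. by rewrite /uc t_shift row_mxEl mxE. Qed.

Lemma yc_shift a s : yc t (avshift a s) = yc t a.
Proof. by rewrite /yc t_shift row_mxKr. Qed.

Lemma uc_comb l a b : uc t (acomb l a b) = l * uc t a + (1 - l) * uc t b.
Proof. by rewrite /uc (triv_acomb hA (adapted_affine tt)) // !mxE. Qed.

Lemma yc_comb l a b : yc t (acomb l a b) = l *: yc t a + (1 - l) *: yc t b.
Proof. by rewrite /yc (triv_acomb hA (adapted_affine tt)) // linearD /= !linearZ. Qed.

Definition Ln (y : 'rV[R]_k) : set (afib A m) := [set a | yc t a = y].

Lemma zetaE a : zeta a = Ln (yc t a).
Proof.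
apply/seteqP; split=> [_ [s _ <-]|b /= E]; first exact: yc_shift.
by exists (uc t b - uc t a) => //; apply: t_eq; rewrite ?uc_shift ?yc_shift // addrC subrK.
Qed.

Lemma Ln_line y : is_line (Ln y).
Proof. by have [a [_ <-]] := t_point 0 y; exists a; rewrite zetaE. Qed.

Lemma line_trivE y : line_triv t m (Ln y) = y.
Proof.
apply: get_eq => [|_ [a <- <-]//].
by have [a [_ E]] := t_point 0 y; exists a.
Qed.

Lemma line_LnE S : is_line S -> S = Ln (line_triv t m S).
Proof. by move=> [a ->]; rewrite zetaE line_trivE. Qed.

Lemma line_mem S a : is_line S -> S a <-> yc t a = line_triv t m S.
Proof. by move=> /line_LnE {1}->. Qed.

Lemma zeta_yc a S : is_line S -> zeta a = S <-> yc t a = line_triv t m S.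
Proof.
move=> lS; rewrite zetaE; split=> [<-|->]; first by rewrite line_trivE.
by rewrite -line_LnE.
Qed.

Lemma line_triv_zeta a : line_triv t m (zeta a) = yc t a.
Proof. by rewrite zetaE line_trivE. Qed.

Lemma line_comb_Ln l y y' :
  line_comb l (existT _ m (Ln y)) (existT _ m (Ln y')) =
  existT _ m (Ln (l *: y + (1 - l) *: y')) :> line_pt A.
Proof.
congr existT; apply/seteqP; split=> [x [a [S [b [/= Ea E Sb ->]]]]|x /= E].
  have {}E : Ln y' = S := eq_from_Tagged E.
  move: Sb; rewrite -E => Sb.
  have H := yc_comb l a b.
  by rewrite (Ea : yc t a = y) (Sb : yc t b = y') in H.
have [b [ub yb]] := t_point 0 y'.
(* To write [x] as a combination, all of its [u]-coordinate is put into [a], which requires dividing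
   by [l]. For [l = 0] the point [a] contributes nothing, and [x] itself serves as [b]. *)
have [E0|l0] := eqVneq l 0.
  have [a [_ ya]] := t_point 0 y.
  exists a, (Ln y'), x; split=> //; first by rewrite /Ln /= (E : yc t x = _) E0 scale0r add0r subr0 scale1r.
  by apply: t_eq; rewrite ?uc_comb ?yc_comb E0 ?mul0r ?scale0r subr0 ?mul1r ?scale1r add0r.
have [a [ua ya]] := t_point (uc t x / l) y.
exists a, (Ln y'), b; split=> //; apply: t_eq; rewrite ?uc_comb ?yc_comb ?ya ?yb ?ua ?ub //.
by rewrite mulr0 addr0 mulrC divfK.
Qed.

Lemma tagged_line_comb l y y' :
  tagged (line_comb l (existT _ m (Ln y)) (existT _ m (Ln y'))) =
  Ln (l *: y + (1 - l) *: y') :> set (afib A m).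
Proof. exact: (eq_from_Tagged (line_comb_Ln l y y')). Qed.

End Adapted.

Lemma line_bundle_ok : bundle_ok (fun m => [set S : set (afib A m) | is_line S])
  [set line_triv t | t in @adapted _ _ A].
Proof.
have ok t : adapted t -> triv_ok (fun m => [set S : set (afib A m) | is_line S]) (line_triv t).
  move=> tt; split=> [|m tm]; first exact: (adapted_affine tt).1.
  split=> [S S' /set_mem /= lS /set_mem /= lS' E|y].
    have {}E : line_triv t m S = line_triv t m S' := E.
    by rewrite (line_LnE tt tm lS) E -line_LnE.
  by exists (Ln t y : set (afib A m)); [exact: Ln_line|exact: line_trivE].
split=> [_ [t tt <-]|m|c _ _ m y sc [t tt <-] [t' tt' <-] cm tm tm']; first exact: ok.
  by have [t tt tm] := adapted_cover hM hA m; exists (line_triv t) => //; exists t.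
(* The transition of lines lifts a line to its point with [u = 0], changes the trivialisation of
   that point and forgets [u]; any other point of the line would give the same result. *)
apply: (tc_intro hM (U := setT) (phi := fun z => rsubmx
   (tc full c t t' (row_mx (lsubmx z) (row_mx 0 (rsubmx z)))))) => //.
- exact: ok.
- exact: (adapted_affine tt').1.
- exact: openT.
- move=> m' S _ cm' tm1 tm1' lS; have [a [ua ya]] := t_point tt tm1 0 (line_triv t m' S).
  rewrite row_mxKl row_mxKr.
  have -> : row_mx 0 (line_triv t m' S) = t m' a.
    by rewrite tsplit ua ya; congr row_mx; apply/rowP => i; rewrite !mxE.
  rewrite tcE //; last exact: adapted_triv_ok.
  by apply/esym/(line_mem tt' tm1' a lS)/(line_mem tt tm1 a lS).
- apply: smooth_row_r.
  apply: (@smooth_row_comp _ _ _ _ _ (fun z => row_mx (lsubmx z) (row_mx 0 (rsubmx z)))).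
    by rewrite row_mxKl row_mxKr; apply: (bo_smooth (adapted_ok hM hA)).
  apply: smooth_row_mx; first exact/smooth_row_l/smooth_row_id.
  by apply: smooth_row_mx; [exact: smooth_row_cst|exact/smooth_row_r/smooth_row_id].
Qed.

Lemma line_space_ok : atlas_ok (line_space A).
Proof. exact: (bspace_ok hM line_bundle_ok). Qed.

Lemma adjoint_sab : is_sabundle (adjoint A).
Proof.
case: (hA) => H1 H2 H3 H4 [H5 H6]; split=> //; split=> [m|t c tt sc i] /=.
  by rewrite (oppr_eq0 (adist A m)); exact: H5.
have ok := atriv_affine hA tt.
have oU : open (c @` (cdom c `&` tdom t)).
  by apply: matl_img => //; apply: openI; [exact: matl_open|exact: ok.1].
apply: smooth_on_near => x [m [cm tm] <-].
apply: (@smooth_near_ext _ _ _ (fun x => - crep c (fun m => tlin t (adist A m) 0 i) x)).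
  have : nbhs (c m) (c @` (cdom c `&` tdom t)) by apply: open_nbhs_nbhs; split => //; exists m.
  apply: filterS => _ [m' [cm' tm'] <-]; rewrite !crepE //; try exact: matl_inj.
  transitivity (tlin t (-1 *: adist A m') 0 i); first by rewrite tlinZ // !mxE mulN1r.
  by rewrite scaleN1r.
by apply: smooth_nearN; apply: smooth_near_on (H6 t c tt sc i) => //; exists m.
Qed.

(** The [u]-coordinate is normalised by the distinguished section, so it changes sign with that
    section, while [y] is unaffected. *)
Definition neg_triv (t : triv (afib A) (1 + k)) : triv (afib (adjoint A)) (1 + ark (adjoint A)) :=
  Triv (tdom t) (fun m a => row_mx (- lsubmx (t m a)) (rsubmx (t m a))).

Lemma neg_triv_adapted t : adapted t -> adapted (neg_triv t).
Proof.
move=> tt; have ok := adapted_affine tt.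
pose neg (z : 'rV[R]_(1 + k)) := row_mx (- lsubmx z) (rsubmx z).
have nl : linear_row neg.
  move=> r u v; rewrite /neg !linearD /= !linearZ /= scale_row_mx add_row_mx.
  by rewrite scalerN.
have nK : involutive neg by move=> z; rewrite /neg row_mxKl row_mxKr opprK hsubmxK.
have aff m : tdom t m -> @affine_iso_with _ _ (adjoint A) m (neg_triv t m) (neg \o tlin t (m := m)).
  move=> tm; have [bij tL ta] := tlin_affine ok tm; split.
  - by apply: (@bij_comp _ _ _ neg) => //; exists neg.
  - by move=> s u w; rewrite /= tL nl.
  - move=> a u; transitivity (neg (t m a + tlin t u)); first by rewrite -ta.
    by rewrite -{1}[t m a]scale1r nl scale1r.
have af : @affine_triv _ _ (adjoint A) (neg_triv t).
  by split=> [|m tm]; [exact: ok.1|exists (neg \o tlin t (m := m)); exact: aff].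
have tE m : tdom t m -> forall u, tlin (neg_triv t) u = neg (tlin t (u : amod A m)).
  move=> tm u; have [a _] := triv_surj af 0 tm.
  have [_ _ aL] := aff m tm.
  by have := triv_aadd af a u tm; rewrite aL => /addrI.
apply: (@adapted_change _ _ hM (adjoint A) adjoint_sab t (neg_triv t)
  (fun c z => neg (rsubmx z)) (fun c z => neg (rsubmx z))) => //.
- by case: tt.
- move=> m tm; have -> : adist (adjoint A) m = -1 *: adist A m by rewrite scaleN1r.
  rewrite tE // tlinZ // tlin_dist // /neg scale_row_mx.
  rewrite row_mxKl row_mxKr scaler0; congr row_mx.
  by apply/rowP => i; rewrite !mxE mulN1r opprK.
- by move=> c m a sc cm tm; rewrite !row_mxKr nK.
- move=> c m y sc cm tm.
  have S : smooth_row (row_mx (c m) y) (fun z => neg (rsubmx z)).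
    apply: (@smooth_row_comp _ _ _ _ _ (fun z => rsubmx z)).
      exact: smooth_row_lin.
    exact/smooth_row_r/smooth_row_id.
  by split.
Qed.

End OneBundle.
End Frames.

(** * The affine dual *)

Section Sharp.
Variables (R : realType) (M : manifold R) (hM : is_manifold M).

(** Two-point combinations suffice: [f - f 0] is homogeneous by combining with the origin, and
    additive because [x + y] is the midpoint of [2 *: x] and [2 *: y]. Values in a general module
    are allowed, since the map from A into its hull is also treated this way. *)
Lemma affine_rowE (V : lmodType R) n (f : 'rV[R]_n -> V) :
  (forall l x y, f (l *: x + (1 - l) *: y) = l *: f x + (1 - l) *: f y) ->
  forall x, f x = f 0 + \sum_i x 0 i *: (f (delta_mx 0 i) - f 0).
Proof.
move=> H; pose g x := f x - f 0.
have gZ l x : g (l *: x) = l *: g x.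
  rewrite /g; have := H l x 0; rewrite scaler0 addr0 => ->.
  by rewrite scalerBr scalerBl scale1r -addrA; congr (_ + _); rewrite addrAC subrr sub0r.
have gD x y : g (x + y) = g x + g y.
  have h2 : (1 - 2^-1) = 2^-1 :> R by field.
  have -> : x + y = 2^-1 *: (2 *: x) + (1 - 2^-1) *: (2 *: y).
    by rewrite h2 !scalerA mulVf ?pnatr_eq0 // !scale1r.
  have E z : f (2 *: z) = 2 *: g z + f 0 by rewrite -gZ /g subrK.
  rewrite {1}/g H !E h2 !scalerDr !scalerA mulVf ?pnatr_eq0 // !scale1r addrACA -scalerDl.
  by rewrite (_ : 2^-1 + 2^-1 = 1 :> R) ?scale1r ?addrK //; field.
move=> x; rewrite addrC; apply/eqP; rewrite -subr_eq -/(g x) {1}(row_sum_delta x).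
have g0 : g 0 = 0 by rewrite /g subrr.
by apply/eqP; elim/big_rec2: _ => // i u v _ <-; rewrite gD gZ.
Qed.

Lemma affine_dotv n (f : 'rV[R]_n -> R) :
  (forall l x y, f (l *: x + (1 - l) *: y) = l * f x + (1 - l) * f y) ->
  exists p, forall x, f x = f 0 + dotv p x.
Proof.
move=> H; exists (\row_i (f (delta_mx 0 i) - f 0)) => x.
rewrite {1}(@affine_rowE R^o _ f H); congr (_ + _).
by apply: eq_bigr => i _; rewrite mxE mulrC.
Qed.

Variables (A : sabundle M) (hA : is_sabundle A).
Notation k := (ark A).
Notation full := (fun m => [set: afib A m]).
Implicit Types (c : chart R M (mdim M)).

(* the value at the point with coordinates [w] of the function with coordinates [z] *)
Definition sev (z w : 'rV[R]_(1 + k)) : R :=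
  z 0 (lshift k 0) + w 0 (lshift k 0) + dotv (rsubmx z) (rsubmx w).

Section Adapted.
Variables (t : triv (afib A) (1 + k)) (tt : adapted t) (m : M) (tm : tdom t m).

(** The case [s = 1] describes points of the affine dual, the case [s = 0] vectors of its model. In
    coordinates [f] is affine, and [s] is forced as its [u]-slope because [v_A] is the first basis
    vector. *)
Lemma sharp_pred_coord s (f : afib A m -> R) : sharp_pred s f ->
  exists z : 'rV[R]_(1 + k), forall a,
    f a = z 0 (lshift k 0) + s * uc t a + dotv (rsubmx z) (yc t a).
Proof.
move=> [Hf fs]; have [[g gK Kg] _ _] := tlin_affine (adapted_affine tt) tm.
have [|p Hp] := @affine_dotv _ (f \o g).
  move=> l x y /=; rewrite -Hf; congr f; apply: (can_inj gK).
  by rewrite Kg (triv_acomb hA (adapted_affine tt)) // !Kg.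
have fE a : f a = f (g 0) + dotv p (t m a) by have := Hp (t m a); rewrite /= gK.
have p0 : lsubmx p 0 0 = s.
  rewrite -(fs (g 0)) fE addrAC subrr add0r; have := t_shift tt tm (g 0) 1.
  rewrite /avshift scale1r => ->; rewrite /uc /yc Kg.
  have -> : (0 : 'rV[R]_(1 + k)) 0 (lshift k 0) = 0 by rewrite mxE.
  rewrite -[p in RHS]hsubmxK dotv_row_mx add0r linear0 dotv0r addr0.
  by rewrite [lsubmx p in RHS]row1E dotv_const mulr1.
exists (row_mx (const_mx (f (g 0))) (rsubmx p)) => a.
rewrite fE tsplit -{1}[p]hsubmxK dotv_row_mx row_mxKr row_mxEl mxE addrA.
by rewrite [lsubmx p]row1E dotv_const p0.
Qed.

Lemma coord_unique s (z z' : 'rV[R]_(1 + k)) :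
  (forall a : afib A m, z 0 (lshift k 0) + s * uc t a + dotv (rsubmx z) (yc t a) =
     z' 0 (lshift k 0) + s * uc t a + dotv (rsubmx z') (yc t a)) -> z = z'.
Proof.
move=> H; have E0 : z 0 (lshift k 0) = z' 0 (lshift k 0).
  by have [a [ua ya]] := t_point tt tm 0 0; have := H a; rewrite ua ya !dotv0r mulr0 !addr0.
rewrite -[z]hsubmxK -[z']hsubmxK; congr row_mx; first by apply/rowP => i; rewrite !ord1 !mxE.
apply: dotv_ext => v; have [a [ua ya]] := t_point tt tm 0 v.
by have := H a; rewrite ua ya E0 => /addrI.
Qed.

Lemma sharp_ofcoord s (z : 'rV[R]_(1 + k)) : sharp_pred s
  (fun a : afib A m => z 0 (lshift k 0) + s * uc t a + dotv (rsubmx z) (yc t a)).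
Proof.
split=> [l a b|a].
  by rewrite (uc_comb hA) // (yc_comb hA) // dotvDr !dotvZr; ring.
have E := uc_shift tt tm a 1; have E' := yc_shift tt tm a 1.
by rewrite /avshift scale1r in E E'; rewrite E E'; ring.
Qed.

Lemma sharp_trivP (f : afib (sharp A) m) a :
  sval f a = sev (sharp_triv t m f) (t m a).
Proof.
have [z Hz] := sharp_pred_coord (svalP f).
have svE (w : 'rV[R]_(1 + k)) b : w 0 (lshift k 0) + t m b 0 (lshift k 0) +
    \sum_(j < k) w 0 (rshift 1 j) * t m b 0 (rshift 1 j) = sev w (t m b).
  by congr (_ + _); apply: eq_bigr => j _; rewrite !mxE.
suff -> : sharp_triv t m f = z by rewrite Hz mul1r.
apply: get_eq => [b|y Hy]; first by rewrite svE Hz mul1r.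
by apply: (@coord_unique 1) => b; rewrite -Hz Hy svE mul1r.
Qed.

Lemma sharp_triv_eq (f : afib (sharp A) m) z :
  (forall a, sval f a = sev z (t m a)) -> sharp_triv t m f = z.
Proof.
by move=> H; apply: (@coord_unique 1) => b; rewrite mul1r -[LHS]sharp_trivP H.
Qed.

Lemma sharp_fib_eq (f g : afib (sharp A) m) : (forall a, sval f a = sval g a) -> f = g.
Proof.
case: f g => [f Hf] [g Hg] /= /funext E; subst g; congr exist.
exact: Prop_irrelevance.
Qed.

Lemma sharp_triv_affine : exists L, @affine_iso_with _ _ (sharp A) m (sharp_triv t m) L.
Proof.
have mkf (z : 'rV[R]_(1 + k)) : exists f : afib (sharp A) m, sharp_triv t m f = z.
  exists (exist _ _ (sharp_ofcoord 1 z) : afib (sharp A) m); apply: sharp_triv_eq => a.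
  by rewrite /= mul1r.
have bij : bijective (sharp_triv t m).
  exists (fun z => projT1 (cid (mkf z))) => [f|z]; last exact: projT2 (cid (mkf z)).
  apply: sharp_fib_eq => a; rewrite sharp_trivP; set e := cid _.
  by rewrite (projT2 e) -sharp_trivP.
pose Lp (g : amod (sharp A) m) (z : 'rV[R]_(1 + k)) := forall a,
  sublmod_val g a = z 0 (lshift k 0) + 0 * uc t a + dotv (rsubmx z) (yc t a).
have Lex g : exists z, Lp g z.
  by case: g => g Hg; apply: (@sharp_pred_coord 0 g); move: (Hg) => /asboolP.
pose L g := projT1 (cid (Lex g)); have LP g : Lp g (L g) := projT2 (cid (Lex g)).
exists L; split=> // [s g h|f g].
  apply: (@coord_unique 0) => a; rewrite -LP.
  rewrite linearD linearZ /= !mxE dotvDl dotvZl.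
  change (s * sublmod_val g a + sublmod_val h a = s * L g 0 (lshift k 0) +
    L h 0 (lshift k 0) + 0 * uc t a + (s * dotv (rsubmx (L g)) (yc t a) +
    dotv (rsubmx (L h)) (yc t a))).
  by rewrite !LP; ring.
apply: sharp_triv_eq => a.
change (1 * sublmod_val g a + sval f a = sev (sharp_triv t m f + L g) (t m a)).
by rewrite LP sharp_trivP /sev linearD /= !mxE dotvDl; ring.
Qed.

End Adapted.

Lemma sharp_affine t : adapted t -> @affine_triv _ _ (sharp A) (sharp_triv t).
Proof.
by move=> tt; split=> [|m tm]; [exact: (adapted_affine tt).1|exact: sharp_triv_affine].
Qed.

Lemma sharp_compat t t' : adapted t -> adapted t' ->
  @triv_compat _ _ (afib (sharp A)) _ (sharp_triv t) (sharp_triv t').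
Proof.
move=> tt tt'.
have ok := @affine_triv_ok _ _ (sharp A) _ (sharp_affine tt).
have ok' := @affine_triv_ok _ _ (sharp A) _ (sharp_affine tt').
apply/(triv_compatP hM ok ok'.1) => c m y sc cm tm tm'.
(* The new coordinates of a function are recovered from its values at the points whose
   [t']-coordinates are [0] and [(0; e_j)]. These points are located in [t] by the transition from
   [t'] to [t], which is smooth; [G] is the value of the function there. *)
pose T (z : 'rV[R]_(mdim M + (1 + k))) v :=
  tc full c t' t (row_mx (lsubmx z) (row_mx 0 v : 'rV[R]_(1 + k))).
pose G z v := sev (rsubmx z) (T z v).
apply: (tc_intro hM (U := setT) (phi := fun z => row_mx (const_mx (G z 0))
   (\row_j (G z (delta_mx 0 j) - G z 0)))) => //.
- exact: ok'.1.
- exact: openT.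
- move=> m' f _ cm' tm1 tm1' _.
  have GE (b : afib A m') : uc t' b = 0 ->
      G (row_mx (c m') (sharp_triv t m' f)) (yc t' b) = sval f b.
    move=> ub; rewrite /G /T row_mxKl row_mxKr.
    have -> : row_mx 0 (yc t' b) = t' m' b.
      by rewrite tsplit ub; congr row_mx; apply/rowP => i; rewrite !mxE.
    by rewrite tcE //; [rewrite -sharp_trivP|exact: adapted_triv_ok].
  have val0 v : G (row_mx (c m') (sharp_triv t m' f)) v =
      sharp_triv t' m' f 0 (lshift k 0) + dotv (rsubmx (sharp_triv t' m' f)) v.
    have [b [ub <-]] := t_point tt' tm1' 0 v.
    by rewrite GE // (sharp_trivP tt' tm1') /sev -/(uc t' b) ub addr0.
  rewrite !val0 dotv0r addr0 -[LHS]hsubmxK; congr row_mx.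
    by apply/rowP => i; rewrite !mxE ord1.
  by apply/rowP => j; rewrite mxE [in RHS]mxE val0 dotv_delta mxE; ring.
- have Gs v : smooth_near (row_mx (c m) y) (G^~ v).
    have sl := smooth_row_l (smooth_row_id (row_mx (c m) y)).
    have sr := smooth_row_r (smooth_row_id (row_mx (c m) y)).
    have sT : smooth_row (row_mx (c m) y) (T^~ v).
      apply: (@smooth_row_comp _ _ _ _ _ (fun z => row_mx (lsubmx z) (row_mx 0 v))).
        by rewrite row_mxKl; apply: (bo_smooth (adapted_ok hM hA)).
      by apply: smooth_row_mx => //; exact: smooth_row_cst.
    apply: smooth_nearD; first by apply: smooth_nearD; [exact: sr|exact: sT].
    by apply: smooth_near_dot; exact: smooth_row_r.
  apply: smooth_row_mx; first exact: smooth_row_const.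
  by move=> j; under eq_fun do rewrite mxE; exact: smooth_nearB.
Qed.

Lemma sharp_tlin_dist t m : adapted t -> tdom t m ->
  @tlin _ _ (sharp A) (sharp_triv t) m (adist (sharp A) m) = row_mx (const_mx 1) 0.
Proof.
move=> tt tm; have ok := sharp_affine tt.
have [f _] := @triv_surj _ _ (sharp A) _ ok m 0 tm.
have := @triv_aadd _ _ (sharp A) _ ok m f (adist (sharp A) m) tm.
move/eqP; rewrite addrC -subr_eq => /eqP <-; apply/eqP; rewrite subr_eq; apply/eqP.
apply: sharp_triv_eq => // a.
change (1 * 1 + sval f a = sev (row_mx (const_mx 1) 0 + sharp_triv t m f) (t m a)).
rewrite (sharp_trivP tt tm) /sev linearD /= mxE dotvDl row_mxKr dotv0l row_mxEl mxE; ring.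
Qed.

Lemma sharp_sab : is_sabundle (sharp A).
Proof.
split.
- move=> m; split.
  + move=> f; apply: sharp_fib_eq => a; change (1 * 0 + sval f a = sval f a); ring.
  + move=> f u w; apply: sharp_fib_eq => a.
    change (1 * sublmod_val w a + (1 * sublmod_val u a + sval f a) =
      1 * (sublmod_val u a + sublmod_val w a) + sval f a); ring.
  + move=> f g; apply: sharp_fib_eq => a.
    change (1 * (-1 * sval g a + sval f a) + sval g a = sval f a); ring.
  + move=> f u; apply: val_inj; apply/funext => a.
    change (-1 * sval f a + (1 * sublmod_val u a + sval f a) = sublmod_val u a); ring.
- by move=> _ [t tt <-]; exact: sharp_affine.
- by move=> m; have [t tt tm] := adapted_cover hM hA m; exists (sharp_triv t) => //; exists t.
- by move=> _ _ [t tt <-] [t' tt' <-]; exact: sharp_compat.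
- split=> [m|_ c [t tt <-] sc i].
    have [t tt tm] := adapted_cover hM hA m; have [a _] := t_point tt tm 0 0.
    apply/eqP => /(congr1 (fun u : amod (sharp A) m => sublmod_val u a)) /= /eqP.
    by apply/negP; exact: (oner_neq0 R).
  apply: smooth_on_near => x [m [cm tm] <-].
  apply: (@smooth_near_ext _ _ _ (fun=> (row_mx (const_mx 1) 0 : 'rV[R]_(1 + k)) 0 i)).
    have : nbhs (c m) (c @` (cdom c `&` tdom t)).
      apply: open_nbhs_nbhs; split; last by exists m.
      apply: matl_img => //; apply: openI; [exact: matl_open|exact: (adapted_affine tt).1].
    apply: filterS => _ [m' [cm' tm'] <-]; rewrite crepE //; last exact: matl_inj.
    by rewrite sharp_tlin_dist.
  exact: smooth_near_cst.
Qed.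

Lemma sharp_adapted t : adapted t -> @adapted _ _ (sharp A) (sharp_triv t).
Proof.
move=> tt; split; first exact: sharp_affine.
  by move=> _ [t' tt' <-]; split; exact: sharp_compat.
by move=> m tm; exact: sharp_tlin_dist.
Qed.

End Sharp.

(** * The contact bundle in a frame *)

Section Jets.
Variables (R : realType) (M : manifold R) (hM : is_manifold M).
Variables (A : sabundle M) (hA : is_sabundle A).
Notation k := (ark A).
Notation n := (mdim M).
Implicit Types (sg : section A) (m : M) (y : 'rV[R]_k).

Definition frame (c : chart R M (mdim M)) (t : triv (afib A) (1 + k)) m : Prop :=
  [/\ matl c, adapted t, cdom c m & tdom t m].

Lemma frame_ex m : exists c t, frame c t m.
Proof.
by have [c sc cm] := matl_cover hM m; have [t tt tm] := adapted_cover hM hA m; exists c, t.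
Qed.

Definition Lp (t : triv (afib A) (1 + k)) m y : line_pt A := existT _ m (Ln t y).

Definition us (t : triv (afib A) (1 + k)) sg (q : line_space A) : R :=
  uc t (sg (tag q) (tagged q)).

Lemma section_yc t sg (m : M) (S : set (afib A m)) : adapted t -> tdom t m ->
  is_section sg -> is_line S -> yc t (sg m S) = line_triv t m S.
Proof. by move=> tt tm sec lS; apply/(zeta_yc tt tm _ lS); exact: sec. Qed.

Lemma sec_subE t sg sg' m (S : set (afib A m)) : adapted t -> tdom t m ->
  is_section sg -> is_section sg' -> is_line S ->
  sec_sub sg sg' (existT _ m S) = uc t (sg' m S) - uc t (sg m S).
Proof.
move=> tt tm s s' lS; have us' := uc_shift tt tm; apply: get_eq => /= [|h ->].
  apply: (t_eq tt tm); first by rewrite us' opprB addrC subrK.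
  by rewrite (yc_shift tt tm) !section_yc.
by rewrite us' opprD opprK addrA subrr add0r.
Qed.

Lemma fsecE t sg m (a : afib A m) : adapted t -> tdom t m -> is_section sg ->
  fsec sg (existT _ m a) = uc t a - uc t (sg m (zeta a)).
Proof.
move=> tt tm s; have us' := uc_shift tt tm; have lS : is_line (zeta a) by exists a.
apply: get_eq => /= [|h E]; last by have := congr1 (fun b => uc t b) E; rewrite us' => <-; ring.
apply: (t_eq tt tm); first by rewrite us' addrC subrK.
by rewrite (yc_shift tt tm) section_yc // line_triv_zeta.
Qed.

Lemma sec_add_section sg h : is_section sg -> is_section (sec_add sg h).
Proof.
move=> sec m S lS; have [t tt tm] := adapted_cover hM hA m.
by apply/(zeta_yc tt tm _ lS); rewrite (yc_shift tt tm) section_yc.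
Qed.

Lemma us_sec_add t sg h q : adapted t -> tdom t (tag q) ->
  us t (sec_add sg h) q = us t sg q - h q.
Proof. by case: q => m S tt tm; rewrite /us /sec_add (uc_shift tt tm). Qed.

Lemma afib_inh m : inhabited (afib A m).
Proof.
have [t tt tm] := adapted_cover hM hA m.
by have [a _] := t_point tt tm 0 0.
Qed.

Section Mksec.
Variables (t : triv (afib A) (1 + k)) (tt : adapted t) (h : line_space A -> R).

(** A [section] is a total function on all subsets of the fibres. On lines over [tdom t] the
    [u]-coordinate is prescribed by [h]; on other lines any point of the line will do, and on
    subsets that are not lines any point of the fibre, which is nonempty. *)
Lemma mksec_ex m (S : set (afib A m)) : exists a : afib A m, is_line S ->
  zeta a = S /\ (tdom t m -> uc t a = h (existT _ m S)).
Proof.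
have [lS|nS] := pselect (is_line S); last by have [a] := afib_inh m; exists a.
have [tm|tm] := pselect (tdom t m); last by have [a ->] := lS; exists a.
have [a [ua ya]] := t_point tt tm (h (existT _ m S)) (line_triv t m S).
by exists a => _; split=> //; apply/(zeta_yc tt tm _ lS).
Qed.

Definition mksec : section A := fun m S => projT1 (cid (mksec_ex (m := m) S)).

Lemma mksec_section : is_section mksec.
Proof. by move=> m S lS; have [] := projT2 (cid (mksec_ex S)) lS. Qed.

Lemma us_mksec (q : line_space A) : is_line (tagged q) -> tdom t (tag q) ->
  us t mksec q = h q.
Proof. by case: q => m S /= lS tm; have [_] := projT2 (cid (mksec_ex S)) lS; apply. Qed.

End Mksec.

Section Frame.
Variables (c : chart R M (mdim M)) (t : triv (afib A) (1 + k)).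
Hypotheses (sc : matl c) (tt : adapted t).
Notation L := (line_chart c t).
Notation okL := (line_space_ok hM hA).

Lemma satlL : @satl R (line_space A) L.
Proof. by exists c, (line_triv t); split=> //; exists t. Qed.

Lemma cdomL m y : cdom c m -> tdom t m -> cdom L (Lp t m y).
Proof. by move=> cm tm; split => //=; exact: Ln_line. Qed.

Lemma LE m y : cdom c m -> tdom t m -> L (Lp t m y) = row_mx (c m) y.
Proof. by move=> cm tm; apply: (congr1 (row_mx (c m))); exact: line_trivE. Qed.

(** In the charts a section leaves [(x, y)] unchanged and adds the coordinate [u], so its smoothness
    is that of a single function. *)
Lemma section_atP (p : line_space A) sg : cdom L p ->
  section_at p sg <-> is_section sg /\ smooth_at (us t sg) p.
Proof.
move=> cp; have [lp [cm tm]] := cp.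
pose b := bchart (fun m => [set: afib A m]) c t.
have sb : @satl R (aspace A) b by exists c, t.
split=> -[sec H]; split=> //.
  apply: (smooth_map_comp_at okL (aspace_ok hM hA) (g := ucoord t) H).
  have cb : cdom (b : chart R (aspace A) (sdim (aspace A))) (sec_map sg p) by [].
  apply/(smooth_at_rep (aspace_ok hM hA) sb cb
    (phi := fun z => z 0 (rshift n (lshift k 0)))).
    by apply: near_ptT => q cq; rewrite /= row_mxEr.
  exact: smooth_near_coord.
apply: (smooth_map_rep okL satlL sb cp
   (phi := fun z => row_mx (lsubmx z) (row_mx (const_mx (crep L (us t sg) z)) (rsubmx z)))).
  apply: near_ptT => -[m S] cq; have [/= lS [cm' tm']] := cq; split=> //.
  rewrite (crepE (c := L) _ (ao_inj okL satlL) cq) /= row_mxKl row_mxKr.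
  by rewrite tsplit section_yc.
apply: smooth_row_mx; first exact/smooth_row_l/smooth_row_id.
apply: smooth_row_mx; last exact/smooth_row_r/smooth_row_id.
by apply: smooth_row_const; exact/(smooth_atE okL _ satlL cp).
Qed.

(** The normal form of a jet. Its class is stated through the [u]-coordinate in one chart, whereas
    [jet] refers to a reference section and to all charts; by [jet_J] every jet over the frame has
    this form. *)
Definition cjet m y (s : R) (x : 'rV[R]_n) (w : 'rV[R]_k) : cpt A :=
  (Lp t m y, [set sg | [/\ is_section sg, smooth_at (us t sg) (Lp t m y),
     us t sg (Lp t m y) = s & grad L (us t sg) (Lp t m y) = row_mx x w]]).

Section Pt.
Variables (m : M) (cm : cdom c m) (tm : tdom t m).

Lemma jetE y sg : section_at (Lp t m y) sg ->
  jet (Lp t m y) sg = cjet m y (us t sg (Lp t m y))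
    (lsubmx (grad L (us t sg) (Lp t m y))) (rsubmx (grad L (us t sg) (Lp t m y))).
Proof.
move=> Hs; set p := Lp t m y; have cp : cdom L p by exact: cdomL.
have [sec sm] := (section_atP sg cp).1 Hs.
rewrite /cjet hsubmxK; congr pair; apply/seteqP.
have lp : is_line (tagged p) by case: cp.
(* The order of the difference is reversed because sections are compared along [- v_A]. *)
have near sg' : is_section sg' ->
    near_pt (X := line_space A) L p (fun q => us t sg q - us t sg' q = sec_sub sg' sg q).
  move=> sec'; apply: near_ptT => -[m' S] [/= lS [cm' tm']].
  by rewrite (@sec_subE t) // /us /=.
have key sg' : is_section sg' -> smooth_at (us t sg') p ->
    dzero (sec_sub sg' sg) p <-> grad L (us t sg') p = grad L (us t sg) p.
  move=> sec' sm'; have N := near _ sec'.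
  have sd := smooth_atB okL satlL cp sm sm'.
  rewrite (dzeroP okL satlL cp (smooth_at_ext okL satlL cp N sd)).
  rewrite -(grad_ext okL satlL cp N) (gradB okL satlL cp) //.
  by split=> [/eqP|->]; [rewrite subr_eq0 => /eqP ->|rewrite subrr].
split=> sg' /=.
  move=> [/(section_atP sg' cp)[sec' sm'] E /(key _ sec' sm') ->]; split=> //.
  by rewrite /us (eq_from_Tagged E : sg' m (Ln t y) = sg m (Ln t y)).
move=> [sec' sm' E /(key _ sec' sm') D]; split=> //; first exact/(section_atP sg' cp).
congr existT; apply: (t_eq tt tm) => //.
by rewrite !section_yc.
Qed.

Lemma J_of_mem y s x w sg : (cjet m y s x w).2 sg -> jet (Lp t m y) sg = cjet m y s x w.
Proof.
move=> [sec sm E1 E2]; rewrite jetE ?E1 ?E2 ?row_mxKl ?row_mxKr //.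
by apply/section_atP => //; exact: cdomL.
Qed.

Lemma J_mem y s x w sg : (cjet m y s x w).2 sg -> section_at (Lp t m y) sg.
Proof. by move=> [sec sm _ _]; apply/section_atP => //; exact: cdomL. Qed.

Lemma J_build y s x w sg : is_section sg ->
  (exists2 h : line_space A -> R, near_pt (X := line_space A) L (Lp t m y) (fun q => us t sg q = h q) &
    [/\ smooth_at h (Lp t m y), h (Lp t m y) = s & grad L h (Lp t m y) = row_mx x w]) ->
  (cjet m y s x w).2 sg.
Proof.
have cp := cdomL y cm tm; move=> sec [h N [sm E G]]; split=> //.
- apply: (smooth_at_ext okL satlL cp) sm; apply: near_ptW N _ => q _ ->; done.
- by rewrite -E; have := nbhs_singleton N; apply.
- by rewrite (grad_ext okL satlL cp N).
Qed.

(** A representative of [cjet m y s x w] whose [u]-coordinate is affine in the chart. It is then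
    affine on all nearby fibres, so the same section also serves where an [affine_section] is
    required. *)
Definition affsec y s x w := mksec tt (fun q => s + dotv (L q - L (Lp t m y)) (row_mx x w)).

Lemma affsecE y s x w (q : line_space A) : cdom L q ->
  us t (affsec y s x w) q = (s - dotv (L (Lp t m y)) (row_mx x w)) + dotv (L q) (row_mx x w).
Proof.
by move=> [lq [cq tq]]; rewrite us_mksec // dotvDl dotvNl; ring.
Qed.

Lemma affsec_smooth y s x w (q : line_space A) : cdom L q -> smooth_at (us t (affsec y s x w)) q.
Proof.
move=> cq; apply: (smooth_at_ext okL satlL cq).
  by apply: near_ptT => q' cq'; rewrite affsecE //.
apply: (smooth_atD okL satlL cq).
- exact: (smooth_at_cst okL satlL cq).
- exact: (smooth_at_dot okL satlL cq).
Qed.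

Lemma affsec_mem y s x w : (cjet m y s x w).2 (affsec y s x w).
Proof.
have cp := cdomL y cm tm; split.
- exact: mksec_section.
- exact: affsec_smooth.
- by rewrite affsecE // subrK.
- rewrite (grad_ext okL satlL cp (g := fun q => (s - dotv (L (Lp t m y)) (row_mx x w)) +
    dotv (L q) (row_mx x w))); last by apply: near_ptT => q' cq'; rewrite affsecE.
  rewrite (gradD okL satlL cp); [|exact: smooth_at_cst okL _ _ satlL cp _|exact: smooth_at_dot okL _ _ satlL cp _].
  by rewrite (grad_cst okL satlL cp) (grad_dot okL satlL cp) add0r.
Qed.

Lemma J_jet y s x w : is_jet (cjet m y s x w).
Proof.
split; first exact: Ln_line.
exists (affsec y s x w); split; first by apply: J_mem; exact: affsec_mem.
exact: (esym (J_of_mem (affsec_mem y s x w))).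
Qed.

Lemma jet_J (j : cpt A) : is_jet j -> tag j.1 = m -> exists y s x w, j = cjet m y s x w.
Proof.
case: j => [[m' S] P] [/= lS [sg [Hs E]]] Em; subst m'.
move: Hs E; rewrite (line_LnE tt tm lS) => Hs ->.
by rewrite jetE //; do 4 eexists.
Qed.

Lemma affsec_affine y s x w : affine_section m (affsec y s x w).
Proof.
split; first exact: mksec_section.
exists (cdom c `&` tdom t); split=> //.
  by apply: openI; [exact: matl_open|exact: (adapted_affine tt).1].
move=> m' [cm' tm']; split=> [S lS|l S S' lS lS'].
  have cS : cdom L (existT _ m' S : line_space A) by [].
  have : section_at (existT _ m' S : line_space A) (affsec y s x w).
    by apply/section_atP => //; split; [exact: mksec_section|exact: affsec_smooth].
  by case.
rewrite (line_LnE tt tm' lS) (line_LnE tt tm' lS') (tagged_line_comb hA tt tm').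
set y1 := line_triv t m' S; set y2 := line_triv t m' S'.
have sec := mksec_section tt (fun q => s + dotv (L q - L (Lp t m y)) (row_mx x w)).
have E y0 : uc t (affsec y s x w (Ln (m := m') t y0)) =
    s - dotv (L (Lp t m y)) (row_mx x w) + (dotv (c m') x + dotv y0 w).
  have cq := cdomL y0 cm' tm'.
  by rewrite -dotv_row_mx -(LE y0 cm' tm'); exact: (affsecE y s x w cq).
apply: (t_eq tt tm').
  by rewrite (uc_comb hA) // !E dotvDl !dotvZl; ring.
by rewrite (yc_comb hA) // !section_yc ?line_trivE //; exact: Ln_line.
Qed.

(** The fibre derivative [w] of an affine section is constant along the fibre. Its base derivative
    [X] depends affinely on the point of the fibre: the affine relation between values holds on all
    fibres near [m], so it can be differentiated along the base. *)
Lemma affine_section_jet sg : affine_section m sg -> exists s0 w (X : 'rV[R]_k -> 'rV[R]_n),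
  (forall y, cjet m y (s0 + dotv w y) (X y) w = jet (Lp t m y) sg /\
     us t sg (Lp t m y) = s0 + dotv w y) /\
  (forall l y y', X (l *: y + (1 - l) *: y') = l *: X y + (1 - l) *: X y').
Proof.
move=> [sec [U [oU Um HU]]].
have sat y : section_at (Lp t m y) sg.
  by split=> //; apply: (HU m Um).1; exact: Ln_line.
have smo y : smooth_at (us t sg) (Lp t m y).
  by have /(section_atP sg (cdomL y cm tm))[] := sat y.
have aff m' : U m' -> tdom t m' -> forall l y y', us t sg (Lp t m' (l *: y + (1 - l) *: y')) =
    l * us t sg (Lp t m' y) + (1 - l) * us t sg (Lp t m' y').
  move=> Um' tm' l y y'; rewrite /us /= -(tagged_line_comb hA tt tm').
  by rewrite (HU m' Um').2 ?(uc_comb hA) //; exact: Ln_line.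
have [w Hw] := affine_dotv (aff m Um tm).
pose X y := lsubmx (grad L (us t sg) (Lp t m y)).
have gE y : grad L (us t sg) (Lp t m y) = gradv (crep L (us t sg)) (row_mx (c m) y).
  by rewrite -LE.
have dif y : differentiable (crep L (us t sg)) (row_mx (c m) y).
  by rewrite -LE //; apply: (smooth_at_diff okL satlL (cdomL y cm tm)).
have crE m' y : cdom c m' -> tdom t m' ->
    crep L (us t sg) (row_mx (c m') y) = us t sg (Lp t m' y).
  move=> cm' tm'; rewrite -LE //.
  by apply: (crepE (c := L) _ (ao_inj okL satlL)); exact: cdomL.
exists (us t sg (Lp t m 0)), w, X; split=> [y|l y y'].
  rewrite -Hw jetE //; split=> //; congr cjet.
  have := @gradv_comp_aff _ _ _ (fun y => row_mx (c m) y) (fun v => row_mx 0 v)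
     (crep L (us t sg)) y _ _ (dif y).
  rewrite -gE => H; apply: dotv_ext => v; apply/esym; move: H.
  move=> /(_ _ _ v); rewrite -[grad _ _ _ in RHS]hsubmxK dotv_row_mx dotv0r add0r.
  move=> <-.
  - have -> : (fun z => crep L (us t sg) (row_mx (c m) z)) =
        (fun z => us t sg (Lp t m 0) + dotv z w).
      by apply/funext => z; rewrite crE // Hw dotvC.
    rewrite gradvD ?gradv_cst ?gradv_dot ?add0r //.
    exact: smooth_near_diff (smooth_near_dotl _ _).
  - by move=> r u v'; rewrite scale_row_mx add_row_mx scaler0 add0r.
  - by move=> z v'; rewrite add_row_mx addr0.
have XE y0 : X y0 = gradv (fun x => crep L (us t sg) (row_mx x y0)) (c m).
  have := @gradv_comp_aff _ _ _ (fun x => row_mx x y0) (fun v => row_mx v 0)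
     (crep L (us t sg)) (c m) _ _ (dif y0).
  rewrite -gE => H; apply: dotv_ext => v; apply/esym; move: H.
  move=> /(_ _ _ v) ->.
  - by rewrite -[grad _ _ _]hsubmxK dotv_row_mx dotv0r addr0.
  - by move=> r u v'; rewrite scale_row_mx add_row_mx scaler0 add0r.
  - by move=> z v'; rewrite add_row_mx addr0.
have dx y0 : differentiable (fun x => crep L (us t sg) (row_mx x y0)) (c m).
  apply: smooth_near_diff; apply: smooth_near_comp.
    by rewrite -LE //; apply/(smooth_atE okL _ satlL); [exact: cdomL|exact: smo].
  by apply: smooth_row_mx; [exact: smooth_row_id|exact: smooth_row_cst].
rewrite !XE -!gradvZ // -gradvD //; try by apply: differentiableZ.
apply: gradv_ext.
have oV : open (U `&` tdom t) by apply: openI => //; exact: (adapted_affine tt).1.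
have := near_base hM sc cm oV (conj Um tm).
by apply: filterS => _ [m' [cm' [Um' tm'] <-]]; rewrite !crE // aff.
Qed.

Lemma jet_chartJ y s x w :
  jet_chart c t (cjet m y s x w) = row_mx (row_mx (c m) y) (row_mx (const_mx s) (row_mx x w)).
Proof.
rewrite -(LE y cm tm); apply: (congr1 (row_mx (L (Lp t m y)))).
apply: get_eq; last by move=> z [sg [_ _ E1 E2] <-]; rewrite -E1 -E2.
exists (affsec y s x w); first exact: affsec_mem.
by have [_ _ E1 E2] := affsec_mem y s x w; congr (row_mx (const_mx _) _).
Qed.

Lemma J_inj y s x w y' s' x' w' : cjet m y s x w = cjet m y' s' x' w' ->
  [/\ y = y', s = s', x = x' & w = w'].
Proof.
move=> /(congr1 (jet_chart c t)); rewrite !jet_chartJ.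
move=> /eq_row_mx[/eq_row_mx[_ ->] /eq_row_mx[/matrixP /(_ 0 0) + /eq_row_mx[-> ->]]].
by rewrite !mxE.
Qed.

(** The minus signs reflect the convention that the distinguished section of [zeta] is [- v_A]:
    adding a function to a section lowers the [u]-coordinate by it. *)
Lemma jet_addJ y s x w x' w' r :
  jet_add (cjet m y s x w) (covec (X := line_space A) L (Lp t m y) (row_mx x' w')) r =
  cjet m y (s - r) (x - x') (w - w').
Proof.
have cp := cdomL y cm tm; set p := Lp t m y in cp *.
have key sg h : (cjet m y s x w).2 sg -> (covec (X := line_space A) L p (row_mx x' w')).2 h ->
    (cjet m y (s - r) (x - x') (w - w')).2 (sec_add sg (fun q => h q - h p + r)).
  move=> [sec sm E1 E2] [hs hg]; apply: J_build; first exact: sec_add_section.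
  exists (fun q => us t sg q - (h q - h p + r)).
    by apply: near_ptT => q [_ [_ tq]]; rewrite us_sec_add.
  have s1 := smooth_at_cst okL satlL cp (- h p + r).
  have s2 := smooth_atD okL satlL cp hs s1.
  have E : (fun q => h q - h p + r) = (fun q => h q + (- h p + r)).
    by apply/funext => q; rewrite addrA.
  split.
  - by apply: (smooth_atB okL satlL cp) => //; rewrite E.
  - by rewrite -/p E1 subrr add0r.
  - rewrite (gradB okL satlL cp) ?E // (gradD okL satlL cp) // (grad_cst okL satlL cp).
    by rewrite addr0 E2 hg opp_row_mx add_row_mx.
have h0 : (covec (X := line_space A) L p (row_mx x' w')).2 (fun q => dotv (L q) (row_mx x' w')).
  by split; [exact: smooth_at_dot okL _ _ satlL cp _|exact: (grad_dot okL satlL cp)].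
rewrite /jet_add; congr pair; apply/seteqP; split=> sg'.
  by move=> [sg [h [H1 H2]]]; rewrite (J_of_mem (key _ _ H1 H2)).
move=> H; exists (affsec y s x w), (fun q => dotv (L q) (row_mx x' w')); split=> //.
  exact: affsec_mem.
by rewrite (J_of_mem (key _ _ (affsec_mem _ _ _ _) h0)).
Qed.

Lemma jet_shiftJ y s x w r : jet_shift r (cjet m y s x w) = cjet m y (s - r) x w.
Proof.
have cp := cdomL y cm tm.
rewrite /jet_shift (dcovE okL satlL cp); last exact: smooth_at_cst okL _ _ satlL cp _.
rewrite (grad_cst okL satlL cp) -[0]row_mx0.
by have := jet_addJ y s x w 0 0 r; rewrite !subr0.
Qed.

Lemma jet_add_baseJ y s x w (g : M -> R) r : smooth_at (X := mspace M) g m ->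
  jet_add_base (cjet m y s x w) g r = cjet m y (s - r) (x - @grad R M n c g m) w.
Proof.
move=> gs; have cp := cdomL y cm tm.
have Ms : @satl R (mspace M) c by [].
have N : near_pt (X := line_space A) L (Lp t m y) (fun q => g (tag q) = crep c g (lsubmx (L q))).
  apply: near_ptT => -[m' S] [_ [/= cm' tm']]; rewrite row_mxKl.
  by rewrite (crepE (c := c) _ (matl_inj hM sc)).
have gd : differentiable (crep c g) (c m) := smooth_at_diff (mspace_ok hM) Ms cm gs.
have sm : smooth_at (X := line_space A) (fun q => g (tag q)) (Lp t m y).
  apply/(smooth_at_rep okL satlL cp (phi := fun z => crep c g (lsubmx z)) N).
  apply: (smooth_near_comp (f := crep c g) (g := fun z => lsubmx z)); last exact/smooth_row_l/smooth_row_id.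
  by rewrite LE // row_mxKl; exact/(smooth_atE (mspace_ok hM) _ Ms cm).
rewrite /jet_add_base (dcovE okL satlL cp) //.
have -> : grad L (fun q : line_space A => g (tag q)) (Lp t m y) = row_mx (@grad R M n c g m) 0.
  transitivity (gradv (fun z => crep c g (lsubmx z)) (L (Lp t m y))).
    exact: (grad_rep okL satlL cp N).
  apply: dotv_ext => v.
  rewrite (@gradv_comp_aff _ _ _ _ lsubmx) ?LE ?row_mxKl //.
  - by rewrite -{2}[v]hsubmxK dotv_row_mx dotv0l addr0.
  - by move=> r' u v'; rewrite linearD linearZ.
  - by move=> u v'; rewrite linearD.
by have := jet_addJ y s x w (@grad R M n c g m) 0 r; rewrite subr0.
Qed.

(** The sign convention enters twice and cancels: with [h = u2 - u1] the combined section has the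
    coordinate [u2 - l * h]. *)
Lemma contact_comb1J l y s1 x1 w1 s2 x2 w2 :
  contact_comb1 l (cjet m y s1 x1 w1) (cjet m y s2 x2 w2) =
  cjet m y (l * s1 + (1 - l) * s2) (l *: x1 + (1 - l) *: x2) (l *: w1 + (1 - l) *: w2).
Proof.
have cp := cdomL y cm tm; set p := Lp t m y in cp *; set j := cjet m y (l * s1 + _) _ _.
have key sg1 sg2 : (cjet m y s1 x1 w1).2 sg1 -> (cjet m y s2 x2 w2).2 sg2 ->
    j.2 (sec_add sg2 (fun q => l * sec_sub sg1 sg2 q)).
  move=> [sec1 sm1 E1 G1] [sec2 sm2 E2 G2]; apply: J_build; first exact: sec_add_section.
  exists (fun q => l * us t sg1 q + (1 - l) * us t sg2 q).
    apply: near_ptT => -[m' S] [/= lS [_ tq]]; rewrite us_sec_add //.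
    by rewrite (@sec_subE t) // /us /=; ring.
  have sl := smooth_atZ okL satlL cp l sm1; have sl' := smooth_atZ okL satlL cp (1 - l) sm2.
  split; first exact: (smooth_atD okL satlL cp).
    by rewrite -/p E1 E2.
  rewrite (gradD okL satlL cp) // !(gradZ okL satlL cp) // G1 G2.
  by rewrite !scale_row_mx add_row_mx.
rewrite /contact_comb1; congr pair; apply/seteqP; split=> sg'.
  by move=> [sg1 [sg2 [H1 H2]]]; rewrite (J_of_mem (key _ _ H1 H2)).
move=> H; exists (affsec y s1 x1 w1), (affsec y s2 x2 w2); split; try exact: affsec_mem.
by rewrite (J_of_mem (key _ _ (affsec_mem _ _ _ _) (affsec_mem _ _ _ _))).
Qed.

(** For an affine representative, [fsec] is [u] minus an affine function of [y] with slope [w].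
    Modulo constants only the slope [- w] remains. *)
Lemma contact_proj2J y s x w :
  contact_proj2 (cjet m y s x w) = existT _ m [set g | yc (A := sharp A) (sharp_triv t) g = - w].
Proof.
congr existT; apply/seteqP; split=> g /=.
  move=> [sg [s' [aff mem Hg]]].
  have [s0 [w0 [X [H _]]]] := affine_section_jet aff.
  have [_ _ _ Ew] : [/\ y = y, s0 + dotv w0 y = s, X y = x & w0 = w].
    by apply: J_inj; rewrite (H y).1 (J_of_mem mem).
  have sec := aff.1; subst w0.
  have E : sharp_triv t m (g : afib (sharp A) m) = row_mx (const_mx (s' - s0)) (- w).
    apply: (sharp_triv_eq hA tt tm) => a; rewrite Hg (@fsecE t) // /sev row_mxEl mxE row_mxKr.
    have := (H (yc t a)).2; rewrite /us /Lp -(zetaE tt tm) /= => ->.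
    by rewrite dotvNl -/(uc t a) -/(yc t a); ring.
  change (rsubmx (sharp_triv t m (g : afib (sharp A) m)) = - w).
  by rewrite E row_mxKr.
move=> Eg; exists (affsec y s x w); set sg := affsec y s x w.
have [_ _ E1 _] := affsec_mem y s x w.
(* Both functions equal [u] minus the pairing of [w] with the variable point, up to constants: the
   first coordinate of [g] on one side and [- (s - dotv y w)] for [fsec] on the other. The witness
   is the difference of these constants. *)
exists (sharp_triv t m g 0 (lshift _ 0) + s - dotv y w); split.
- exact: affsec_affine.
- exact: affsec_mem.
- move=> a; rewrite (sharp_trivP hA tt tm) /sev.
  have -> : rsubmx (sharp_triv t m g) = - w by exact: Eg.
  have sec : is_section sg by exact: mksec_section.
  rewrite (@fsecE t) //.
  have -> : uc t (sg m (zeta a)) = s - dotv y w + dotv w (yc t a).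
    have := affsecE y s x w (cdomL (yc t a) cm tm).
    rewrite /us /Lp -(zetaE tt tm) => ->.
    rewrite (zetaE tt tm) -!/(Lp t m _) !LE // !dotv_row_mx (dotvC w); ring.
  by rewrite dotvNl -/(uc t a) -/(yc t a); ring.
Qed.

(** Independence of the reference section is the point: its value and its base derivative are both
    affine along the fibre by [affine_section_jet], so they drop out of the combination. *)
Lemma contact_comb2J l y1 y2 s1 x1 s2 x2 w :
  contact_comb2 l (cjet m y1 s1 x1 w) (cjet m y2 s2 x2 w) =
  cjet m (l *: y1 + (1 - l) *: y2) (l * s1 + (1 - l) * s2) (l *: x1 + (1 - l) *: x2) w.
Proof.
have Ms : @satl R (mspace M) c by [].
have okM := mspace_ok hM.
apply: the_eq.
  (* The reference section has [u]-coordinate [dotv y w] in the frame. Adding [(d g, r)] subtracts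
     from the coordinates, whence a [g] with gradient [- x] and [r = dotv y w - s]. *)
  pose sg0 := affsec 0 0 0 w; pose g (x : 'rV[R]_n) m' := dotv (c m') (- x).
  have J0 y : jet (Lp t m y) sg0 = cjet m y (dotv y w) 0 w.
    apply: J_of_mem; have H := affsec_mem y (dotv y w) 0 w.
    apply: J_build; first exact: mksec_section.
    exists (us t (affsec y (dotv y w) 0 w)); last by case: H.
    apply: near_ptT => q cq; rewrite !affsecE // !LE // !dotv_row_mx !dotv0r dotv0l; ring.
  have gs x : smooth_at (X := mspace M) (g x) m by exact: (smooth_at_dot okM Ms cm).
  have gg x : @grad R M n c (g x) m = - x by exact: (grad_dot okM Ms cm).
  exists sg0, (g x1), (g x2), (dotv y1 w - s1), (dotv y2 w - s2); split.
  - exact: affsec_affine.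
  - have [z Hz] : exists z : afib (sharp A) m,
        sharp_triv t m z = row_mx (const_mx 0) (- w).
      exact: (@triv_surj _ _ (sharp A) _ (sharp_affine hA tt) m _ tm).
    have P : tagged (contact_proj2 (cjet m y1 s1 x1 w)) =
      [set g : afib (sharp A) m | yc (A := sharp A) (sharp_triv t) g = - w]
      := eq_from_Tagged (contact_proj2J y1 s1 x1 w).
    exists z; split.
      have : yc (A := sharp A) (sharp_triv t) z = - w by rewrite /yc Hz row_mxKr.
      by rewrite P.
    move=> a /=; rewrite (sharp_trivP hA tt tm) Hz /sev row_mxEl mxE add0r row_mxKr.
    rewrite (@fsecE t) //; last exact: mksec_section.
    have -> : uc t (sg0 m (zeta a)) = dotv (yc t a) w.
      have := affsecE 0 0 0 w (cdomL (yc t a) cm tm).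
      rewrite /us /Lp -(zetaE tt tm) => ->.
      rewrite (zetaE tt tm) -!/(Lp t m _) !LE // !dotv_row_mx !dotv0r dotv0l; ring.
    by rewrite dotvNl (dotvC w) -/(uc t a) -/(yc t a).
  - by split.
  - rewrite !J0 !jet_add_baseJ // !gg; split; congr cjet; rewrite ?sub0r ?opprK //; ring.
  - rewrite [(cjet m y1 _ _ _).1]/= [(cjet m y2 _ _ _).1]/= line_comb_Ln //.
    rewrite -/(Lp t m _) J0 jet_add_baseJ //; last first.
      by apply: (smooth_atD okM Ms cm); apply: (smooth_atZ okM Ms cm).
    have -> : @grad R M n c (fun m => l * g x1 m + (1 - l) * g x2 m) m =
        l *: - x1 + (1 - l) *: - x2.
      rewrite (gradD okM Ms cm) ?(gradZ okM Ms cm) ?gg //; exact: (smooth_atZ okM Ms cm).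
    congr cjet; first by rewrite dotvDl !dotvZl; ring.
    by rewrite sub0r !scalerN -opprD opprK.
(* For an arbitrary admissible reference section, comparing coordinates expresses the given values
   and base derivatives through those of the section and the corrections. *)
move=> j [sg0 [g1 [g2 [r1 [r2 [aff _ [gs1 gs2] [E1 E2] ->]]]]]].
have [s0 [w0 [X [H HX]]]] := affine_section_jet aff.
move: E1 E2; rewrite [(cjet m y1 _ _ _).1]/= [(cjet m y2 _ _ _).1]/=.
rewrite -!/(Lp t m _) -!(H _).1 !jet_add_baseJ // => /J_inj[_ -> -> ->] /J_inj[_ -> -> _].
rewrite line_comb_Ln // -/(Lp t m _) -(H _).1 jet_add_baseJ //; last first.
  by apply: (smooth_atD okM Ms cm); apply: (smooth_atZ okM Ms cm).
congr cjet; first by rewrite dotvDr !dotvZr; ring.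
rewrite HX (gradD okM Ms cm) ?(gradZ okM Ms cm) //; try exact: (smooth_atZ okM Ms cm).
by rewrite !scalerBr opprD !addrA; congr (_ - _); rewrite addrAC.
Qed.

End Pt.
End Frame.
End Jets.

(** * Dual bundles and vector hulls *)

Section DualApp.
Variables (R : realType) (V : lmodType R).

Lemma linear_form_dapp (f : dual V) : linear_form (dapp f).
Proof. by case: f => f Hf; have /asboolP := Hf. Qed.

Lemma dapp0 (f : dual V) : dapp f 0 = 0.
Proof.
by have := linear_form_dapp f (-1) 0 0; rewrite scaler0 addr0 mulN1r addNr.
Qed.

Lemma dapp_eq (f g : dual V) : (forall e, dapp f e = dapp g e) -> f = g.
Proof. by move=> E; apply: val_inj; apply/funext. Qed.

End DualApp.

Section Hulls.
Variables (R : realType) (T : Type) (cb : R -> T -> T -> T).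
Notation H := (hull cb).
Notation x_ := (hgen cb).

Definition fsum_eval (f : T -> R) (s : fsum R T) : R := \sum_(p <- s) p.1 * f p.2.

Lemma fsum_eval_cat f s t : fsum_eval f (s ++ t) = fsum_eval f s + fsum_eval f t.
Proof. exact: big_cat. Qed.

Lemma fsum_eval_scale f c s : fsum_eval f (fscale c s) = c * fsum_eval f s.
Proof.
by rewrite /fsum_eval big_map mulr_sumr; apply: eq_bigr => p _; rewrite mulrA.
Qed.

Lemma fsum_eval_rel f s t : (forall l a b, f (cb l a b) = l * f a + (1 - l) * f b) ->
  hull_rel cb s t -> fsum_eval f s = fsum_eval f t.
Proof.
move=> Hf; elim=> {s t} //.
- by move=> s t r _ -> _ ->.
- by move=> s t st; exact: perm_big.
- by move=> s s' t t' _ E _ E'; rewrite !fsum_eval_cat E E'.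
- by move=> c s t _ E; rewrite !fsum_eval_scale E.
- by move=> a; rewrite /fsum_eval big_cons !big_nil mul0r addr0.
- by move=> l l' a; rewrite /fsum_eval !big_cons !big_nil !addr0 mulrDl.
- by move=> l a b; rewrite /fsum_eval !big_cons !big_nil !addr0 Hf mul1r.
Qed.

Lemma hull_pi_sum s : \pi_(H)%qT s = \sum_(p <- s) p.1 *: x_ p.2.
Proof.
elim: s => [|[l a] s IH]; first by rewrite big_nil.
rewrite big_cons -IH -cat1s.
transitivity (hadd (\pi_(H)%qT [:: (l, a)]) (\pi_(H)%qT s)); first by rewrite hadd_pi.
by congr (hadd _ _); rewrite [RHS]hscale_pi /fscale /= mulr1.
Qed.

Lemma hull_span (P : H -> Prop) : P 0 -> (forall r a e, P e -> P (r *: x_ a + e)) ->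
  forall e, P e.
Proof.
move=> P0 PD; elim/hull_ind => s; rewrite hull_pi_sum.
by elim/big_rec: _ => [|p e _]; [exact: P0|exact: PD].
Qed.

Lemma dual_hull_eq (f g : dual H) : (forall a, dapp f (x_ a) = dapp g (x_ a)) -> f = g.
Proof.
move=> E; apply: dapp_eq; apply: hull_span; first by rewrite !dapp0.
by move=> r a e IH; rewrite !linear_form_dapp E IH.
Qed.

(** The universal property of the hull: evaluating formal sums with [f] respects every relation of
    [hull_rel], the last one because [f] preserves combinations. *)
Lemma dual_hull_ex (f : T -> R) : (forall l a b, f (cb l a b) = l * f a + (1 - l) * f b) ->
  exists g : dual H, forall a, dapp g (x_ a) = f a.
Proof.
move=> Hf; pose g (e : H) : R^o := fsum_eval f (repr e).
have gpi s : g (\pi_(H)%qT s) = fsum_eval f s.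
  by apply: fsum_eval_rel => //; exact: hull_reprP.
have lg : linear_form g.
  move=> r; elim/hull_ind => s; elim/hull_ind => t.
  transitivity (g (hadd (hscale r (\pi_(H)%qT s)) (\pi_(H)%qT t))) => //.
  by rewrite hscale_pi hadd_pi !gpi fsum_eval_cat fsum_eval_scale.
exists (Sublmod (introT (asboolP _) lg)) => a.
by rewrite /dapp /= gpi /fsum_eval big_cons big_nil addr0 mul1r.
Qed.

End Hulls.

Section VectorBundles.
Variables (R : realType) (M : manifold R) (hM : is_manifold M).
Notation n := (mdim M).

Record vb_ok (V : vbundle M) : Prop := VbOk {
  vb_bundle : bundle_ok (fun m => [set: V m]) (@vtrivs _ _ V);
  vb_linear : forall t m (r : R) x y, @vtrivs _ _ V t -> tdom t m ->
    t m (r *: x + y) = r *: t m x + t m y }.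

Section Triv.
Variables (V : vbundle M) (Vok : vb_ok V) (t : triv (fun m => V m) (vrk V)).
Variables (vt : vtrivs t) (m : M) (tm : tdom t m).

Lemma vt_inj : injective (t m).
Proof.
by move=> x y E; apply: ((bo_triv (vb_bundle Vok) vt).2 m tm).1; rewrite ?inE.
Qed.

Lemma vt_surj z : exists e, t m e = z.
Proof. by have [e _ <-] := ((bo_triv (vb_bundle Vok) vt).2 m tm).2 z; exists e. Qed.

Lemma vt0 : t m 0 = 0.
Proof.
by have := vb_linear Vok (-1) 0 0 vt tm; rewrite scaler0 addr0 scaleN1r addNr.
Qed.

Lemma vtZ r x : t m (r *: x) = r *: t m x.
Proof. by rewrite -[r *: x]addr0 (vb_linear Vok) // vt0 addr0. Qed.

Lemma vtD x y : t m (x + y) = t m x + t m y.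
Proof. by rewrite -{1}[x]scale1r (vb_linear Vok) // scale1r. Qed.

Lemma dual_triv_uniq (xi xi' : 'rV[R]_(vrk V)) :
  (forall e, dotv xi (t m e) = dotv xi' (t m e)) -> xi = xi'.
Proof. by move=> E; apply: dotv_ext => v; have [e <-] := vt_surj v. Qed.

(** The components of [f] are its values on the vectors with coordinates [delta_mx 0 i]; this shows
    that the choice in [dual_triv] is not empty. *)
Lemma dual_trivP (f : dual (V m)) e : dapp f e = dotv (dual_triv t m f) (t m e).
Proof.
suff [xi Hxi] : exists xi, forall e, dapp f e = dotv xi (t m e).
  rewrite (_ : dual_triv t m f = xi) //; apply: get_eq => // y Hy.
  by apply: dual_triv_uniq => e'; rewrite -Hxi; exact/esym/Hy.
pose g v := projT1 (cid (vt_surj v)); have gK v : t m (g v) = v := projT2 (cid (vt_surj v)).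
have gsum (v : 'rV[R]_(vrk V)) : t m (\sum_i v 0 i *: g (delta_mx 0 i)) = v.
  rewrite [RHS](row_sum_delta v).
  by elim/big_rec2: _ => [|i y1 y2 _ <-]; rewrite ?vt0 // (vb_linear Vok) // gK.
exists (\row_i dapp f (g (delta_mx 0 i))) => e'.
rewrite (_ : e' = \sum_i t m e' 0 i *: g (delta_mx 0 i)); last by apply: vt_inj; rewrite gsum.
rewrite gsum; set v := t m e'.
rewrite /dotv; elim/big_rec2: _ => [|i y1 y2 _ <-]; first exact: dapp0.
by rewrite linear_form_dapp mxE mulrC.
Qed.

Lemma dual_triv_eq (f : dual (V m)) xi :
  (forall e, dapp f e = dotv xi (t m e)) -> dual_triv t m f = xi.
Proof. by move=> E; apply: dual_triv_uniq => e; rewrite -dual_trivP. Qed.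

Lemma dual_triv_surj xi : exists f : dual (V m), dual_triv t m f = xi.
Proof.
have lf : linear_form (fun e : V m => dotv xi (t m e) : R^o).
  by move=> r x y; rewrite (vb_linear Vok) // dotvDr dotvZr.
by exists (Sublmod (introT (asboolP _) lf)); apply: dual_triv_eq.
Qed.

End Triv.

Lemma dual_vb_ok (V : vbundle M) : vb_ok V -> vb_ok (dual_bundle V).
Proof.
move=> Vok.
have ok t : vtrivs t -> triv_ok (fun m => [set: dual (V m)]) (dual_triv (V := V) t).
  move=> vt; split=> [|m tm]; first exact: (bo_triv (vb_bundle Vok) vt).1.
  split=> [f g _ _ E|xi]; last by have [f <-] := dual_triv_surj Vok vt tm xi; exists f.
  by apply: dapp_eq => e; rewrite !(dual_trivP Vok vt tm) E.
split; last first.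
  move=> _ m r f g [t vt <-] tm; apply: (dual_triv_eq Vok vt tm) => e.
  change (r * dapp f e + dapp g e = dotv (r *: dual_triv t m f + dual_triv t m g) (t m e)).
  by rewrite !(dual_trivP Vok vt tm) dotvDl dotvZl.
split=> [_ [t vt <-]|m|c _ _ m y sc [t vt <-] [t' vt' <-] cm tm tm']; first exact: ok.
  by have [t vt tm] := bo_cover (vb_bundle Vok) m; exists (dual_triv t) => //; exists t.
(* The transition of the dual is the inverse transpose: the i-th new component of a form is its
   value on the vector with [t']-coordinates [delta_mx 0 i], found in [t] by the opposite
   transition. *)
pose S (z : 'rV[R]_(n + vrk V)) i :=
  tc (fun m => [set: V m]) c t' t (row_mx (lsubmx z) (delta_mx 0 i)).
apply: (tc_intro hM (U := setT) (phi := fun z => \row_i dotv (rsubmx z) (S z i))) => //.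
- exact: ok.
- exact: (bo_triv (vb_bundle Vok) vt').1.
- exact: openT.
- move=> m' f _ cm' tm1 tm1' _; apply/rowP => i.
  rewrite mxE row_mxKr -dotv_delta /S row_mxKl.
  have [e Ee] := vt_surj Vok vt' tm1' (delta_mx 0 i).
  rewrite -Ee tcE //; last exact: bo_triv (vb_bundle Vok) _ vt'.
  by rewrite -(dual_trivP Vok vt' tm1') -(dual_trivP Vok vt tm1).
- move=> i; under eq_fun do rewrite mxE.
  apply: smooth_near_dot; first exact/smooth_row_r/smooth_row_id.
  apply: (@smooth_row_comp _ _ _ _ _ (fun z => row_mx (lsubmx z) (delta_mx 0 i))).
    by rewrite row_mxKl; apply: (bo_smooth (vb_bundle Vok)).
  by apply: smooth_row_mx; [exact/smooth_row_l/smooth_row_id|exact: smooth_row_cst].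
Qed.

Section HullBundleOk.
Variables (A : sabundle M) (hA : is_sabundle A).
Notation k := (ark A).
Notation x_ := (fun m => hgen (@acomb _ _ A m)).
Notation E := (hull_bundle A).

Lemma linextE m (f : afib A m -> R) : affine_fun f ->
  forall a, dapp (linext f) (x_ m a) = f a.
Proof.
move=> Hf; have [g Hg] := dual_hull_ex Hf.
rewrite (_ : linext f = g) //; apply: the_eq => // h Hh.
by apply: dual_hull_eq => a; rewrite Hg Hh.
Qed.

Lemma affine_cst m (r : R) : affine_fun (fun _ : afib A m => r).
Proof. by move=> l a b; ring. Qed.

Section Adapted.
Variables (t : triv (afib A) (1 + k)) (tt : adapted t) (m : M) (tm : tdom t m).

Lemma affine_coord i : affine_fun (fun a : afib A m => t m a 0 i).
Proof. by move=> l a b; rewrite (triv_acomb hA (adapted_affine tt)) // !mxE. Qed.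

Lemma hull_triv_gen a : hull_triv t m (x_ m a) = row_mx (const_mx 1) (t m a).
Proof.
rewrite /= linextE; last exact: affine_cst; congr row_mx.
by apply/rowP => i; rewrite mxE linextE //; exact: affine_coord.
Qed.

Lemma hull_triv_linear r (x y : E m) :
  hull_triv t m (r *: x + y) = r *: hull_triv t m x + hull_triv t m y.
Proof.
rewrite /= scale_row_mx add_row_mx; congr row_mx; apply/rowP => i;
  by rewrite !mxE linear_form_dapp.
Qed.

Lemma hull_triv0 : hull_triv t m 0 = 0.
Proof.
by have := hull_triv_linear (-1) 0 0; rewrite scaler0 addr0 scaleN1r addNr.
Qed.

Lemma hull_trivB x y : hull_triv t m (x - y) = hull_triv t m x - hull_triv t m y.
Proof. by rewrite addrC -scaleN1r hull_triv_linear scaleN1r addrC. Qed.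

(* The points with coordinates [0] and [delta_mx 0 i] form an affine basis of
   the fibre, hence a linear basis of its hull. *)
Lemma hull_basis : exists (a0 : afib A m) (a_ : 'I_(1 + k) -> afib A m),
  [/\ t m a0 = 0, forall i, t m (a_ i) = delta_mx 0 i &
   forall e, e = lsubmx (hull_triv t m e) 0 0 *: x_ m a0 +
     \sum_i rsubmx (hull_triv t m e) 0 i *: (x_ m (a_ i) - x_ m a0)].
Proof.
have sur z := triv_surj (adapted_affine tt) z tm.
pose g z := projT1 (cid (sur z)); have gK z : t m (g z) = z := projT2 (cid (sur z)).
have Kg a : g (t m a) = a by apply: (triv_inj (adapted_affine tt) tm); rewrite gK.
exists (g 0), (fun i => g (delta_mx 0 i)); split=> // e.
have aff l z z' : x_ m (g (l *: z + (1 - l) *: z')) = l *: x_ m (g z) + (1 - l) *: x_ m (g z').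
  have -> : g (l *: z + (1 - l) *: z') = acomb l (g z) (g z').
    apply: (triv_inj (adapted_affine tt) tm).
    by rewrite (triv_acomb hA (adapted_affine tt)) // !gK.
  have := hull_piP (hull_comb (@acomb _ _ A m) l (g z) (g z')).
  by rewrite hull_pi_sum big_seq1 scale1r hull_pi_sum big_cons big_seq1.
have H := affine_rowE aff.
move: e; apply: hull_span => [|r a e IH].
  by rewrite hull_triv0 !linear0 mxE scale0r big1 ?addr0 // => i _; rewrite mxE scale0r.
rewrite hull_triv_linear hull_triv_gen {1}IH -{1}(Kg a) H.
set z := hull_triv t m e.
set v := r *: row_mx (const_mx 1) (t m a) + z.
have -> : lsubmx v 0 0 = r + lsubmx z 0 0.
  by rewrite /v linearD linearZ /= row_mxKl !mxE mulr1.
have -> : rsubmx v = r *: t m a + rsubmx z by rewrite /v linearD linearZ /= row_mxKr.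
rewrite scalerDl scalerDr.
rewrite -!addrA; congr (_ + _); rewrite addrCA; congr (_ + _).
rewrite scaler_sumr -big_split; apply: eq_bigr => i _ /=.
by rewrite [(_ + _ : 'rV_(1 + k)) 0 i]mxE [(r *: _ : 'rV_(1 + k)) 0 i]mxE scalerDl scalerA.
Qed.

Lemma hull_triv_ok_at : set_inj [set: E m] (hull_triv t m) /\
  forall z, exists2 e, [set: E m] e & hull_triv t m e = z.
Proof.
have [a0 [a_ [E0 Ei H]]] := hull_basis; split=> [x y _ _ Exy|z].
  by rewrite (H x) (H y) Exy.
exists (lsubmx z 0 0 *: x_ m a0 + \sum_i rsubmx z 0 i *: (x_ m (a_ i) - x_ m a0)) => //.
have -> (e' : E m) : hull_triv t m (lsubmx z 0 0 *: x_ m a0 + e') =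
   row_mx (lsubmx z) 0 + hull_triv t m e'.
  rewrite hull_triv_linear hull_triv_gen E0 scale_row_mx scaler0; congr (row_mx _ _ + _).
  by apply/rowP => i; rewrite !mxE ord1 mulr1.
have -> : hull_triv t m (\sum_i rsubmx z 0 i *: (x_ m (a_ i) - x_ m a0)) =
    row_mx 0 (\sum_i rsubmx z 0 i *: delta_mx 0 i).
  elim/big_rec2: _ => [|i y1 y2 _ IH]; first by rewrite hull_triv0 row_mx0.
  rewrite hull_triv_linear IH hull_trivB !hull_triv_gen E0 Ei.
  by rewrite opp_row_mx add_row_mx subrr subr0 scale_row_mx scaler0 add_row_mx add0r.
by rewrite add_row_mx addr0 add0r -row_sum_delta hsubmxK.
Qed.

(** The difference of the generators at [a + v_A] and at [a] has coordinates that do not depend on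
    [a]; injectivity of the coordinates makes the choice in [evec] unambiguous. *)
Lemma evec_hull : hull_triv t m (evec (hull_embedding A) m) =
  row_mx 0 (row_mx (const_mx 1) 0).
Proof.
have key (a : afib A m) : hull_triv t m (x_ m (aadd a (adist A m)) - x_ m a) =
    row_mx 0 (row_mx (const_mx 1) 0).
  rewrite hull_trivB !hull_triv_gen opp_row_mx add_row_mx subrr; congr row_mx.
  by rewrite (triv_aadd (adapted_affine tt)) // tlin_dist // addrAC subrr add0r.
have [a _] := triv_surj (adapted_affine tt) 0 tm.
rewrite -(key a); congr (hull_triv t m _); apply: the_eq; first by exists a.
by move=> _ [b ->]; apply: hull_triv_ok_at.1; rewrite ?inE // !key.
Qed.

(** An affine function and its linear extension have the same coefficients; the constant term
    becomes the coefficient of the coordinate alpha, which is [1] on points of A. *)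
Lemma dual_triv_linext (f : afib A m -> R) (z : 'rV[R]_(1 + (1 + k))) :
  affine_fun f -> (forall a, f a = z 0 (lshift _ 0) + dotv (rsubmx z) (t m a)) ->
  dual_triv (V := E) (hull_triv t) m (linext f) = z.
Proof.
move=> Hf fE; apply: get_eq; last first.
  move=> y Hy; apply: dotv_ext => v; have [e _ <-] := hull_triv_ok_at.2 v.
  rewrite -[LHS]Hy; move: e; apply: hull_span => [|r a e IH].
    by rewrite dapp0 hull_triv0 dotv0r.
  rewrite linear_form_dapp IH hull_triv_linear dotvDr dotvZr.
  by congr (_ * _ + _); rewrite linextE // fE hull_triv_gen dotv_row1 mulr1.
move=> /=; apply: hull_span => [|r a e IH].
  by rewrite dapp0 -[RHS]/(dotv z (hull_triv t m 0)) hull_triv0 dotv0r.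
rewrite -[RHS]/(dotv z (hull_triv t m _)) linear_form_dapp IH hull_triv_linear dotvDr dotvZr.
by congr (_ * _ + _); rewrite linextE // fE hull_triv_gen dotv_row1 mulr1.
Qed.

End Adapted.

Lemma hull_vb_ok : vb_ok E.
Proof.
have ok t : adapted t -> triv_ok (fun m => [set: E m]) (hull_triv t).
  by move=> tt; split=> [|m tm]; [exact: (adapted_affine tt).1|exact: hull_triv_ok_at].
split; last by move=> _ m r x y [t tt <-] tm; exact: hull_triv_linear.
split=> [_ [t tt <-]|m|c _ _ m y sc [t tt <-] [t' tt' <-] cm tm tm']; first exact: ok.
  by have [t tt tm] := adapted_cover hM hA m; exists (hull_triv t) => //; exists t.
(* A linear map of hulls is determined by an affine basis of A: [S] follows the points with
   coordinates [0] and [delta_mx 0 i] through the smooth transition of A. *)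
pose S (z : 'rV[R]_(n + (1 + (1 + k)))) v :=
  tc (fun m => [set: afib A m]) c t t' (row_mx (lsubmx z) v).
pose Y (z : 'rV[R]_(n + (1 + (1 + k)))) := rsubmx z.
apply: (tc_intro hM (U := setT) (phi := fun z => row_mx (lsubmx (Y z))
   (lsubmx (Y z) 0 0 *: S z 0 +
    \sum_i rsubmx (Y z) 0 i *: (S z (delta_mx 0 i) - S z 0)))) => //.
- exact: ok.
- exact: (adapted_affine tt').1.
- exact: openT.
- move=> m' e _ cm' tm1 tm1' _; have [a0 [a_ [E0 Ei H]]] := hull_basis tt tm1.
  rewrite /Y row_mxKr /S row_mxKl.
  have ok1 := adapted_triv_ok tt.
  have T0 : tc (fun m => [set: afib A m]) c t t' (row_mx (c m') 0) = t' m' a0.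
    by rewrite -E0 tcE.
  have Ti i : tc (fun m => [set: afib A m]) c t t' (row_mx (c m') (delta_mx 0 i)) = t' m' (a_ i).
    by rewrite -Ei tcE.
  rewrite T0; under eq_bigr do rewrite Ti.
  rewrite {1}(H e) hull_triv_linear hull_triv_gen //.
  have -> : hull_triv t' m' (\sum_i rsubmx (hull_triv t m' e) 0 i *: (x_ m' (a_ i) - x_ m' a0)) =
    row_mx 0 (\sum_i rsubmx (hull_triv t m' e) 0 i *: (t' m' (a_ i) - t' m' a0)).
    elim/big_rec2: _ => [|i y1 y2 _ IH]; first by rewrite hull_triv0 row_mx0.
    rewrite hull_triv_linear IH hull_trivB !hull_triv_gen //.
    by rewrite opp_row_mx add_row_mx subrr scale_row_mx scaler0 add_row_mx add0r.
  rewrite scale_row_mx add_row_mx addr0; congr row_mx.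
  by apply/rowP => i; rewrite !mxE mulr1 ord1.
- have sl : smooth_row (row_mx (c m) y) (fun z => lsubmx z) by exact/smooth_row_l/smooth_row_id.
  have sY : smooth_row (row_mx (c m) y) Y by exact/smooth_row_r/smooth_row_id.
  have sS v : smooth_row (row_mx (c m) y) (S^~ v).
    apply: (@smooth_row_comp _ _ _ _ _ (fun z => row_mx (lsubmx z) v)).
      by rewrite row_mxKl; apply: (bo_smooth (adapted_ok hM hA)).
    by apply: smooth_row_mx => //; exact: smooth_row_cst.
  apply: smooth_row_mx; first exact: smooth_row_l.
  apply: smooth_rowD; first by apply: smooth_rowZ => //; exact: (smooth_row_l sY).
  move=> j; under eq_fun do rewrite summxE; apply: smooth_near_sum => i.
  move: j; apply: smooth_rowZ; first exact: (smooth_row_r sY).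
  by apply: smooth_rowD => //; exact: smooth_rowN.
Qed.

End HullBundleOk.
End VectorBundles.

(** * Cotangent bundles of vector bundles in a frame *)

Section Covectors.
Variables (R : realType) (M : manifold R) (hM : is_manifold M).
Notation n := (mdim M).

Section OneBundle.
Variables (V : vbundle M) (Vok : vb_ok V).
Notation r := (vrk V).
Notation okV := (bspace_ok hM (vb_bundle Vok)).
Implicit Types (c : chart R M n) (t : triv (fun m => V m) r).

Definition ccov c t m (e : V m) (p : 'rV[R]_n) (w : 'rV[R]_r) : cotangent (vspace V) :=
  covec (X := vspace V) (vchart c t) (existT _ m e) (row_mx p w).

Section Frame.
Variables (c : chart R M n) (t : triv (fun m => V m) r) (m : M).
Hypotheses (sc : matl c) (vt : vtrivs t) (cm : cdom c m) (tm : tdom t m).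
Notation ch := (vchart c t).
Implicit Types (e : V m) (p : 'rV[R]_n).

Lemma satlV : @satl R (vspace V) ch.
Proof. by exists c, t. Qed.

Lemma cdomV (e : V m) : cdom ch (existT _ m e).
Proof. by []. Qed.

Lemma Wc_is e p w : is_covector (ccov c t e p w).
Proof. exact: covec_is okV _ _ satlV (cdomV e) _. Qed.

Lemma Wc_chart e p w :
  cotangent_chart ch (ccov c t e p w) = row_mx (row_mx (c m) (t m e)) (row_mx p w).
Proof. exact: (cotangent_chartE okV satlV (cdomV e)). Qed.

Lemma Wc_inj e p w e' p' w' : ccov c t e p w = ccov c t e' p' w' ->
  [/\ e = e', p = p' & w = w'].
Proof.
move/(congr1 (cotangent_chart ch)); rewrite !Wc_chart.
by move=> /eq_row_mx[/eq_row_mx[_ /(vt_inj Vok vt tm) ->] /eq_row_mx[-> ->]].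
Qed.

Lemma Wc_ex (w : cotangent (vspace V)) : is_covector w -> tag w.1 = m ->
  exists (e : V m) p v, w = ccov c t e p v.
Proof.
case: w => [[m' e] S] iw /= E; subst m'; exists e.
have := covectorP okV (w := (existT _ m e, S)) satlV (cdomV e) iw.
by rewrite -[rsubmx _]hsubmxK => ->; do 2 eexists.
Qed.

Lemma Wc_mem e p w : (ccov c t e p w).2 (fun q => dotv (ch q) (row_mx p w)).
Proof.
split; first exact: (smooth_at_dot okV satlV (cdomV e)).
exact: (grad_dot okV satlV (cdomV e)).
Qed.

Lemma vpairE e p w (u : V m) : vpair (w := ccov c t e p w) u = dotv w (t m u).
Proof.
have key f : (ccov c t e p w).2 f ->
    derive1 (fun s : R => f (vshift (p := existT _ m e) (s *: u)) : R^o) 0 = dotv w (t m u).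
  move=> [sf gf]; have df := smooth_at_diff okV satlV (cdomV e) sf.
  have gf' : gradv (crep ch f) (ch (existT _ m e)) = row_mx p w := gf.
  have := dotv_gradv (row_mx 0 (t m u)) df; rewrite gf'.
  rewrite dotv_row_mx dotv0r add0r => ->; rewrite /derive1 /derive.
  set d := (fun _ : R => _); set d' := (fun _ : R => _); suff -> : d = d' by [].
  apply/funext => h; have fE e' : f (existT _ m e') = crep ch f (row_mx (c m) (t m e')).
    by rewrite -(crepE (c := ch) f (ao_inj okV satlV) (cdomV e')).
  rewrite /d /d' addr0 /vshift /= !fE scale0r addr0 scale_row_mx add_row_mx scaler0 add0r.
  by rewrite (vtD Vok vt tm) (vtZ Vok vt tm) (addrC (h *: _)).
apply: get_eq; last by move=> y [f /key -> <-].
exists (fun q => dotv (ch q) (row_mx p w)); first exact: Wc_mem.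
exact: (key (fun q => dotv (ch q) (row_mx p w)) (Wc_mem e p w)).
Qed.

Section Shift.
Variables (v : forall m, V m) (vE : 'rV[R]_r).
Hypothesis vvE : forall m', tdom t m' -> t m' (v m') = vE.
Notation shift s := (fun q : vspace V => vshift (p := q) (s *: v (tag q))).

Lemma shiftK s (q : vspace V) : shift s (shift (- s) q) = q.
Proof. by case: q => m' e; rewrite /vshift /= scaleNr subrK. Qed.

(** The section [v] has constant coordinates [vE] in the frame, so its flow is a translation of the
    chart, which moves the base point of a covector and keeps its components. *)
Lemma shift_mem s e p w f : (ccov c t e p w).2 f ->
  (ccov c t (e + s *: v m) p w).2 (f \o shift (- s)).
Proof.
move=> [sf gf].
have N : near_pt (X := vspace V) ch (existT _ m (e + s *: v m))
    (fun q => (f \o shift (- s)) q = crep ch f (ch q + row_mx 0 (- s *: vE))).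
  apply: near_ptT => -[m' e'] [_ /= [cm' tm']].
  have cq : cdom ch (existT _ m' (e' + - s *: v m')) by [].
  rewrite -(vvE tm') -(vtZ Vok vt tm') add_row_mx addr0 -(vtD Vok vt tm').
  by rewrite (crepE (c := ch) f (ao_inj okV satlV) cq).
have E : ch (existT _ m (e + s *: v m)) + row_mx 0 (- s *: vE) = ch (existT _ m e).
  rewrite /= add_row_mx addr0 (vtD Vok vt tm) (vtZ Vok vt tm) (vvE tm).
  by rewrite scaleNr addrK.
split.
  apply/(smooth_at_rep okV satlV (cdomV _) (phi := fun z =>
    crep ch f (z + row_mx 0 (- s *: vE))) N).
  apply: (smooth_near_comp (f := crep ch f) (g := fun z => z + row_mx 0 (- s *: vE))).
    by rewrite E; exact/(smooth_atE okV _ satlV (cdomV e)).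
  by apply: smooth_rowD; [exact: smooth_row_id|exact: smooth_row_cst].
rewrite (grad_rep okV satlV (cdomV _) (phi := fun z =>
    crep ch f (z + row_mx 0 (- s *: vE))) N).
apply: dotv_ext => u; rewrite (@gradv_comp_aff _ _ _ _ id) ?E.
- by rewrite (gf : gradv (crep ch f) (ch (existT _ m e)) = row_mx p w).
- by [].
- by move=> z z'; rewrite addrAC.
- exact: (smooth_at_diff okV satlV (cdomV e) sf).
Qed.

Lemma Wc_shift s e p w : [set f \o shift (- s) | f in (ccov c t e p w).2] =
  (ccov c t (e + s *: v m) p w).2.
Proof.
apply/seteqP; split=> [_ [f Hf <-]|g Hg]; first exact: shift_mem.
exists (g \o shift s).
  have := shift_mem (- s) Hg; rewrite opprK scaleNr addrK; exact.
by apply/funext => q; rewrite /= shiftK.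
Qed.

End Shift.

Lemma Wc_add s e p w (a : vspace V -> R) (al : 'rV[R]_r) :
  (forall m' (e' : V m'), tdom t m' -> a (existT _ m' e') = dotv al (t m' e')) ->
  [set (fun q => f q + s * a q) | f in (ccov c t e p w).2] = (ccov c t e p (w + s *: al)).2.
Proof.
move=> aE; have N : near_pt (X := vspace V) ch (existT _ m e)
    (fun q => a q = dotv (ch q) (row_mx 0 al)).
  apply: near_ptT => -[m' e'] [_ /= [cm' tm']].
  by rewrite dotv_row_mx dotv0r add0r aE // dotvC.
have sd := smooth_at_dot okV satlV (cdomV e) (row_mx 0 al).
have sa : smooth_at a (existT _ m e).
  by apply: (smooth_at_ext okV satlV (cdomV e)) sd; apply: near_ptW N _ => q _ ->.
have ga : grad ch a (existT _ m e) = row_mx 0 al.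
  by rewrite (grad_ext okV satlV (cdomV e) N) (grad_dot okV satlV (cdomV e)).
have key s' w' f : (ccov c t e p w').2 f ->
    (ccov c t e p (w' + s' *: al)).2 (fun q => f q + s' * a q).
  move=> [sf gf]; have sa' := smooth_atZ okV satlV (cdomV e) s' sa.
  split; first exact: (smooth_atD okV satlV (cdomV e)).
  rewrite (gradD okV satlV (cdomV e)) // (gradZ okV satlV (cdomV e)) // gf ga.
  by rewrite scale_row_mx scaler0 add_row_mx addr0.
apply/seteqP; split=> [_ [f Hf <-]|g Hg]; first exact: key.
exists (fun q => g q + - s * a q).
  by have := key (- s) _ _ Hg; rewrite scaleNr addrK.
by apply/funext => q; rewrite mulNr subrK.
Qed.

End Frame.
End OneBundle.

(** * The isomorphism between the cotangent bundles of a vector bundle and of its dual *)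

Section Beta.
Variables (V : vbundle M) (Vok : vb_ok V).
Notation r := (vrk V).
Notation V' := (dual_bundle V).
Notation okV' := (dual_vb_ok hM Vok).
Notation F := (fun m => (V m * dual (V m))%type).
Notation C := (fun m => [set x : F m | [set: V m] x.1 /\ [set: dual (V m)] x.2]).
Notation pt t := (prod_triv (fun t => t) (fun t => dual_triv (V := V) t) t).
Notation P := (bspace C [set pt t | t in @vtrivs _ _ V]).

Lemma pairing_ok : atlas_ok P.
Proof.
apply: (bspace_ok hM).
apply: (@prod_bundle_ok _ _ hM _ _ (fun m => [set: V m]) (fun m => [set: dual (V m)])
  _ _ _ (fun t => t)
  (fun t => dual_triv (V := V) t) (@vtrivs _ _ V)) => //.
  by rewrite image_id; exact: vb_bundle.
exact: (vb_bundle okV').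
Qed.

Definition pairing_defect (f : vspace V -> R) (g : vspace V' -> R) (q : P) : R :=
  dapp (tagged q).2 (tagged q).1 - f (existT _ (tag q) (tagged q).1)
    - g (existT _ (tag q) (tagged q).2).

Section Frame.
Variables (c : chart R M n) (t : triv (fun m => V m) r) (m : M).
Hypotheses (sc : matl c) (vt : vtrivs t) (cm : cdom c m) (tm : tdom t m).
Notation t' := (dual_triv (V := V) t).
Notation pch := (bchart C c (pt t)).

Lemma vt' : @vtrivs _ _ V' t'. Proof. by exists t. Qed.

(* T^*V -> T^*V' sends d f to d g when <xi, e> - f - g is critical on the
   fibre product of V and V', a condition which is independent of the frame. *)
Lemma beta_critical (e : V m) (xi : dual (V m)) p w p' w' f g :
  (ccov c t e p w).2 f -> (ccov (V := V') c t' xi p' w').2 g ->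
  smooth_at (pairing_defect f g) (existT _ m (e, xi)) /\
  (grad pch (pairing_defect f g) (existT _ m (e, xi)) = 0 <->
   [/\ t' m xi = w, p' = - p & w' = t m e]).
Proof.
move=> [sf gf] [sg gg].
have sp : @satl R P pch by exists c, (pt t); split=> //; exists t.
have cp : cdom (pch : chart R P (sdim P)) (existT _ m (e, xi)) by [].
have ok1 := bspace_ok hM (vb_bundle Vok); have ok2 := bspace_ok hM (vb_bundle okV').
have sV := satlV sc vt; have sV' := satlV sc vt'.
pose A (z : 'rV[R]_(n + (r + r))) := row_mx (lsubmx z) (lsubmx (rsubmx z)).
pose B (z : 'rV[R]_(n + (r + r))) := row_mx (lsubmx z) (rsubmx (rsubmx z)).
pose f' := crep (vchart c t) f; pose g' := crep (vchart (V := V') c t') g.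
pose b (z : 'rV[R]_(n + (r + r))) := dotv (rsubmx (rsubmx z)) (lsubmx (rsubmx z)).
pose phi z := b z - f' (A z) - g' (B z).
have lA : linear_row A.
  by move=> s u v; rewrite /A !linearD /= !linearZ /= scale_row_mx add_row_mx.
have lB : linear_row B.
  by move=> s u v; rewrite /B !linearD /= !linearZ /= scale_row_mx add_row_mx.
have lr : linear_row (fun z : 'rV[R]_(n + (r + r)) => rsubmx (rsubmx z)).
  by move=> s u v; rewrite !linearD /= !linearZ.
have ll : linear_row (fun z : 'rV[R]_(n + (r + r)) => lsubmx (rsubmx z)).
  by move=> s u v; rewrite !linearD /= !linearZ.
have N : near_pt (X := P) pch (existT _ m (e, xi))
    (fun q => pairing_defect f g q = phi (pch q)).
  apply: near_ptT => -[m1 [e1 xi1]] [_ /= [cm1 tm1]].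
  rewrite /pairing_defect /phi /b /A /B /= !(row_mxKl, row_mxKr) (dual_trivP Vok vt tm1).
  rewrite /f' /g' -[row_mx (c m1) (t m1 e1)]/(vchart c t (existT _ m1 e1)).
  have cf : cdom (vchart (V := V') c t') (existT _ m1 xi1) by [].
  rewrite -[row_mx (c m1) (t' m1 xi1)]/(vchart (V := V') c t' (existT _ m1 xi1)).
  by rewrite (crepE f (ao_inj ok1 sV)) // (crepE g (ao_inj ok2 sV')).
set a := pch (existT _ m (e, xi)).
have EA : A a = vchart c t (existT _ m e) by rewrite /A /a /= !(row_mxKl, row_mxKr).
have EB : B a = vchart (V := V') c t' (existT _ m xi).
  by rewrite /B /a /= !(row_mxKl, row_mxKr).
have cf : cdom (vchart c t) (existT _ m e) by [].
have cg : cdom (vchart (V := V') c t') (existT _ m xi) by [].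
have sA : smooth_near a (fun z => f' (A z)).
  apply: smooth_near_comp; last exact: smooth_row_lin.
  by rewrite EA; exact/(smooth_atE ok1 _ sV cf).
have sB : smooth_near a (fun z => g' (B z)).
  apply: smooth_near_comp; last exact: smooth_row_lin.
  by rewrite EB; exact/(smooth_atE ok2 _ sV' cg).
have sb : smooth_near a b.
  by apply: smooth_near_dot; exact: smooth_row_lin.
have sbA := smooth_nearB sb sA.
split; first by apply/(smooth_at_rep pairing_ok sp cp N); exact: smooth_nearB.
(* The three blocks are the derivatives along the base, along [V] and along its dual; each of them
   vanishing is one of the three equations defining [beta] in coordinates. *)
have -> : grad pch (pairing_defect f g) (existT _ m (e, xi)) =
    row_mx (- p - p') (row_mx (t' m xi - w) (t m e - w')).
  rewrite (grad_rep pairing_ok sp cp N) -/a; apply: dotv_ext => v.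
  have := smooth_near_diff sA; have := smooth_near_diff sB.
  have := smooth_near_diff sb; have := smooth_near_diff sbA => d1 d2 d3 d4.
  rewrite /phi !gradvB // !dotvDl !dotvNl dotv_gradv_bilin //.
  rewrite (@gradv_comp_aff _ _ _ A A) //; last 2 first.
  - by move=> z z'; rewrite -[z]scale1r lA !scale1r.
  - by rewrite EA; exact: (smooth_at_diff ok1 sV cf sf).
  rewrite (@gradv_comp_aff _ _ _ B B) //; last 2 first.
  - by move=> z z'; rewrite -[z]scale1r lB !scale1r.
  - by rewrite EB; exact: (smooth_at_diff ok2 sV' cg sg).
  rewrite EA EB (gf : gradv f' (vchart c t (existT _ m e)) = _).
  rewrite (gg : gradv g' (vchart (V := V') c t' (existT _ m xi)) = _).
  rewrite -{5}[v]hsubmxK -[rsubmx v in RHS]hsubmxK /A /B !dotv_row_mx.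
  rewrite !dotvDl !dotvNl /a /= !(row_mxKl, row_mxKr) (dotvC (rsubmx (rsubmx v))).
  ring.
split=> [|[-> -> ->]]; last by rewrite opprK addNr !subrr !row_mx0.
rewrite -row_mx0 -[X in row_mx 0 X]row_mx0 => /eq_row_mx[E1 /eq_row_mx[/eqP E2 /eqP E3]].
split.
- by apply/eqP; rewrite -subr_eq0.
- by apply/eqP; rewrite eq_sym -subr_eq0 E1.
- by apply/eqP; rewrite eq_sym -subr_eq0.
Qed.

End Frame.

(** Uniqueness needs the given frame only. For existence the coordinate formula must hold in any
    other frame [(c1, t1)]: by [beta_critical] it says that a certain differential vanishes, and by
    [dzeroP] this can be checked in the frame [(c, t)]. *)
Lemma betaE c t m (e : V m) (xi : dual (V m)) p : matl c -> vtrivs t -> cdom c m -> tdom t m ->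
  beta (ccov c t e p (dual_triv (V := V) t m xi)) =
  ccov (V := V') c (dual_triv (V := V) t) xi (- p) (t m e).
Proof.
move=> sc vt cm tm; set w := ccov _ _ _ _ _; set w' := ccov _ _ _ _ _.
have vtd := vt' vt.
apply: the_eq => [|w'' [iw'' tw'' H]]; last first.
  have {}tw'' : tag w''.1 = m := tw''.
  have [xi'' [p'' [v'' E]]] := Wc_ex okV' (t := dual_triv (V := V) t) sc vtd cm tm iw'' tw''.
  subst w''; have := H c t sc vt cm tm; rewrite (Wc_chart okV') // (Wc_chart Vok) // /beta_coord.
  rewrite !(row_mxKl, row_mxKr) => /eq_row_mx[/eq_row_mx[_ Ex] /eq_row_mx[-> ->]].
  by rewrite (vt_inj okV' vtd tm Ex).
split=> //; first exact: (Wc_is okV').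
move=> c1 t1 sc1 vt1 cm1 tm1; have vtd1 := vt' vt1.
have mf := Wc_mem Vok sc vt cm tm e p (dual_triv (V := V) t m xi).
have mg := Wc_mem okV' sc vtd cm tm xi (- p) (t m e).
have [sm [_ H]] := beta_critical sc vt cm tm mf mg.
have {}H := H (And3 erefl erefl erefl).
have iw : is_covector w by exact: (Wc_is Vok).
have iw' : is_covector w' by exact: (Wc_is okV').
have [e1 [p1 [v1 E1]]] := Wc_ex Vok sc1 vt1 cm1 tm1 iw erefl.
have [xi1 [p1' [v1' E1']]] := Wc_ex okV' (t := dual_triv (V := V) t1) sc1 vtd1 cm1 tm1 iw' erefl.
have Ee : e1 = e := esym (eq_from_Tagged (congr1 fst E1)).
have Ex : xi1 = xi := esym (eq_from_Tagged (congr1 fst E1')).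
subst e1 xi1; rewrite E1 E1' (Wc_chart Vok) // (Wc_chart okV') // /beta_coord.
have mf1 := mf; rewrite -/w E1 in mf1; have mg1 := mg; rewrite -/w' E1' in mg1.
have [_ [G _]] := beta_critical sc1 vt1 cm1 tm1 mf1 mg1.
have sp : @satl R P (bchart C c (pt t)) by exists c, (pt t); split=> //; exists t.
have sp1 : @satl R P (bchart C c1 (pt t1)) by exists c1, (pt t1); split=> //; exists t1.
have cp : cdom (bchart C c (pt t) : chart R P (sdim P)) (existT _ m (e, xi)) by [].
have cp1 : cdom (bchart C c1 (pt t1) : chart R P (sdim P)) (existT _ m (e, xi)) by [].
have D := iffRL (dzeroP pairing_ok sp cp sm) H.
have [-> -> ->] := G (D _ sp1 cp1).
by rewrite !(row_mxKl, row_mxKr).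
Qed.

End Beta.
End Covectors.

(** * The contact map in a frame *)

Section Kappa.
Variables (R : realType) (M : manifold R) (hM : is_manifold M).
Variables (A : sabundle M) (hA : is_sabundle A) (E : embedding A) (Eok : vb_ok E).
Notation n := (mdim M).
Notation k := (ark A).
Notation r := (vrk E).

Section Coordinates.
Variables (t : triv (afib A) (1 + k)) (T : triv (fun m => E m) r).
Variables (B0 vE al : 'rV[R]_r) (L : 'rV[R]_(1 + k) -> 'rV[R]_r).

(* Satisfied by A in its vector hull and by A^# in the dual of the hull. *)
Record embedding_coords : Prop := EmbeddingCoords {
  ec_t : adapted t;
  ec_T : vtrivs T;
  ec_dom : tdom T = tdom t;
  ec_lin : linear_row L;
  ec_map : forall m (a : afib A m), tdom t m -> T m (emap E a) = B0 + L (t m a);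
  ec_vec : forall m, tdom t m -> T m (evec E m) = vE;
  ec_lvec : L (row_mx (const_mx 1) 0) = vE;
  ec_adj : forall q, exists v, forall u, dotv v (L u) = dotv q u;
  ec_alpha : forall m (e : E m), tdom t m -> ealpha e = dotv al (T m e) }.

Hypothesis ec : embedding_coords.

Section Frame.
Variables (c : chart R M n) (m : M).
Hypotheses (sc : matl c) (cm : cdom c m) (tm : tdom t m).
Let tt := ec_t ec.
Let vt := ec_T ec.
Let Tm : tdom T m. Proof. by rewrite (ec_dom ec). Qed.
Implicit Types (e : E m).

Lemma psi1E s e p w : psi1 (E := E) s (ccov c T e p w) = ccov c T (e + s *: evec E m) p w.
Proof.
have vE' m' : tdom T m' -> T m' (evec E m') = vE.
  by rewrite (ec_dom ec); exact: (ec_vec ec).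
by congr pair; exact: (Wc_shift hM Eok sc vt cm Tm vE').
Qed.

Lemma psi2E s e p w : psi2 (E := E) s (ccov c T e p w) = ccov c T e p (w + s *: al).
Proof.
congr pair; apply: (Wc_add hM Eok sc vt cm Tm) => m' e' tm'.
by rewrite -(ec_alpha ec) // -(ec_dom ec).
Qed.

(** In coordinates the inclusion of A is affine with linear part [L] and [fsec] is [u] minus a
    function with gradient [(x, w)]. The base and fibre parts of the gradient of the difference give
    the two conditions. *)
Lemma kappa_dzero y s x w sg (p : 'rV[R]_n) (v : 'rV[R]_r) F :
  (cjet c t m y s x w).2 sg -> (ccov c T (emap E (sg m (Ln t y))) p v).2 F ->
  dzero (X := aspace A) (fun x => F (etot E x) - fsec sg x) (sec_map sg (Lp t m y)) <->
  p = - x /\ forall u, dotv v (L u) = dotv (row_mx (const_mx 1) (- w)) u.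
Proof.
move=> [sec ss us_s us_g] [sF gF].
set a := sec_map sg (Lp t m y).
pose b := bchart (fun m => [set: afib A m]) c t.
have sb : @satl R (aspace A) b by exists c, t.
have cb : cdom (b : chart R (aspace A) (sdim (aspace A))) a by [].
have okA := aspace_ok hM hA; have okE := bspace_ok hM (vb_bundle Eok).
have okL := line_space_ok hM hA.
have sL := satlL sc tt; have cL : cdom (line_chart c t) (Lp t m y) by exact: cdomL.
have sE := satlV sc vt.
have cE : cdom (vchart c T) (etot E a) by [].
pose iota (z : 'rV[R]_(n + (1 + k))) := row_mx (lsubmx z) (B0 + L (rsubmx z)).
pose dio (z : 'rV[R]_(n + (1 + k))) := row_mx (lsubmx z) (L (rsubmx z)).
have ldio : linear_row dio.
  move=> q u u'; rewrite /dio !linearD /= !linearZ /= (ec_lin ec).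
  by rewrite scale_row_mx add_row_mx.
pose pr (z : 'rV[R]_(n + (1 + k))) := row_mx (lsubmx z) (rsubmx (rsubmx z)).
have lpr : linear_row pr.
  by move=> q u u'; rewrite /pr !linearD /= !linearZ /= scale_row_mx add_row_mx.
pose F' := crep (vchart c T) F; pose g := crep (line_chart c t) (us t sg).
pose i0 := rshift n (lshift k (0 : 'I_1)).
have N1 : near_pt (X := aspace A) b a (fun q => F (etot E q) = F' (iota (b q))).
  apply: near_ptT => -[m' a'] [_ /= [cm' tm']]; rewrite /iota !(row_mxKl, row_mxKr).
  rewrite -(ec_map ec) // -[row_mx _ _]/(vchart c T (etot E (existT _ m' a'))).
  by apply/esym/(crepE F (ao_inj okE sE)); do !split; rewrite //= (ec_dom ec).
have N2 : near_pt (X := aspace A) b a (fun q => fsec sg q = b q 0 i0 - g (pr (b q))).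
  apply: near_ptT => -[m' a'] [_ /= [cm' tm']]; rewrite /pr !(row_mxKl, row_mxKr) row_mxEr.
  rewrite (fsecE a' tt tm' sec) -/(yc t a') -(LE tt (yc t a') cm' tm').
  rewrite [g _](crepE (us t sg) (ao_inj okL sL) (cdomL tt (yc t a') cm' tm')).
  by rewrite (zetaE tt tm').
have ya : yc t (sg m (Ln t y)) = y.
  by rewrite (section_yc tt tm sec) ?(line_trivE tt tm) //; exact: Ln_line.
have Ei : iota (b a) = vchart c T (etot E a).
  by rewrite /iota /= !(row_mxKl, row_mxKr) -(ec_map ec).
have Ep : pr (b a) = line_chart c t (Lp t m y).
  by rewrite /pr (LE tt y cm tm) /= !(row_mxKl, row_mxKr) -/(yc t _) ya.
have dF : differentiable F' (iota (b a)).
  by rewrite Ei; exact: (smooth_at_diff okE sE cE sF).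
have dg : differentiable g (pr (b a)).
  by rewrite Ep; exact: (smooth_at_diff okL sL cL ss).
have s1 : smooth_near (b a) (fun z => F' (iota z)).
  apply: smooth_near_comp; first by rewrite Ei; exact/(smooth_atE okE _ sE cE).
  apply: smooth_row_mx; first exact/smooth_row_l/smooth_row_id.
  apply: smooth_rowD; first exact: smooth_row_cst.
  apply: (smooth_row_comp (f := L) (g := fun z => rsubmx z)).
    exact: (smooth_row_lin _ (ec_lin ec)).
  exact/smooth_row_r/smooth_row_id.
have s2 : smooth_near (b a) (fun z => g (pr z)).
  apply: smooth_near_comp; last exact: smooth_row_lin.
  by rewrite Ep; exact/(smooth_atE okL _ sL cL).
have s3 := smooth_near_coord (b a) i0.
have S1 : smooth_at (X := aspace A) (fun q => F (etot E q)) a.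
  exact/(smooth_at_rep okA sb cb (phi := fun z => F' (iota z)) N1).
have S2 : smooth_at (X := aspace A) (fsec sg) a.
  apply/(smooth_at_rep okA sb cb (phi := fun z => z 0 i0 - g (pr z)) N2).
  exact: smooth_nearB.
have G u : dotv (grad b (fun q => F (etot E q) - fsec sg q) a) u =
    dotv (p + x) (lsubmx u) + (dotv v (L (rsubmx u)) -
    dotv (row_mx (const_mx 1) (- w)) (rsubmx u)).
  have D1 : dotv (gradv (fun z : 'rV[R]_(n + (1 + k)) => F' (iota z)) (b a)) u =
      dotv (gradv F' (iota (b a))) (dio u).
    rewrite (@gradv_comp_aff _ _ _ iota dio) // => z z'.
    by rewrite /iota /dio !linearD /= -[rsubmx z]scale1r (ec_lin ec) scale1r add_row_mx !addrA
      scale1r.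
  have D2 : dotv (gradv (fun z : 'rV[R]_(n + (1 + k)) => z 0 i0 - g (pr z)) (b a)) u =
      u 0 i0 - dotv (gradv g (pr (b a))) (pr u).
    have d2 := smooth_near_diff s2; have d3 := smooth_near_diff s3.
    rewrite gradvB // gradv_coord dotvDl dotvNl dotvC dotv_delta.
    rewrite (@gradv_comp_aff _ _ _ pr pr) // => z z'.
    by rewrite -[z]scale1r lpr !scale1r.
  rewrite (gradB okA sb cb S1 S2) [LHS]dotvDl [X in _ + X = _]dotvNl.
  rewrite (grad_rep okA sb cb (phi := fun z => F' (iota z)) N1).
  rewrite (grad_rep okA sb cb (phi := fun z => z 0 i0 - g (pr z)) N2).
  rewrite [X in X - _ = _]D1 [X in _ - X = _]D2.
  rewrite (_ : gradv F' (iota (b a)) = row_mx p v); last by rewrite Ei; exact: gF.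
  rewrite (_ : gradv g (pr (b a)) = row_mx x w); last by rewrite Ep; exact: us_g.
  rewrite /dio /pr !dotv_row_mx (dotvC (row_mx (const_mx 1) _)) dotv_row1 dotvNr (dotvC _ w).
  rewrite dotvDl !mxE.
  ring.
rewrite (dzeroP okA sb cb (smooth_atB okA sb cb S1 S2)); split=> [G0|[Hp Hv]]; last first.
  by apply: dotv_ext => u; rewrite G Hv Hp addNr !dotv0l subrr add0r.
split.
  apply/eqP; rewrite -subr_eq0 opprK; apply/eqP; apply: dotv_ext => u.
  have := G (row_mx u 0); rewrite G0 row_mxKl row_mxKr (linear_row0 (ec_lin ec)).
  by rewrite !dotv0r subr0 addr0 !dotv0l.
move=> u; have := G (row_mx 0 u); rewrite G0 row_mxKl row_mxKr dotv0r add0r dotv0l.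
by move/esym/eqP; rewrite subr_eq0 => /eqP.
Qed.

(** The condition constrains [v] only through its pairing with the image of [L], that is, on vectors
    tangent to the embedded affine bundle; off that image [v] is free, which is why a set of
    covectors and not a single one corresponds to a jet. *)
Lemma kappaE y s x w : kappa (E := E) (cjet c t m y s x w) =
  [set W | exists (e : E m) v, [/\ W = ccov c T e (- x) v,
     T m e = B0 + L (row_mx (const_mx s) y) &
     forall u, dotv v (L u) = dotv (row_mx (const_mx 1) (- w)) u]].
Proof.
have ta sg : (cjet c t m y s x w).2 sg -> t m (sg m (Ln t y)) = row_mx (const_mx s) y.
  move=> [sec _ us_s _]; rewrite tsplit (section_yc tt tm sec); last exact: Ln_line.
  by rewrite (line_trivE tt tm); congr (row_mx (const_mx _) _).
apply/seteqP; split=> [W [[iW _ _] [sg [F [Jsg WF W1 D]]]]|W [e [v [-> Te Hv]]]].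
  have [|e [p [v EW]]] := Wc_ex hM Eok sc vt cm Tm iW; first by rewrite W1.
  have Ee : e = emap E (sg m (Ln t y)).
    by rewrite EW in W1; exact: eq_from_Tagged W1.
  subst e; rewrite EW in WF.
  have [Ep Hv] := (kappa_dzero Jsg WF).1 D; subst p.
  by exists (emap E (sg m (Ln t y))), v; split=> //; rewrite (ec_map ec) // ta.
have Jsg := affsec_mem hM hA sc tt cm tm y s x w; set sg := affsec _ _ _ _ _ _ _ _ _ in Jsg.
have Ee : e = emap E (sg m (Ln t y)).
  by apply: (vt_inj Eok vt Tm); rewrite Te (ec_map ec) // ta.
have WF := Wc_mem hM Eok sc vt cm Tm e (- x) v.
split.
  split; first exact: (Wc_is hM Eok).
    by exists (existT _ m (sg m (Ln t y))); rewrite /etot /= -Ee.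
  rewrite (vpairE hM Eok sc vt cm Tm) (ec_vec ec tm) -(ec_lvec ec) Hv.
  by rewrite dotv_row_mx dotv_const dotv0r addr0 mulr1.
exists sg, (fun q => dotv (vchart c T q) (row_mx (- x) v)); split=> //.
- by rewrite /etot /= -Ee.
- by rewrite Ee in WF; apply/(kappa_dzero Jsg WF).
Qed.

End Frame.
End Coordinates.

Definition embedding_framed : Prop := forall m, exists t T B0 vE al L,
  embedding_coords t T B0 vE al L /\ tdom t m.

Lemma kappa_tag (j : cpt A) W : kappa (E := E) j W -> tag W.1 = tag j.1.
Proof. by move=> [_ [sg [F [_ _ -> _]]]]. Qed.

Hypothesis framed : embedding_framed.

(** All coordinates of the jet can be read off from any element of [kappa j], so it is enough that
    this set is nonempty. *)
Lemma kappa_inj (j j' : cpt A) : is_jet j -> is_jet j' ->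
  kappa (E := E) j = kappa (E := E) j' -> j = j'.
Proof.
move=> ij ij' Ej; set m := tag j.1.
have [t [T [B0 [vE [al [L [ec tm]]]]]]] := framed m.
have [c sc cm] := matl_cover hM m; have tt := ec_t ec; have vt := ec_T ec.
have Tm : tdom T m by rewrite (ec_dom ec).
have [y [s [x [w Jj]]]] := jet_J hM hA sc tt cm tm ij erefl.
have := Ej; rewrite {1}Jj (kappaE ec sc cm tm) => K.
have [a Ea] := triv_surj (adapted_affine tt) (row_mx (const_mx s) y) tm.
(* [ec_adj] says that the transpose of [L] is onto: it yields an element of [kappa j] here, and the
   injectivity of [L] just below. *)
have [v Hv] := ec_adj ec (row_mx (const_mx 1) (- w)).
have Linj u u' : L u = L u' -> u = u'.
  move=> EL; apply: dotv_ext => q; rewrite dotvC [RHS]dotvC.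
  by have [q' Hq'] := ec_adj ec q; rewrite -!Hq' EL.
have W0 : kappa (E := E) j' (ccov c T (emap E a) (- x) v).
  by rewrite -K; exists (emap E a), v; split=> //; rewrite (ec_map ec) // Ea.
(* The common covector forces both jets to lie over [m], so that they can be compared in one
   frame. *)
have tj' : tag j'.1 = m by rewrite -(kappa_tag W0).
have [y' [s' [x' [w' Jj']]]] := jet_J hM hA sc tt cm tm ij' tj'.
move: W0; rewrite Jj' (kappaE ec sc cm tm) => -[e' [v' [EW Te Hv']]].
have [Ee /oppr_inj Ex Ev] := Wc_inj hM Eok sc vt cm Tm EW; subst e' x' v'.
rewrite Jj.
move: Te; rewrite (ec_map ec) // Ea => /addrI /Linj /eq_row_mx[Es ->].
have -> : s = s' by have := congr1 (fun z : 'rV[R]_1 => z 0 0) Es; rewrite !mxE.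
have /eq_row_mx[_ /oppr_inj ->] : row_mx (const_mx 1 : 'rV[R]_1) (- w) = row_mx (const_mx 1) (- w').
  by apply: dotv_ext => u; rewrite -Hv Hv'.
by [].
Qed.

Lemma kappa_invK (j : cpt A) : is_jet j -> kappa_inv (kappa (E := E) j) = j.
Proof. by move=> ij; apply: the_eq => // j' [ij' Ej]; exact: kappa_inj. Qed.

End Kappa.

(** * The maps kappa, tau and beta in a frame *)

Section ContactIso.
Variables (R : realType) (M : manifold R) (hM : is_manifold M).
Variables (A : sabundle M) (hA : is_sabundle A).
Notation n := (mdim M).
Notation k := (ark A).
Notation HA := (hull_embedding A).
Notation HS := (dual_embedding A).
Let hS := sharp_sab hM hA.
Let okH : vb_ok HA := hull_vb_ok hM hA.
Let okD : vb_ok HS := dual_vb_ok hM okH.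

Definition eH (u : R) (y : 'rV[R]_k) : 'rV[R]_(1 + (1 + k)) :=
  row_mx (const_mx 1) (row_mx (const_mx u) y).

Definition eD (b : R) (w : 'rV[R]_k) : 'rV[R]_(1 + (1 + k)) :=
  row_mx (const_mx b) (row_mx (const_mx 1) w).

Lemma hull_coords (t : triv (afib A) (1 + k)) : adapted t ->
  embedding_coords (E := HA) t (hull_triv t) (row_mx (const_mx 1) 0) (row_mx 0 (row_mx (const_mx 1) 0))
    (row_mx (const_mx 1) 0) (fun u => row_mx 0 u).
Proof.
move=> tt; split=> //.
- by exists t.
- by move=> q u v; rewrite scale_row_mx add_row_mx scaler0 addr0.
- by move=> m a tm; rewrite (hull_triv_gen hA tt tm) add_row_mx addr0 add0r.
- by move=> m tm; exact: evec_hull.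
- by move=> q; exists (row_mx 0 q) => u; rewrite dotv_row_mx dotv0l add0r.
- move=> m e tm; rewrite /= dotv_row_mx dotv0l addr0 dotv_const mul1r; done.
Qed.

(** Compared with [hull_coords] the coordinates alpha and [u] exchange their roles: the affine dual
    is the hyperplane where the second component is [1], its distinguished vector is the linear
    function alpha with components [(1; 0; 0)], and its canonical linear function is evaluation at
    [v_A], which reads the second component. *)
Lemma dual_coords (t : triv (afib A) (1 + k)) : adapted t ->
  embedding_coords (E := HS) (sharp_triv t) (dual_triv (V := hull_bundle A) (hull_triv t))
    (row_mx 0 (row_mx (const_mx 1) 0)) (row_mx (const_mx 1) 0) (row_mx 0 (row_mx (const_mx 1) 0))
    (fun u => row_mx (lsubmx u) (row_mx 0 (rsubmx u))).
Proof.
move=> tt; split.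
- exact: sharp_adapted.
- by exists (hull_triv t) => //; exists t.
- by [].
- by move=> q u v; rewrite !linearD /= !linearZ /= !scale_row_mx !add_row_mx scaler0 addr0.
- move=> m f tm; apply: (dual_triv_linext hA tt tm); first by case: (svalP f).
  move=> a; rewrite (sharp_trivP hA tt tm) add_row_mx add0r add_row_mx addr0 add0r row_mxKr.
  rewrite row_mxEl [(lsubmx _) 0 0]mxE tsplit dotv_row_mx dotv_const mul1r /sev row_mxKr.
  by rewrite row_mxEl mxE addrA.
- move=> m tm; apply: (dual_triv_linext hA tt tm); first exact: affine_cst.
  by move=> a; rewrite row_mxEl mxE row_mxKr dotv0l addr0.
- by rewrite row_mxKl row_mxKr row_mx0.
- move=> q; exists (row_mx (lsubmx q) (row_mx 0 (rsubmx q))) => u.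
  by rewrite !dotv_row_mx dotv0l add0r -dotv_row_mx !hsubmxK.
- move=> m e tm; transitivity (dotv (dual_triv (V := hull_bundle A) (hull_triv t) m e)
    (hull_triv t m (evec HA m))); last by rewrite (evec_hull hA tt tm) dotvC.
  have vt : vtrivs (v := hull_bundle A) (hull_triv t) by exists t.
  exact: (dual_trivP okH vt tm).
Qed.

Lemma hull_framed : embedding_framed HA.
Proof.
move=> m; have [t tt tm] := adapted_cover hM hA m; do 6 eexists; split; last exact: tm.
exact: hull_coords.
Qed.

Lemma dual_framed : embedding_framed HS.
Proof.
move=> m; have [t tt tm] := adapted_cover hM hA m; do 6 eexists; split.
  exact: (dual_coords tt).
exact: tm.
Qed.

Section Frame.
Variables (c : chart R M n) (t : triv (afib A) (1 + k)) (m : M).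
Hypotheses (sc : matl c) (tt : adapted t) (cm : cdom c m) (tm : tdom t m).
Let T : triv (fun m => hull_bundle A m) (vrk (hull_bundle A)) := hull_triv t.
Let T' := dual_triv (V := hull_bundle A) T.
Let vt : vtrivs (v := hull_bundle A) T. Proof. by exists t. Qed.
Let vt' : vtrivs (v := dual_bundle (hull_bundle A)) T'. Proof. by exists T. Qed.
Notation W := (ccov (V := hull_bundle A) c T).
Notation W' := (ccov (V := dual_bundle (hull_bundle A)) c T').

(** A section with constant [u]-coordinate serves to choose the point of A with coordinates
    [(u; y)]; it is used as a generator of the hull, hence visibly lies in A. *)
Definition hpt (u : R) (y : 'rV[R]_k) : hull_bundle A m :=
  hgen (@acomb _ _ A m) (mksec hM hA tt (fun=> u) (Ln (m := m) t y)).

Lemma hptE u y : T m (hpt u y) = eH u y.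
Proof.
rewrite /T /hpt (hull_triv_gen hA tt tm) /eH tsplit; congr (row_mx _ (row_mx (const_mx _) _)).
  by apply: (us_mksec hM hA tt (fun=> u) (q := Lp t m y)) => //; exact: Ln_line.
rewrite (section_yc tt tm) ?(line_trivE tt tm) //; last exact: Ln_line.
exact: mksec_section.
Qed.

Lemma hpt_eq e u y : T m e = eH u y -> e = hpt u y.
Proof. by move=> Te; apply: (vt_inj okH vt tm); rewrite hptE. Qed.

Lemma hpt_shift u y s : hpt u y + s *: evec HA m = hpt (u + s) y.
Proof.
apply: hpt_eq; rewrite (vtD okH vt tm) (vtZ okH vt tm) hptE (evec_hull hA tt tm).
rewrite /eH !scale_row_mx !add_row_mx !scaler0 !addr0; congr (row_mx _ (row_mx _ _)).
by apply/rowP => i; rewrite !mxE mulr1.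
Qed.

(* [(x; 1, u, y; p; b, 1, w)] in the coordinates of T^*E, with [x] those of [m] *)
Definition BAc (u : R) (y : 'rV[R]_k) (p : 'rV[R]_n) (b : R) (w : 'rV[R]_k) : cov A := W (hpt u y) p (eD b w).

Lemma D_BA u y p b w : is_BA (BAc u y p b w).
Proof.
split; first exact: (Wc_is hM okH).
  by exists (existT _ m (mksec hM hA tt (fun=> u) (Ln (m := m) t y))).
rewrite /BAc (vpairE hM okH sc vt cm tm) (evec_hull hA tt tm) /eD dotv_row_mx dotv0r add0r.
by rewrite dotv_row_mx dotv_const dotv0r addr0 mulr1.
Qed.

Lemma BA_D w0 : is_BA w0 -> tag w0.1 = m -> exists u y p b w, w0 = BAc u y p b w.
Proof.
move=> [iw [[m' a] Ex] pair1] Em.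
have [e [p [v EW]]] := Wc_ex hM okH sc vt cm tm iw Em; subst w0.
have Em' : m = m' := congr1 tag Ex; subst m'.
have Ee : e = hgen (@acomb _ _ A m) a := eq_from_Tagged Ex.
move: pair1; rewrite (vpairE hM okH sc vt cm tm) (evec_hull hA tt tm).
rewrite -[v]hsubmxK dotv_row_mx dotv0r add0r -[rsubmx v]hsubmxK dotv_row_mx dotv0r addr0.
rewrite [lsubmx (rsubmx v)]row1E dotv_const mulr1 => E1.
exists (uc t a), (yc t a), p, (lsubmx v 0 0), (rsubmx (rsubmx v)).
rewrite /BAc /eD -row1E -(@hpt_eq e); last first.
  by rewrite Ee /T (hull_triv_gen hA tt tm) tsplit.
congr (W _ _ (row_mx _ (row_mx _ _))); first exact: row1E.
by rewrite [LHS]row1E E1.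
Qed.

Lemma orbit1D u y p b w : BA_orbit1 (BAc u y p b w) = [set BAc u' y p b w | u' in [set: R]].
Proof.
have P s : psi1 (E := HA) s (BAc u y p b w) = BAc (u + s) y p b w.
  by rewrite /BAc (psi1E hM okH (hull_coords tt) sc cm tm) hpt_shift.
apply/seteqP; split=> [_ [s _ <-]|_ [u' _ <-]]; first by exists (u + s).
by exists (u' - u) => //; rewrite P addrC subrK.
Qed.

Lemma orbit2D u y p b w : BA_orbit2 (BAc u y p b w) = [set BAc u y p b' w | b' in [set: R]].
Proof.
have P s : psi2 (E := HA) s (BAc u y p b w) = BAc u y p (b + s) w.
  rewrite /BAc (psi2E hM okH (hull_coords tt) sc cm tm); congr (W _ _ _).
  rewrite /eD scale_row_mx add_row_mx scaler0 addr0; congr row_mx.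
  by apply/rowP => i; rewrite !mxE mulr1.
apply/seteqP; split=> [_ [s _ <-]|_ [b' _ <-]]; first by exists (b + s).
by exists (b' - b) => //; rewrite P addrC subrK.
Qed.

(** The value of [b] is arbitrary, being the coefficient of d alpha along which the second orbit
    runs. The signs of [x] and [w] come from [fsec], where the section is subtracted from [u]. *)
Lemma kappaD y s x w b : kappaA (cjet c t m y s x w) = BA_orbit2 (BAc s y (- x) b (- w)).
Proof.
rewrite /kappaA (kappaE hM hA okH (hull_coords tt) sc cm tm) orbit2D.
apply/seteqP; split=> [_ [e [v [-> Te Hv]]]|_ [b' _ <-]].
  exists (lsubmx v 0 0) => //; rewrite /BAc -(@hpt_eq e); last first.
    by rewrite /T Te add_row_mx addr0 add0r.
  congr (W _ _ _); rewrite /eD -row1E -[RHS]hsubmxK; congr row_mx.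
  by apply: dotv_ext => u; rewrite -Hv -{1}[v]hsubmxK dotv_row_mx dotv0r add0r.
exists (hpt s y), (eD b' (- w)); split=> //.
  by rewrite [LHS]hptE add_row_mx addr0 add0r.
by move=> u; rewrite /eD dotv_row_mx dotv0r add0r.
Qed.

Lemma vpair_euler u y p b w : vpair (w := BAc u y p b w) (hpt u y) = b + u + dotv w y.
Proof.
rewrite (vpairE hM okH sc vt cm tm) hptE /eD /eH !dotv_row_mx !dotv_const; ring.
Qed.

(** On the second orbit the value on the Euler field is [b] plus a constant, so it vanishes for
    exactly one [b]. The representative with [u = 0] is a choice: the first orbit runs through all
    values of [u]. *)
Lemma tauD u y p b w : tauA (BA_orbit2 (BAc u y p b w)) =
  BA_orbit1 (BAc 0 y p (- (u + dotv w y)) w).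
Proof.
rewrite orbit2D orbit1D; apply/seteqP; split=> [w1 [_ [[b' _ <-] E0]]|_ [u' _ <-]].
  move: E0; rewrite vpair_euler => E0; rewrite -/(BA_orbit1 _) orbit1D => -[u' _ <-].
  exists u' => //; congr BAc; apply/eqP; rewrite -subr_eq0 -oppr_eq0 -E0.
  by apply/eqP; ring.
exists (BAc u y p (- (u + dotv w y)) w); split.
- by exists (- (u + dotv w y)).
- by rewrite vpair_euler; ring.
- by rewrite -/(BA_orbit1 _) orbit1D; exists u'.
Qed.

(** After [beta] the base point has coordinates [(b; 1; w)] and the vertical components are
    [(1; u; y)] with [u] free. Matching this with [kappaE] for the affine dual gives the point [w],
    the value [b] and, after the two sign changes, the derivatives [p] and [- y]. *)
Lemma beta_orbitD u y p b w : beta_quot (BA_orbit1 (BAc u y p b w)) =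
  kappa (E := HS) (cjet (A := sharp A) c (sharp_triv t) m w b p (- y)).
Proof.
have [xi Exi] := dual_triv_surj okH vt tm (eD b w).
have bD u' : beta (V := hull_bundle A) (BAc u' y p b w) = W' xi (- p) (eH u' y).
  by rewrite /BAc -{1}Exi (betaE hM okH _ xi p sc vt cm tm) -/T hptE.
rewrite /beta_quot (kappaE hM hS okD (dual_coords tt) sc cm tm) orbit1D.
apply/seteqP; split=> [_ [_ [u' _ <-] <-]|_ [e [v [-> Te Hv]]]].
  exists xi, (eH u' y); split; first exact: bD.
    rewrite [LHS]Exi row_mxKl row_mxKr add_row_mx add0r add_row_mx addr0 add0r; done.
  by move=> q; rewrite opprK /eH -[q in RHS]hsubmxK !dotv_row_mx dotv0r add0r.
have Ee : e = xi.
  apply: (vt_inj okD vt' tm); rewrite [LHS]Te [RHS]Exi row_mxKl row_mxKr.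
  by rewrite add_row_mx add0r add_row_mx addr0 add0r.
subst e; exists (BAc (lsubmx (rsubmx v) 0 0) y p b w); first by exists (lsubmx (rsubmx v) 0 0).
rewrite bD; congr (W' _ _ _); rewrite /eH -row1E.
(* The image of [L] omits the middle coordinate: the outer components of [v] are determined, and its
   middle component becomes the parameter of the first orbit. *)
have H1 q : dotv (lsubmx v) (lsubmx q) + dotv (rsubmx (rsubmx v)) (rsubmx q) =
    dotv (const_mx 1) (lsubmx q) + dotv y (rsubmx q).
  have := Hv q; rewrite opprK -{1}[v]hsubmxK -{1}[rsubmx v]hsubmxK !dotv_row_mx dotv0r add0r => ->.
  by rewrite -[q in LHS]hsubmxK dotv_row_mx.
rewrite -[RHS]hsubmxK -[rsubmx v in RHS]hsubmxK; congr (row_mx _ (row_mx _ _)).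
  apply: dotv_ext => q; have := H1 (row_mx q 0); rewrite row_mxKl row_mxKr !dotv0r !addr0.
  by move->.
apply: dotv_ext => q; have := H1 (row_mx 0 q); rewrite row_mxKl row_mxKr !dotv0r !add0r.
by move->.
Qed.

Lemma contact_isoJ y s x w : contact_iso (cjet c t m y s x w) =
  cjet (A := sharp A) c (sharp_triv t) m (- w) (dotv w y - s) (- x) (- y).
Proof.
rewrite /contact_iso (kappaD y s x w 0) tauD beta_orbitD.
rewrite (kappa_invK hM hS okD dual_framed).
  by congr (cjet _ _ _ _ _ _ _); rewrite dotvNl opprD opprK addrC.
by apply: J_jet => //; exact: sharp_adapted.
Qed.

End Frame.
End ContactIso.

(** * Isomorphisms of double affine bundles *)

Section Diffeo.
Variable R : realType.

Definition chart_good (X : space R) (c : chart R X (sdim X)) : Prop :=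
  [/\ satl c, cdom c `<=` @scar R X, set_inj (cdom c) c & open (c @` cdom c)].

Lemma smooth_map_chart (X Y : space R) (F : X -> Y) c d phi p :
  chart_good c -> satl d -> cdom c p ->
  (forall q, cdom c q -> cdom d (F q) /\ d (F q) = phi (c q)) ->
  (forall z, smooth_row z phi) -> smooth_map_at F p.
Proof.
move=> [sc _ ic oc] sd cp H sm; exists c, d, (c @` cdom c); split; first by split=> //; exists p.
split=> [_ [q cq <-]|i]; first by exists q => //; split=> //; have [] := H q cq.
apply: smooth_on_near => _ [q cq <-].
apply: (@smooth_near_ext _ _ _ (fun z => phi z 0 i)) (sm _ i).
have : nbhs (c q) (c @` cdom c) by apply: open_nbhs_nbhs; split=> //; exists q.
by apply: filterS => _ [q' cq' <-]; rewrite crepE //; have [_ ->] := H q' cq'.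
Qed.

(* No compatibility between the charts of different indices is required, since F
   and its inverse are only ever read in the two charts of a common index. *)
Lemma diffeo_charts (X Y : space R) (x0 : X) (F : X -> Y) (I : Type) (P : set I)
    (c : I -> chart R X (sdim X)) (d : I -> chart R Y (sdim Y)) phi psi :
  (forall i, P i -> chart_good (c i) /\ chart_good (d i)) ->
  (forall q, scar q -> exists2 i, P i & cdom (c i) q) ->
  (forall r, scar r -> exists2 i, P i & cdom (d i) r) ->
  (forall i q, P i -> cdom (c i) q ->
     [/\ cdom (d i) (F q), d i (F q) = phi (c i q) & c i q = psi (d i (F q))]) ->
  (forall i r, P i -> cdom (d i) r -> exists2 q, cdom (c i) q & F q = r) ->
  (forall i q, P i -> scar q -> cdom (d i) (F q) -> cdom (c i) q) ->
  (forall z, smooth_row z phi) -> (forall z, smooth_row z psi) -> diffeo F.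
Proof.
move=> good covX covY H surj dom sphi spsi.
have inj p p' : scar p -> scar p' -> F p = F p' -> p = p'.
  move=> xp xp' E; have [i Pi cp] := covX p xp; have [[_ _ ic _] _] := good i Pi.
  have [dp _ Ep] := H i p Pi cp; have cp' : cdom (c i) p' by apply: dom; rewrite // -E.
  by apply: ic; rewrite ?inE // Ep E; have [_ _ <-] := H i p' Pi cp'.
(* The inverse is chosen globally; on the domain of each [d i] it is then read as [psi], since [F]
   maps the domain of [c i] onto it. *)
pose G r := the x0 [set p | scar p /\ F p = r].
have GF p : scar p -> G (F p) = p.
  by move=> xp; apply: the_eq => // p' [xp' /inj]; exact.
split=> [p xp|].
  have [i Pi cp] := covX p xp; have [gc [sd dY _ _]] := good i Pi.
  split; first by apply: dY; have [] := H i p Pi cp.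
  by apply: (smooth_map_chart (c := c i) (d := d i)) sphi => // q cq; have [] := H i q Pi cq.
exists G; split=> // r yr; have [i Pi dr] := covY r yr; have [[sc cX _ _] gd] := good i Pi.
  have Gd q : cdom (d i) q -> cdom (c i) (G q) /\ c i (G q) = psi (d i q).
    move=> dq; have [p cp <-] := surj i q Pi dq; rewrite GF //; last exact: cX.
    by have [_ _] := H i p Pi cp.
  split; first by have [/cX] := Gd r dr.
  exact: (smooth_map_chart (c := d i) (d := c i)) spsi.
by have [p /cX xp <-] := surj i r Pi dr; rewrite GF.
Qed.

Lemma chart_good_ok (X : space R) (c : chart R X (sdim X)) : atlas_ok X -> satl c -> chart_good c.
Proof.
move=> ok sc; split=> //; [by move=> q; exact: ao_scar|exact: ao_inj|].
by have := ao_open ok sc sc; rewrite setIid.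
Qed.

(** The image consists of all coordinate rows whose base part lies in the open set of coordinates of
    [U], all other coordinates being unrestricted. *)
Lemma open_chart_img (M : manifold R) (hM : is_manifold M) (T : Type) (a b : nat)
    (ch : chart R T ((mdim M + a) + b)) (c : chart R M (mdim M)) (U : set M) :
  matl c -> open U -> U `<=` cdom c ->
  (forall q, cdom ch q -> exists2 m, U m & lsubmx (lsubmx (ch q)) = c m) ->
  (forall m z, U m -> lsubmx (lsubmx z) = c m -> exists2 q, cdom ch q & ch q = z) ->
  open (ch @` cdom ch).
Proof.
move=> sc oU Uc H1 H2; rewrite openE => _ [q cq <-].
have [m Um E] := H1 q cq.
have N : nbhs (lsubmx (lsubmx (ch q))) (c @` U).
  apply: open_nbhs_nbhs; split; first exact: matl_img.
  by exists m.
have := near_lsub (near_lsub N); apply: filterS => z /= [m' Um' Ez].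
by have [q' cq' <-] := H2 m' z Um' (esym Ez); exists q'.
Qed.

End Diffeo.

Lemma linear_row_comb (R : realType) (a b : nat) (L : 'rV[R]_a -> 'rV[R]_b) r u v : linear_row L ->
  L (r *: u + (1 - r) *: v) = r *: L u + (1 - r) *: L v.
Proof. by move=> HL; rewrite HL -[(1 - r) *: v]addr0 HL (linear_row0 HL) addr0. Qed.

(** * Maps between bundles of lines with the same linear expression in all frames *)

Section FramedLines.
Variables (R : realType) (M : manifold R) (hM : is_manifold M).
Variables (A B : sabundle M) (hA : is_sabundle A) (hB : is_sabundle B).
Notation n := (mdim M).
Variables (I : Type) (P : set I) (c : I -> chart R M n).
Variables (t : I -> triv (afib A) (1 + ark A)) (t' : I -> triv (afib B) (1 + ark B)).
Hypothesis fr : forall i, P i -> [/\ matl (c i), adapted (t i), adapted (t' i) &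
  tdom (t' i) = tdom (t i)].
Hypothesis cov : forall m, exists2 i, P i & cdom (c i) m /\ tdom (t i) m.
Variables (g : 'rV[R]_(ark A) -> 'rV[R]_(ark B)) (g' : 'rV[R]_(ark B) -> 'rV[R]_(ark A)).
Hypotheses (gl : linear_row g) (gl' : linear_row g') (gK : cancel g g') (gK' : cancel g' g).
Variable F : line_pt A -> line_pt B.
Hypothesis FE : forall i m y, P i -> cdom (c i) m -> tdom (t i) m ->
  F (Lp (t i) m y) = Lp (t' i) m (g y).

Lemma line_pt_Lp (D : sabundle M) (s : triv (afib D) (1 + ark D)) (q : line_pt D) :
  adapted s -> tdom s (tag q) -> is_line (tagged q) ->
  q = Lp s (tag q) (line_triv s (tag q) (tagged q)).
Proof. by case: q => m S /= ss sm lS; rewrite /Lp -line_LnE. Qed.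

Lemma line_ptP (D : sabundle M) (s : triv (afib D) (1 + ark D)) (q : line_pt D) m :
  adapted s -> tdom s m -> is_line (tagged q) -> tag q = m -> exists y, q = Lp s m y.
Proof.
by move=> ss sm lq E; exists (line_triv s (tag q) (tagged q)); subst m; exact: line_pt_Lp.
Qed.

Lemma line_comb_Lp (D : sabundle M) (hD : is_sabundle D) (s : triv (afib D) (1 + ark D)) m l y y' :
  adapted s -> tdom s m -> line_comb l (Lp s m y) (Lp s m y') = Lp s m (l *: y + (1 - l) *: y').
Proof. by move=> ss sm; exact: line_comb_Ln. Qed.

Lemma framed_line_tag (q : line_pt A) : is_line (tagged q) -> tag (F q) = tag q.
Proof.
move=> lq; have [i Pi [cm tm]] := cov (tag q); have [sc tt _ _] := fr Pi.
by rewrite (line_pt_Lp tt tm lq) FE.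
Qed.

Lemma framed_line_comb l (q q' : line_pt A) : is_line (tagged q) -> is_line (tagged q') ->
  tag q = tag q' -> F (line_comb l q q') = line_comb l (F q) (F q').
Proof.
move=> lq lq' E; have [i Pi [cm tm]] := cov (tag q); have [sc tt tt' Ed] := fr Pi.
have [y ->] := line_ptP tt tm lq erefl; have [y' ->] := line_ptP tt tm lq' (esym E).
have tm' : tdom (t' i) (tag q) by rewrite Ed.
by rewrite line_comb_Lp // !FE // line_comb_Lp // (linear_row_comb _ _ _ gl).
Qed.

Lemma framed_line_diffeo : diffeo (X := line_space A) (Y := line_space B) F.
Proof.
pose phi (z : 'rV[R]_(n + ark A)) := row_mx (lsubmx z) (g (rsubmx z)).
pose psi (z : 'rV[R]_(n + ark B)) := row_mx (lsubmx z) (g' (rsubmx z)).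
apply: (@diffeo_charts R (line_space A) (line_space B) (existT _ point set0) F I P
  (fun i => line_chart (c i) (t i)) (fun i => line_chart (c i) (t' i)) phi psi).
- move=> i Pi; have [sc tt tt' _] := fr Pi; split.
    by apply: chart_good_ok; [exact: (line_space_ok hM hA)|exact: satlL].
  by apply: chart_good_ok; [exact: (line_space_ok hM hB)|exact: satlL].
- by move=> q lq; have [i Pi [cm tm]] := cov (tag q); exists i.
- move=> q lq; have [i Pi [cm tm]] := cov (tag q); have [_ _ _ Ed] := fr Pi; exists i => //.
  by do !split; rewrite /= ?Ed.
- move=> i q Pi [lq [cm tm]]; have [sc tt tt' Ed] := fr Pi.
  have tm' : tdom (t' i) (tag q) by rewrite Ed.
  rewrite (line_pt_Lp tt tm lq) FE // !LE //.
  split; first exact: cdomL.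
    by rewrite /phi row_mxKl row_mxKr.
  by rewrite /psi row_mxKl row_mxKr gK.
- move=> i r Pi [lr [cm tm']]; have [sc tt tt' Ed] := fr Pi.
  have tm : tdom (t i) (tag r) by rewrite -Ed.
  exists (Lp (t i) (tag r) (g' (line_triv (t' i) (tag r) (tagged r)))); first exact: cdomL.
  by rewrite FE // gK' -line_pt_Lp.
- move=> i q Pi lq [_ []]; rewrite (framed_line_tag lq) => cm; have [_ _ _ ->] := fr Pi.
  by [].
- move=> z; apply: smooth_row_mx; first exact/smooth_row_l/smooth_row_id.
  apply: (smooth_row_comp (f := g) (g := fun z => rsubmx z)); first exact: smooth_row_lin.
  exact/smooth_row_r/smooth_row_id.
- move=> z; apply: smooth_row_mx; first exact/smooth_row_l/smooth_row_id.
  apply: (smooth_row_comp (f := g') (g := fun z => rsubmx z)); first exact: smooth_row_lin.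
  exact/smooth_row_r/smooth_row_id.
Qed.

End FramedLines.

(** * Charts of the contact bundle *)

Section JetCharts.
Variables (R : realType) (M : manifold R) (hM : is_manifold M).
Variables (A : sabundle M) (hA : is_sabundle A).
Notation n := (mdim M).
Notation k := (ark A).

Lemma jet_chart_good c (t : triv (afib A) (1 + k)) : matl c -> adapted t ->
  chart_good (X := contact_space A) (jet_chart c t).
Proof.
move=> sc tt; split; first by exists c, t.
- by move=> j [].
- move=> j j'; rewrite !inE => -[ij [_ [cm tm]]] [ij' [_ [cm' tm']]].
  have [y [s [x [w ->]]]] := jet_J hM hA sc tt cm tm ij erefl.
  have [y' [s' [x' [w' ->]]]] := jet_J hM hA sc tt cm' tm' ij' erefl.
  rewrite !jet_chartJ // => /eq_row_mx[/eq_row_mx[E ->] /eq_row_mx[Es /eq_row_mx[-> ->]]].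
  have := congr1 (fun z : 'rV[R]_1 => z 0 0) Es; rewrite !mxE => ->.
  by have -> : tag j.1 = tag j'.1 by apply: (matl_inj hM sc); rewrite ?inE.
- apply: (open_chart_img hM (U := cdom c `&` tdom t) sc).
  + by apply: openI; [exact: matl_open|exact: (adapted_affine tt).1].
  + by move=> m [].
  + move=> j [ij [_ [cm tm]]]; exists (tag j.1) => //.
    have [y [s [x [w ->]]]] := jet_J hM hA sc tt cm tm ij erefl.
    by rewrite jet_chartJ // !row_mxKl.
  + move=> m z [cm tm] Ez.
    exists (cjet c t m (rsubmx (lsubmx z)) (rsubmx z 0 (lshift _ 0)) (lsubmx (rsubmx (rsubmx z)))
      (rsubmx (rsubmx (rsubmx z)))).
      by split; [exact: J_jet|exact: cdomL].
    rewrite jet_chartJ // -Ez !hsubmxK -[RHS]hsubmxK -[rsubmx z in RHS]hsubmxK.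
    by congr (row_mx _ (row_mx _ _)); apply/rowP => i; rewrite !mxE !ord1.
Qed.

End JetCharts.

(* For A itself, [e = 1] and [f w = - w]; for the adjoint of A, [e = -1] and
   [f w = w]; in both cases [l y = - y]. *)
Section FramedContact.
Variables (R : realType) (M : manifold R) (hM : is_manifold M).
Variables (A B : sabundle M) (hA : is_sabundle A) (hB : is_sabundle B).
Notation n := (mdim M).
Variables (I : Type) (P : set I) (c : I -> chart R M n).
Variables (t : I -> triv (afib A) (1 + ark A)) (t' : I -> triv (afib B) (1 + ark B)).
Hypothesis fr : forall i, P i -> [/\ matl (c i), adapted (t i), adapted (t' i) &
  tdom (t' i) = tdom (t i)].
Hypothesis cov : forall m, exists2 i, P i & cdom (c i) m /\ tdom (t i) m.
Variables (f l : 'rV[R]_(ark A) -> 'rV[R]_(ark B)) (f' l' : 'rV[R]_(ark B) -> 'rV[R]_(ark A)).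
Hypotheses (fl : linear_row f) (fl' : linear_row f') (fK : cancel f f') (fK' : cancel f' f).
Hypotheses (ll : linear_row l) (ll' : linear_row l') (lK : cancel l l') (lK' : cancel l' l).
Variables (e : R) (ee : e * e = 1).
Variable Phi : cpt A -> cpt B.
Hypothesis PhiJ : forall i m y s x w, P i -> cdom (c i) m -> tdom (t i) m ->
  Phi (cjet (c i) (t i) m y s x w) =
  cjet (c i) (t' i) m (f w) (e * (dotv w y - s)) ((- e) *: x) (l y).

(** [dab_iso] asks for maps between the side bundles. They are forced by [Phi]: any jet over [q] may
    be used, and [side1E] shows that the result does not depend on it. *)
Definition side1 (q : line_pt A) : line_pt (sharp B) :=
  the (existT _ point set0)
    [set r | exists j, [/\ is_jet j, j.1 = q & r = contact_proj2 (Phi j)]].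

Definition side2 (q : line_pt (sharp A)) : line_pt B :=
  the (existT _ point set0)
    [set r | exists j, [/\ is_jet j, contact_proj2 j = q & r = (Phi j).1]].

Lemma Lp_inj (D : sabundle M) (s : triv (afib D) (1 + ark D)) m y y' : adapted s -> tdom s m ->
  Lp s m y = Lp s m y' -> y = y'.
Proof.
move=> ss sm E; have := congr1 (fun S => line_triv s m S) (eq_from_Tagged E).
by rewrite !line_trivE.
Qed.

Lemma side1E i m y : P i -> cdom (c i) m -> tdom (t i) m ->
  side1 (Lp (t i) m y) = Lp (A := sharp B) (sharp_triv (t' i)) m (- l y).
Proof.
move=> Pi cm tm; have [sc tt tt' Ed] := fr Pi; have tm' : tdom (t' i) m by rewrite Ed.
have E s x w : contact_proj2 (Phi (cjet (c i) (t i) m y s x w)) =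
    Lp (A := sharp B) (sharp_triv (t' i)) m (- l y).
  by rewrite PhiJ // (contact_proj2J hM hB sc tt' cm tm').
apply: the_eq; first by exists (cjet (c i) (t i) m y 0 0 0); split; rewrite ?E //; exact: J_jet.
move=> _ [j [ij j1 ->]].
have [|y' [s [x [w Ej]]]] := jet_J hM hA sc tt cm tm ij; first by rewrite j1.
by move: j1; rewrite Ej => /(Lp_inj tt tm) ->; exact: E.
Qed.

Lemma side2E i m y : P i -> cdom (c i) m -> tdom (t i) m ->
  side2 (Lp (A := sharp A) (sharp_triv (t i)) m y) = Lp (t' i) m (f (- y)).
Proof.
move=> Pi cm tm; have [sc tt tt' Ed] := fr Pi; have tm' : tdom (t' i) m by rewrite Ed.
have E y' s x w : contact_proj2 (cjet (c i) (t i) m y' s x w) =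
    Lp (A := sharp A) (sharp_triv (t i)) m (- w).
  by rewrite (contact_proj2J hM hA sc tt cm tm).
apply: the_eq.
  by exists (cjet (c i) (t i) m 0 0 0 (- y)); split; rewrite ?E ?opprK ?PhiJ //; exact: J_jet.
move=> _ [j [ij j1 ->]].
have [|y' [s [x [w Ej]]]] := jet_J hM hA sc tt cm tm ij; first exact: (congr1 (@tag _ _) j1).
move: j1; rewrite Ej E => /(Lp_inj (sharp_adapted hM hA tt) tm) <-.
by rewrite PhiJ // opprK.
Qed.

Lemma framed_contact_diffeo : diffeo (X := contact_space A) (Y := contact_space B) Phi.
Proof.
pose wz a (z : 'rV[R]_((n + a) + (1 + (n + a)))) := rsubmx (rsubmx (rsubmx z)).
pose xz a (z : 'rV[R]_((n + a) + (1 + (n + a)))) := lsubmx (rsubmx (rsubmx z)).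
pose sz a (z : 'rV[R]_((n + a) + (1 + (n + a)))) := rsubmx z 0 (lshift (n + a) 0).
pose yz a (z : 'rV[R]_((n + a) + (1 + (n + a)))) := rsubmx (lsubmx z).
pose phi (z : 'rV[R]_((n + ark A) + (1 + (n + ark A)))) :=
  row_mx (row_mx (lsubmx (lsubmx z)) (f (wz _ z)))
    (row_mx (const_mx (e * (dotv (wz _ z) (yz _ z) - sz _ z)) : 'rV_1)
      (row_mx ((- e) *: xz _ z) (l (yz _ z)))).
(* The equation [s' = e * (dotv w y - s)] is solved for [s] with [e * e = 1], which gives
   [dotv w y - e * s']; here [w] and [y] are recovered from the target by [f'] and [l']. *)
pose psi (z : 'rV[R]_((n + ark B) + (1 + (n + ark B)))) :=
  row_mx (row_mx (lsubmx (lsubmx z)) (l' (wz _ z)))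
    (row_mx (const_mx (dotv (f' (yz _ z)) (l' (wz _ z)) - e * sz _ z) : 'rV_1)
      (row_mx ((- e) *: xz _ z) (f' (yz _ z)))).
have sw a z : smooth_row z (wz a).
  exact/smooth_row_r/smooth_row_r/smooth_row_r/smooth_row_id.
have sx a z : smooth_row z (xz a).
  exact/smooth_row_l/smooth_row_r/smooth_row_r/smooth_row_id.
have sy a z : smooth_row z (yz a) by exact/smooth_row_r/smooth_row_l/smooth_row_id.
have ss a z : smooth_near z (sz a).
  exact: (smooth_row_r (smooth_row_id z) (lshift (n + a) 0)).
have sm a z : smooth_row z (fun z : 'rV[R]_((n + a) + (1 + (n + a))) => lsubmx (lsubmx z)).
  exact/smooth_row_l/smooth_row_l/smooth_row_id.
have sphi z : smooth_row z phi.
  apply: smooth_row_mx; apply: smooth_row_mx.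
  + exact: sm.
  + exact: (smooth_row_comp (f := f) (g := @wz _) (smooth_row_lin _ fl)).
  + apply: smooth_row_const; apply: smooth_nearZ; apply: smooth_nearB => //.
    exact: smooth_near_dot.
  + apply: smooth_row_mx; first exact: (smooth_rowZ (smooth_near_cst _ _) (sx _ z)).
    exact: (smooth_row_comp (f := l) (g := @yz _) (smooth_row_lin _ ll)).
have sf' z : smooth_row z (fun z => f' (yz _ z)).
  exact: (smooth_row_comp (f := f') (g := @yz _) (smooth_row_lin _ fl')).
have sl' z : smooth_row z (fun z => l' (wz _ z)).
  exact: (smooth_row_comp (f := l') (g := @wz _) (smooth_row_lin _ ll')).
have spsi z : smooth_row z psi.
  apply: smooth_row_mx; apply: smooth_row_mx.
  + exact: sm.
  + exact: sl'.
  + apply: smooth_row_const; apply: smooth_nearB; first exact: smooth_near_dot.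
    exact: smooth_nearZ.
  + by apply: smooth_row_mx => //; exact: (smooth_rowZ (smooth_near_cst _ _) (sx _ z)).
refine (@diffeo_charts R (contact_space A) (contact_space B) (existT _ point set0, set0) Phi I P
  (fun i => jet_chart (c i) (t i)) (fun i => jet_chart (c i) (t' i)) phi psi _ _ _ _ _ _ sphi spsi).
- by move=> i Pi; have [sc tt tt' _] := fr Pi; split; exact: jet_chart_good.
- by move=> j ij; have [i Pi [cm tm]] := cov (tag j.1); exists i => //; case: (ij).
- move=> j ij; have [i Pi [cm tm]] := cov (tag j.1); have [_ _ _ Ed] := fr Pi; exists i => //.
  by split=> //; split; [case: (ij)|split; rewrite /= ?Ed].
- move=> i j Pi [ij [_ [cm tm]]]; have [sc tt tt' Ed] := fr Pi.
  have tm' : tdom (t' i) (tag j.1) by rewrite Ed.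
  have [y [s [x [w ->]]]] := jet_J hM hA sc tt cm tm ij erefl.
  rewrite PhiJ // !jet_chartJ //; split.
  + by split; [exact: J_jet|exact: cdomL].
  + by rewrite /phi /wz /yz /sz /xz !(row_mxKl, row_mxKr) row_mxEl mxE.
  + rewrite /psi /wz /yz /sz /xz !(row_mxKl, row_mxKr) row_mxEl mxE fK lK scalerA mulrNN ee.
    by rewrite scale1r mulrA ee mul1r opprB addrC subrK.
- move=> i j Pi [ij [_ [cm tm']]]; have [sc tt tt' Ed] := fr Pi.
  have tm : tdom (t i) (tag j.1) by rewrite -Ed.
  have [y [s [x [w ->]]]] := jet_J hM hB sc tt' cm tm' ij erefl.
  exists (cjet (c i) (t i) (tag j.1) (l' w) (dotv (f' y) (l' w) - e * s) ((- e) *: x) (f' y)).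
    by split; [exact: J_jet|exact: cdomL].
  rewrite PhiJ // fK' lK' scalerA mulrNN ee scale1r; congr cjet.
  by rewrite opprB addrC subrK mulrA ee mul1r.
(* [Phi] preserves the base point; this is seen in a frame [i0] around the jet, which may differ
   from [i]. *)
- move=> i j Pi ij [_ [_ []]]; have [i0 Pi0 [cm tm]] := cov (tag j.1).
  have [sc tt tt' Ed] := fr Pi0; have [y [s [x [w Ej]]]] := jet_J hM hA sc tt cm tm ij erefl.
  rewrite {1 2}Ej PhiJ // => cm' /=; have [_ _ _ ->] := fr Pi => tm'; split=> //.
  by split=> //; case: ij.
Qed.

Lemma framed_contact_iso : dab_iso (D := contact A) (D' := flip (contact B)) Phi.
Proof.
have hSA := sharp_sab hM hA; have hSB := sharp_sab hM hB.
have negl a : linear_row (fun u : 'rV[R]_a => - u).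
  by move=> r u v; rewrite opprD scalerN.
(* The second projection records minus the fibre derivative, so the side maps are [- l] and [f]
   after a change of sign. Both then fall under the result on lines, with the affine dual of [B],
   respectively of [A], as one of the two bundles. *)
have nll : linear_row (fun y => - l y) by move=> r u v; rewrite ll opprD scalerN.
have nll' : linear_row (fun y => l' (- y)) by move=> r u v; rewrite -ll' opprD scalerN.
have nfl : linear_row (fun y => f (- y)) by move=> r u v; rewrite -fl opprD scalerN.
have nfl' : linear_row (fun y => - f' y) by move=> r u v; rewrite fl' opprD scalerN.
have fr1 i : P i -> [/\ matl (c i), adapted (t i), @adapted _ _ (sharp B) (sharp_triv (t' i)) &
    tdom (sharp_triv (t' i)) = tdom (t i)].
  by move=> /fr[sc tt tt' Ed]; split=> //; exact: sharp_adapted.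
have fr2 i : P i -> [/\ matl (c i), @adapted _ _ (sharp A) (sharp_triv (t i)), adapted (t' i) &
    tdom (t' i) = tdom (sharp_triv (t i))].
  by move=> /fr[sc tt tt' Ed]; split=> //; exact: sharp_adapted.
have lsK : cancel (fun y => - l y) (fun y => l' (- y)) by move=> y; rewrite opprK lK.
have lsK' : cancel (fun y => l' (- y)) (fun y => - l y) by move=> y; rewrite lK' opprK.
have fsK : cancel (fun y => f (- y)) (fun y => - f' y) by move=> y; rewrite fK opprK.
have fsK' : cancel (fun y => - f' y) (fun y => f (- y)) by move=> y; rewrite opprK fK'.
have s2E i m y : P i -> cdom (c i) m -> tdom (sharp_triv (t i)) m ->
  side2 (Lp (A := sharp A) (sharp_triv (t i)) m y) = Lp (t' i) m (f (- y)) by exact: side2E.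
exists side1, side2; split.
- split; first exact: framed_contact_diffeo.
  split; first exact: (framed_line_diffeo hM hA hSB fr1 cov nll nll' lsK lsK' side1E).
  exact: (framed_line_diffeo hM hSA hB fr2 cov nfl nfl' fsK fsK' s2E).
- move=> j ij; have [i Pi [cm tm]] := cov (tag j.1); have [sc tt tt' Ed] := fr Pi.
  have tm' : tdom (t' i) (tag j.1) by rewrite Ed.
  have [y [s [x [w ->]]]] := jet_J hM hA sc tt cm tm ij erefl.
  rewrite PhiJ //=; split.
    by rewrite [LHS](contact_proj2J hM hB sc tt' cm tm') side1E.
  by rewrite [contact_proj2 _](contact_proj2J hM hA sc tt cm tm) [RHS]side2E // opprK.
- split=> q lq; first exact: (framed_line_tag fr1 cov side1E lq).
  exact: (framed_line_tag fr2 cov s2E lq).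
- split=> r j j' ij ij' E.
    have [i Pi [cm tm]] := cov (tag j.1); have [sc tt tt' Ed] := fr Pi.
    have tm' : tdom (t' i) (tag j.1) by rewrite Ed.
    have [y [s [x [w Ej]]]] := jet_J hM hA sc tt cm tm ij erefl.
    have Et : tag j'.1 = tag j.1 := congr1 (@tag _ _) (esym E : j'.1 = j.1).
    have [y' [s' [x' [w' Ej']]]] := jet_J hM hA sc tt cm tm ij' Et.
    have Ey : y' = y by apply: (Lp_inj tt tm); move: E; rewrite Ej Ej'.
    subst y'; rewrite Ej Ej' /= contact_comb1J // !PhiJ // contact_comb2J //.
    congr cjet; first exact: linear_row_comb.
      by rewrite dotvDl !dotvZl; ring.
    by rewrite scalerDr !scalerA ![- e * _]mulrC.
  have [i Pi [cm tm]] := cov (tag j.1); have [sc tt tt' Ed] := fr Pi.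
  have tm' : tdom (t' i) (tag j.1) by rewrite Ed.
  have [y [s [x [w Ej]]]] := jet_J hM hA sc tt cm tm ij erefl.
  have Et : tag j'.1 = tag j.1 := congr1 (@tag _ _) (esym E : contact_proj2 j' = contact_proj2 j).
  have [y' [s' [x' [w' Ej']]]] := jet_J hM hA sc tt cm tm ij' Et.
  have Ew : w' = w.
    apply: oppr_inj; apply: (Lp_inj (sharp_adapted hM hA tt) tm); move: E; rewrite Ej Ej' /=.
    by rewrite !contact_proj2J.
  subst w'; rewrite Ej Ej' /= contact_comb2J // !PhiJ // contact_comb1J //.
  congr cjet; last exact: linear_row_comb.
    by rewrite dotvDr !dotvZr; ring.
  by rewrite scalerDr !scalerA ![- e * _]mulrC.
- split=> r q q' lq lq' E; first exact: (framed_line_comb hA hSB fr1 cov nll side1E).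
  exact: (framed_line_comb hSA hB fr2 cov nfl s2E).
Qed.

End FramedContact.

(** * Jets of the adjoint bundle *)

Section Adjoint.
Variables (R : realType) (M : manifold R) (hM : is_manifold M).
Variables (A : sabundle M) (hA : is_sabundle A).
Notation k := (ark A).

Lemma zeta_adjoint m (a : afib A m) : zeta (A := adjoint A) a = zeta a.
Proof.
apply/seteqP; split=> _ [s _ <-]; exists (- s) => //.
  by rewrite /avshift scaleNr scalerN.
by rewrite /avshift /= scalerN scaleNr opprK.
Qed.

Lemma is_line_adjoint m (S : set (afib A m)) : is_line (A := adjoint A) S <-> is_line S.
Proof. by split=> -[a ->]; exists a; rewrite zeta_adjoint. Qed.

Lemma is_section_adjoint (sg : section A) : is_section (A := adjoint A) sg <-> is_section sg.
Proof.
split=> sec m S; first by move=> /is_line_adjoint /sec; rewrite zeta_adjoint.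
by move=> /is_line_adjoint /sec E; rewrite zeta_adjoint.
Qed.

Lemma yc_neg_triv (t : triv (afib A) (1 + k)) m (a : afib A m) :
  yc (A := adjoint A) (neg_triv t) a = yc t a.
Proof. exact: row_mxKr. Qed.

Lemma uc_neg_triv (t : triv (afib A) (1 + k)) m (a : afib A m) :
  uc (A := adjoint A) (neg_triv t) a = - uc t a.
Proof. by rewrite /uc row_mxEl !mxE. Qed.

Lemma Lp_adjoint (t : triv (afib A) (1 + k)) m (y : 'rV[R]_k) :
  Lp (A := adjoint A) (neg_triv t) m y = Lp t m y.
Proof.
congr existT; apply/seteqP; split=> a; first by rewrite /Ln /= yc_neg_triv.
by rewrite /Ln /= -yc_neg_triv.
Qed.

Lemma line_chart_adjoint c (t : triv (afib A) (1 + k)) :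
  line_chart (A := adjoint A) c (neg_triv t) = line_chart c t.
Proof.
have E1 : (fun m => [set S : set (afib A m) | is_line (A := adjoint A) S]) =
    (fun m => [set S : set (afib A m) | is_line S]).
  by apply: functional_extensionality_dep => m; apply/seteqP; split=> S /is_line_adjoint.
have E2 : line_triv (A := adjoint A) (neg_triv t) = line_triv t.
  congr Triv; apply: functional_extensionality_dep => m; apply/funext => S; congr get.
  by apply/seteqP; split=> _ [a Sa <-]; exists a => //; rewrite row_mxKr.
by rewrite /line_chart /= E1 E2.
Qed.

(** The adjoint has the same fibres, lines and sections, so its jets are literally jets of [A] and
    the same map applies to both. Only the normalised coordinate [u] is reversed, and with it the
    value and all its derivatives. *)
Lemma J_adjoint c (t : triv (afib A) (1 + k)) m (y w : 'rV[R]_k) s x :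
  matl c -> adapted t -> cdom c m -> tdom t m ->
  cjet (A := adjoint A) c (neg_triv t) m y s x w = cjet c t m y (- s) (- x) (- w).
Proof.
move=> sc tt cm tm; have hA' := adjoint_sab hM hA; have tt' := neg_triv_adapted hM hA tt.
have okL := line_space_ok hM hA; have okL' := line_space_ok hM hA'.
have sL := satlL sc tt; have sL' := satlL (A := adjoint A) sc tt'.
have cp := cdomL tt y cm tm; have cp' := cdomL (A := adjoint A) tt' y cm tm.
have Eu (sg : section A) :
    us (A := adjoint A) (neg_triv t) sg = (fun q => - us t sg q) :> (line_pt A -> R).
  by apply/funext => q; exact: uc_neg_triv.
have Es (sg : section A) : smooth_at (X := line_space (adjoint A))
      (us (A := adjoint A) (neg_triv t) sg) (Lp (A := adjoint A) (neg_triv t) m y) <->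
    smooth_at (X := line_space A) (us t sg) (Lp t m y).
  rewrite (smooth_atE okL' _ sL' cp') line_chart_adjoint Lp_adjoint Eu.
  rewrite -(smooth_atE okL _ sL cp); split=> [/(smooth_atN okL sL cp)|].
    by under [X in smooth_at X]eq_fun do rewrite opprK.
  exact: (smooth_atN okL sL cp).
rewrite /cjet Lp_adjoint; congr pair; apply/seteqP; split=> sg /= [sec sm E1 E2].
  have sm' : smooth_at (us t sg) (Lp t m y) by apply/Es; rewrite Lp_adjoint.
  split=> //; first exact/is_section_adjoint.
    by rewrite -E1 Eu opprK.
  move: E2; rewrite line_chart_adjoint Eu (gradN okL sL cp sm') => E2.
  by rewrite -opp_row_mx -E2 opprK.
split; first exact/is_section_adjoint.
- by have /Es := sm; rewrite Lp_adjoint.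
- by rewrite Eu E1 opprK.
- by rewrite line_chart_adjoint Eu (gradN okL sL cp sm) E2 opp_row_mx !opprK.
Qed.

End Adjoint.

(** * The contact map for a bundle and for its adjoint *)

Section ContactIsos.
Variables (R : realType) (M : manifold R) (hM : is_manifold M).
Variables (A : sabundle M) (hA : is_sabundle A).
Notation n := (mdim M).
Notation k := (ark A).
Let hS := sharp_sab hM hA.
Let hA' := adjoint_sab hM hA.
Let I : Type := chart R M n * triv (afib A) (1 + k).
Let P : set I := [set i | matl i.1 /\ adapted i.2].

Let cov m : exists2 i, P i & cdom i.1 m /\ tdom i.2 m.
Proof. by have [c [t [sc tt cm tm]]] := frame_ex hM hA m; exists (c, t). Qed.

Let negl : linear_row (fun u : 'rV[R]_k => - u).
Proof. by move=> r u v; rewrite opprD scalerN. Qed.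

Let idl : linear_row (fun u : 'rV[R]_k => u). Proof. by []. Qed.

Let contact_iso_adjointJ c (t : triv (afib A) (1 + k)) m (y : 'rV[R]_k) s x (w : 'rV[R]_k) :
  matl c -> adapted t -> cdom c m -> tdom t m ->
  contact_iso (cjet (A := adjoint A) c (neg_triv t) m y s x w : cpt A) =
  cjet (A := sharp A) c (sharp_triv t) m w (-1 * (dotv w y - s)) (- -1 *: x) (- y).
Proof.
move=> sc tt cm tm; rewrite J_adjoint // contact_isoJ //; congr cjet; rewrite ?opprK ?scale1r //.
by rewrite dotvNl; ring.
Qed.

Lemma contact_iso_dab : dab_iso (D := contact A) (D' := flip (contact (sharp A))) (@contact_iso R M A).
Proof.
apply: (@framed_contact_iso R M hM A (sharp A) hA hS I P (fun i => i.1) (fun i => i.2)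
  (fun i => sharp_triv i.2) _ cov (fun u => - u) (fun u => - u) (fun u => - u) (fun u => - u)
  negl negl (@opprK _) (@opprK _) negl negl (@opprK _) (@opprK _) 1 (mulr1 1)).
  by move=> i [sc tt]; split=> //; exact: sharp_adapted.
move=> i m y s x w [sc tt] cm tm; rewrite contact_isoJ // mul1r scaleNr scale1r //.
Qed.

Lemma contact_iso_adjoint_dab :
  dab_iso (D := contact (adjoint A)) (D' := flip (contact (sharp A))) (@contact_iso R M A).
Proof.
apply: (@framed_contact_iso R M hM (adjoint A) (sharp A) hA' hS I P (fun i => i.1)
  (fun i => neg_triv i.2) (fun i => sharp_triv i.2) _ cov id (fun u => - u) id (fun u => - u)
  idl idl (fun=> erefl) (fun=> erefl) negl negl (@opprK _) (@opprK _) (-1)).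
- by move=> i [sc tt]; split=> //; [exact: neg_triv_adapted|exact: sharp_adapted].
- by rewrite mulrNN mulr1.
- by move=> i m y s x w [sc tt] cm tm; exact: contact_iso_adjointJ.
Qed.

Lemma contact_iso_shift (j : cpt A) : is_jet j ->
  contact_iso (jet_shift 1 j) = jet_shift (A := sharp A) (-1) (contact_iso j).
Proof.
move=> ij; have [c [t [sc tt cm tm]]] := frame_ex hM hA (tag j.1).
have [y [s [x [w ->]]]] := jet_J hM hA sc tt cm tm ij erefl.
rewrite jet_shiftJ // !contact_isoJ // (jet_shiftJ hM hS sc (sharp_adapted hM hA tt) cm tm).
by congr cjet; ring.
Qed.

Lemma contact_iso_adjoint_shift (j : cpt (adjoint A)) : is_jet j ->
  contact_iso (jet_shift (A := adjoint A) 1 j : cpt A) =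
  jet_shift (A := sharp A) 1 (contact_iso (j : cpt A)).
Proof.
move=> ij; have [c [t [sc tt cm tm]]] := frame_ex hM hA (tag j.1).
have tt' := neg_triv_adapted hM hA tt.
have [y [s [x [w ->]]]] := jet_J hM hA' sc tt' cm tm ij erefl.
rewrite (jet_shiftJ hM hA' sc tt' cm tm) !contact_iso_adjointJ //.
rewrite (jet_shiftJ hM hS sc (sharp_adapted hM hA tt) cm tm).
by congr cjet; ring.
Qed.

Lemma contact_comb1_jet l (j j' : cpt A) : is_jet j -> is_jet j' -> j.1 = j'.1 ->
  is_jet (contact_comb1 l j j').
Proof.
move=> ij ij' E; have [c [t [sc tt cm tm]]] := frame_ex hM hA (tag j.1).
have [y [s [x [w Ej]]]] := jet_J hM hA sc tt cm tm ij erefl.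
have Et : tag j'.1 = tag j.1 := congr1 (@tag _ _) (esym E).
have [y' [s' [x' [w' Ej']]]] := jet_J hM hA sc tt cm tm ij' Et.
have Ey : y' = y by apply: (Lp_inj tt tm); move: E; rewrite Ej Ej'.
by subst y'; rewrite Ej Ej' contact_comb1J //; exact: J_jet.
Qed.

Lemma contact_comb2_jet l (j j' : cpt A) : is_jet j -> is_jet j' ->
  contact_proj2 j = contact_proj2 j' -> is_jet (contact_comb2 l j j').
Proof.
move=> ij ij' E; have [c [t [sc tt cm tm]]] := frame_ex hM hA (tag j.1).
have [y [s [x [w Ej]]]] := jet_J hM hA sc tt cm tm ij erefl.
have Et : tag j'.1 = tag j.1 := congr1 (@tag _ _) (esym E).
have [y' [s' [x' [w' Ej']]]] := jet_J hM hA sc tt cm tm ij' Et.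
have Ew : w' = w.
  apply: oppr_inj; apply: (Lp_inj (sharp_adapted hM hA tt) tm); move: E; rewrite Ej Ej'.
  by rewrite !contact_proj2J.
by subst w'; rewrite Ej Ej' contact_comb2J //; exact: J_jet.
Qed.

End ContactIsos.

(** [tau] is conjugate to [Phi] through the identifications, and the side maps are those of [Phi].
    Smoothness is a separate hypothesis, since [Y] and [Y'] carry atlases of their own. Closure
    under combinations is needed because [tau (f x)] is known only for [x] in the carrier. *)
Lemma dab_transport_iso (R : realType) (M : manifold R) (D D' : dabundle M) (Y Y' : space R)
    (f : dtot D -> Y) (g : Y -> dtot D) (f' : dtot D' -> Y') (g' : Y' -> dtot D')
    (Phi : dtot D -> dtot D') (tau : Y -> Y') :
  dab_iso Phi -> diffeo tau ->
  (forall y, scar y -> scar (g y) /\ g' (tau y) = Phi (g y)) ->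
  (forall x, scar x -> tau (f x) = f' (Phi x)) ->
  (forall (l : R) (x x' : dtot D), scar x -> scar x' -> dp1 x = dp1 x' -> scar (dcomb1 l x x')) ->
  (forall (l : R) (x x' : dtot D), scar x -> scar x' -> dp2 x = dp2 x' -> scar (dcomb2 l x x')) ->
  dab_iso (D := dab_transport f g) (D' := dab_transport f' g') tau.
Proof.
move=> [P1 [P2 [[_ dP] pr dq [c1 c2] sc]]] dt Hg Hf cl1 cl2; exists P1, P2; split=> //.
- by move=> y /Hg[gy /= ->]; exact: pr.
- split=> l y y' /Hg[gy gE] /Hg[gy' gE'] E /=; rewrite gE gE' -?c1 -?c2 // Hf //.
    exact: cl1.
  exact: cl2.
Qed.

(** * The quotients of the double affine dual and the isomorphism between them *)

Section Quotients.
Variables (R : realType) (M : manifold R) (hM : is_manifold M).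
Variables (A : sabundle M) (hA : is_sabundle A).
Notation n := (mdim M).
Notation k := (ark A).
Let hS := sharp_sab hM hA.
Let okH : vb_ok (hull_embedding A) := hull_vb_ok hM hA.
Let okD : vb_ok (dual_embedding A) := dual_vb_ok hM okH.

Definition quot_chart (orb : cov A -> set (cov A)) N
    (q : 'rV[R]_((n + (1 + (1 + k))) + (n + (1 + (1 + k)))) -> 'rV[R]_N)
    (c : chart R M n) (t : triv (afib A) (1 + k)) : chart R (set (cov A)) N :=
  Chart [set O | exists w, [/\ is_BA w, O = orb w, cdom c (tag w.1) & tdom t (tag w.1)]]
    (fun O => get [set q (cotangent_chart (vchart (V := hull_bundle A) c (hull_triv t)) w) | w in O]).

Section Frame.
Variables (c : chart R M n) (t : triv (afib A) (1 + k)) (sc : matl c) (tt : adapted t).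
Notation DD m := (BAc hM hA c m tt).

Lemma quot_domP orb N (q : _ -> 'rV[R]_N) O : cdom (quot_chart orb q c t) O ->
  exists m u y p b w, [/\ cdom c m, tdom t m & O = orb (DD m u y p b w)].
Proof.
move=> [w0 [Bw -> cm tm]]; have [u [y [p [b [w E]]]]] := BA_D hM hA sc tt cm tm Bw erefl.
by exists (tag w0.1), u, y, p, b, w; rewrite -E.
Qed.

Lemma quot_dom orb N (q : _ -> 'rV[R]_N) m u y p b w : cdom c m -> tdom t m ->
  cdom (quot_chart orb q c t) (orb (DD m u y p b w)).
Proof. by move=> cm tm; exists (DD m u y p b w); split=> //; exact: D_BA. Qed.

Lemma D_chart m u y p b w : cdom c m -> tdom t m ->
  cotangent_chart (vchart (V := hull_bundle A) c (hull_triv t)) (DD m u y p b w) =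
  row_mx (row_mx (c m) (eH u y)) (row_mx p (eD b w)).
Proof.
move=> cm tm; have vt : vtrivs (v := hull_bundle A) (hull_triv t) by exists t.
by rewrite [LHS](Wc_chart hM okH sc vt cm tm) (hptE hM hA tt tm).
Qed.

Lemma quot2_chartE m u y p b w : cdom c m -> tdom t m ->
  quot_chart (@BA_orbit2 R M A) (@quot2_coord R n k) c t (BA_orbit2 (DD m u y p b w)) =
  row_mx (row_mx (c m) (row_mx (const_mx u) y)) (row_mx p w).
Proof.
move=> cm tm; rewrite /= (orbit2D hM hA sc tt cm tm).
have E b' : quot2_coord (cotangent_chart (vchart (V := hull_bundle A) c (hull_triv t))
    (DD m u y p b' w)) = row_mx (row_mx (c m) (row_mx (const_mx u) y)) (row_mx p w).
  by rewrite D_chart // /quot2_coord !(row_mxKl, row_mxKr).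
apply: get_eq => /= [|_ [_ [b' _ <-] <-]]; last exact: E.
by exists (DD m u y p b w); [exists b|exact: E].
Qed.

Lemma quot1_chartE m u y p b w : cdom c m -> tdom t m ->
  quot_chart (@BA_orbit1 R M A) (@quot1_coord R n k) c t (BA_orbit1 (DD m u y p b w)) =
  row_mx (row_mx (c m) y) (row_mx p (row_mx (const_mx b) w)).
Proof.
move=> cm tm; rewrite /= (orbit1D hM hA sc tt cm tm).
have E u' : quot1_coord (cotangent_chart (vchart (V := hull_bundle A) c (hull_triv t))
    (DD m u' y p b w)) = row_mx (row_mx (c m) y) (row_mx p (row_mx (const_mx b) w)).
  by rewrite D_chart // /quot1_coord !(row_mxKl, row_mxKr).
apply: get_eq => /= [|_ [_ [u' _ <-] <-]]; last exact: E.
by exists (DD m u y p b w); [exists u|exact: E].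
Qed.

Lemma row1_inj (a b : R) : const_mx a = const_mx b :> 'rV[R]_1 -> a = b.
Proof. by move/matrixP => /(_ 0 0); rewrite !mxE. Qed.

Lemma quot2_chart_good : chart_good (X := quot2 A)
  (quot_chart (@BA_orbit2 R M A) (@quot2_coord R n k) c t).
Proof.
split; first by exists c, t.
- by move=> O [w [Bw -> _ _]]; exists w.
- move=> O O'; rewrite !inE => /quot_domP[m [u [y [p [b [w [cm tm ->]]]]]]].
  move=> /quot_domP[m' [u' [y' [p' [b' [w' [cm' tm' ->]]]]]]].
  rewrite !quot2_chartE // => /eq_row_mx[/eq_row_mx[Em /eq_row_mx[/row1_inj -> ->]]].
  move=> /eq_row_mx[-> ->].
  have E : m = m' by apply: (matl_inj hM sc); rewrite ?inE.
  by subst m'; rewrite !(orbit2D hM hA sc tt cm tm).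
- apply: (open_chart_img hM (U := cdom c `&` tdom t) sc).
  + by apply: openI; [exact: matl_open|exact: (adapted_affine tt).1].
  + by move=> m [].
  + move=> O /quot_domP[m [u [y [p [b [w [cm tm ->]]]]]]]; exists m => //.
    by rewrite quot2_chartE // !row_mxKl.
  + move=> m z [cm tm] Ez; set uy := rsubmx (lsubmx z).
    exists (BA_orbit2 (DD m (lsubmx uy 0 0) (rsubmx uy) (lsubmx (rsubmx z)) 0
      (rsubmx (rsubmx z)))); first exact: quot_dom.
    by rewrite quot2_chartE // -Ez -row1E !hsubmxK.
Qed.

Lemma quot1_chart_good : chart_good (X := quot1 A)
  (quot_chart (@BA_orbit1 R M A) (@quot1_coord R n k) c t).
Proof.
split; first by exists c, t.
- by move=> O [w [Bw -> _ _]]; exists w.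
- move=> O O'; rewrite !inE => /quot_domP[m [u [y [p [b [w [cm tm ->]]]]]]].
  move=> /quot_domP[m' [u' [y' [p' [b' [w' [cm' tm' ->]]]]]]].
  rewrite !quot1_chartE // => /eq_row_mx[/eq_row_mx[Em ->]].
  move=> /eq_row_mx[-> /eq_row_mx[/row1_inj -> ->]].
  have E : m = m' by apply: (matl_inj hM sc); rewrite ?inE.
  by subst m'; rewrite !(orbit1D hM hA sc tt cm tm).
- apply: (open_chart_img hM (U := cdom c `&` tdom t) sc).
  + by apply: openI; [exact: matl_open|exact: (adapted_affine tt).1].
  + by move=> m [].
  + move=> O /quot_domP[m [u [y [p [b [w [cm tm ->]]]]]]]; exists m => //.
    by rewrite quot1_chartE // !row_mxKl.
  + move=> m z [cm tm] Ez; set bw := rsubmx (rsubmx z).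
    exists (BA_orbit1 (DD m 0 (rsubmx (lsubmx z)) (lsubmx (rsubmx z)) (lsubmx bw 0 0)
      (rsubmx bw))); first exact: quot_dom.
    by rewrite quot1_chartE // -Ez -row1E !hsubmxK.
Qed.

End Frame.

(** Vanishing on the Euler field is the relation [b + u + dotv w y = 0], symmetric in [b] and [u].
    One quotient keeps [u], the other keeps [b], so [tau] and its inverse are both given by solving
    this relation. *)
Lemma tau_diffeo : diffeo (@tauA R M A).
Proof.
pose phi (z : 'rV[R]_((n + (1 + k)) + (n + k))) :=
  let uy := rsubmx (lsubmx z) in let w := rsubmx (rsubmx z) in
  row_mx (row_mx (lsubmx (lsubmx z)) (rsubmx uy))
    (row_mx (lsubmx (rsubmx z))
       (row_mx (const_mx (- (uy 0 (lshift k 0) + dotv w (rsubmx uy))) : 'rV_1) w)).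
pose psi (z : 'rV[R]_((n + k) + (n + (1 + k)))) :=
  let y := rsubmx (lsubmx z) in let bw := rsubmx (rsubmx z) in
  row_mx (row_mx (lsubmx (lsubmx z))
       (row_mx (const_mx (- (bw 0 (lshift k 0) + dotv (rsubmx bw) y)) : 'rV_1) y))
    (row_mx (lsubmx (rsubmx z)) (rsubmx bw)).
pose I : Type := (chart R M n * triv (afib A) (1 + k))%type.
pose P : set I := [set i | matl i.1 /\ adapted i.2].
have sphi z : smooth_row z phi.
  have sy : smooth_row z (fun z => rsubmx (rsubmx (lsubmx z))).
    exact/smooth_row_r/smooth_row_r/smooth_row_l/smooth_row_id.
  have sw : smooth_row z (fun z => rsubmx (rsubmx z)) by exact/smooth_row_r/smooth_row_r/smooth_row_id.
  apply: smooth_row_mx; apply: smooth_row_mx => //.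
  + exact/smooth_row_l/smooth_row_l/smooth_row_id.
  + exact/smooth_row_l/smooth_row_r/smooth_row_id.
  + apply: smooth_row_mx => //; apply: smooth_row_const; apply: smooth_nearN.
    apply: smooth_nearD; last exact: smooth_near_dot.
    exact: (smooth_row_r (smooth_row_l (smooth_row_id z)) (lshift k 0)).
have spsi z : smooth_row z psi.
  have sy : smooth_row z (fun z => rsubmx (lsubmx z)).
    exact/smooth_row_r/smooth_row_l/smooth_row_id.
  have sw : smooth_row z (fun z => rsubmx (rsubmx (rsubmx z))).
    exact/smooth_row_r/smooth_row_r/smooth_row_r/smooth_row_id.
  apply: smooth_row_mx; apply: smooth_row_mx => //.
  + exact/smooth_row_l/smooth_row_l/smooth_row_id.
  + apply: smooth_row_mx => //; apply: smooth_row_const; apply: smooth_nearN.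
    apply: smooth_nearD; last exact: smooth_near_dot.
    exact: (smooth_row_r (smooth_row_r (smooth_row_id z)) (lshift k 0)).
  + exact/smooth_row_l/smooth_row_r/smooth_row_id.
refine (@diffeo_charts R (quot2 A) (quot1 A) set0 (@tauA R M A) I P
  (fun i => quot_chart (@BA_orbit2 R M A) (@quot2_coord R n k) i.1 i.2)
  (fun i => quot_chart (@BA_orbit1 R M A) (@quot1_coord R n k) i.1 i.2) phi psi _ _ _ _ _ _ sphi spsi).
- by move=> i [sc tt]; split; [exact: quot2_chart_good|exact: quot1_chart_good].
- move=> O [w Bw ->]; have [c [t [sc tt cm tm]]] := frame_ex hM hA (tag w.1).
  by exists (c, t) => //; exists w.
- move=> O [w Bw ->]; have [c [t [sc tt cm tm]]] := frame_ex hM hA (tag w.1).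
  by exists (c, t) => //; exists w.
- move=> i O [sc tt] dO; have [m [u [y [p [b [w [cm tm ->]]]]]]] := quot_domP sc tt dO.
  rewrite (tauD hM hA sc tt cm tm) (quot1_chartE sc tt) // (quot2_chartE sc tt) //; split.
  + exact: quot_dom.
  + by rewrite /phi /= !(row_mxKl, row_mxKr) row_mxEl mxE.
  + by rewrite /psi /= !(row_mxKl, row_mxKr) row_mxEl mxE opprD opprK addrK.
- move=> i O [sc tt] dO; have [m [u [y [p [b [w [cm tm ->]]]]]]] := quot_domP sc tt dO.
  exists (BA_orbit2 (BAc hM hA i.1 m tt (- (b + dotv w y)) y p 0 w)); first exact: quot_dom.
  rewrite (tauD hM hA sc tt cm tm) !(orbit1D hM hA sc tt cm tm).
  by rewrite opprD opprK addrK.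
- move=> i O [sc tt] [w0 Bw ->].
  (* The orbit is first described in a frame of its own. All points of a first orbit lie over the
     same base point, so membership in the domain of the frame [i] passes back to [w0]. *)
  have [c' [t' [sc' tt' cm' tm']]] := frame_ex hM hA (tag w0.1).
  have [u [y [p [b [w Ew]]]]] := BA_D hM hA sc' tt' cm' tm' Bw erefl.
  rewrite {1}Ew (tauD hM hA sc' tt' cm' tm') => -[w1 [Bw1 E cm tm]].
  have [s _ E1] : BA_orbit1 w1 (BAc hM hA c' (tag w0.1) tt' 0 y p (- (u + dotv w y)) w).
    by rewrite -E (orbit1D hM hA sc' tt' cm' tm'); exists 0.
  have Et : tag w0.1 = tag w1.1 := congr1 (fun w => tag w.1) (esym E1).
  by exists w0; split; rewrite // Et.
Qed.

Lemma kappaA_surj (O : quot2 A) : scar O -> exists2 j : cpt A, is_jet j & O = kappaA j.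
Proof.
move=> [w0 Bw ->]; have [c [t [sc tt cm tm]]] := frame_ex hM hA (tag w0.1).
have [u [y [p [b [w ->]]]]] := BA_D hM hA sc tt cm tm Bw erefl.
exists (cjet c t (tag w0.1) y u (- p) (- w)); first exact: J_jet.
by rewrite (kappaD hM hA sc tt cm tm _ _ _ _ b) !opprK.
Qed.

(** Equal images lie over the same base point, hence [w] and [w'] can be compared in one frame,
    where [betaE] lets every component be recovered. *)
Lemma beta_BA_inj (w w' : cov A) : is_BA w -> is_BA w' ->
  beta (V := hull_bundle A) w = beta (V := hull_bundle A) w' -> w = w'.
Proof.
have key (w1 : cov A) c t m (sc : matl c) (tt : adapted t) (cm : cdom c m) (tm : tdom t m) :
    is_BA w1 -> tag w1.1 = m -> exists (e : hull_bundle A m) xi p,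
    w1 = ccov (V := hull_bundle A) c (hull_triv t) e p (dual_triv (V := hull_bundle A) (hull_triv t) m xi) /\
    beta (V := hull_bundle A) w1 = ccov (V := dual_bundle (hull_bundle A)) c
      (dual_triv (V := hull_bundle A) (hull_triv t)) xi (- p) (hull_triv t m e).
  move=> [iw _ _] Em; have vt : vtrivs (v := hull_bundle A) (hull_triv t) by exists t.
  have [e [p [v ->]]] := Wc_ex hM okH sc vt cm tm iw Em.
  have [xi <-] := dual_triv_surj okH vt tm v.
  by exists e, xi, p; split=> //; exact: (betaE hM okH).
move=> Bw Bw' E; have [c [t [sc tt cm tm]]] := frame_ex hM hA (tag w.1).
have vt : vtrivs (v := hull_bundle A) (hull_triv t) by exists t.
have vt' : vtrivs (v := dual_bundle (hull_bundle A)) (dual_triv (V := hull_bundle A) (hull_triv t)).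
  by exists (hull_triv t).
have [e [xi [p [Ew Eb]]]] := key w c t _ sc tt cm tm Bw erefl.
have Et : tag w'.1 = tag w.1.
  have [c' [t' [sc' tt' cm' tm']]] := frame_ex hM hA (tag w'.1).
  have [e' [xi' [p' [_ Eb']]]] := key w' c' t' _ sc' tt' cm' tm' Bw' erefl.
  by move: E; rewrite Eb Eb' => /(congr1 (fun w => tag w.1)).
have [e' [xi' [p' [Ew' Eb']]]] := key w' c t _ sc tt cm tm Bw' Et.
move: E; rewrite Eb Eb' => /(Wc_inj hM okD sc vt' cm tm)[Exi /oppr_inj Ep Ee].
by rewrite Ew Ew' Exi Ep (vt_inj okH vt tm Ee).
Qed.

(** [beta_quot_inv] is a preimage within BA, so it undoes the image under [beta] by injectivity of
    [beta] there. *)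
Lemma beta_quotK (O : quot1 A) : scar O -> beta_quot_inv (beta_quot O) = O.
Proof.
move=> [w0 Bw0 ->]; have [c [t [sc tt cm tm]]] := frame_ex hM hA (tag w0.1).
have [u [y [p [b [w ->]]]]] := BA_D hM hA sc tt cm tm Bw0 erefl.
have BO w1 : BA_orbit1 (BAc hM hA c (tag w0.1) tt u y p b w) w1 -> is_BA w1.
  by rewrite (orbit1D hM hA sc tt cm tm) => -[u' _ <-]; exact: D_BA.
apply/seteqP; split=> w1; last by move=> Ow1; split; [exact: BO|exists w1].
by move=> [Bw1 [w2 Ow2 /beta_BA_inj <-]] //; exact: BO.
Qed.

(** By the frame formulas [beta] carries the orbit on the left to the [kappa]-class of the image
    jet, and [beta_quotK] then cancels [beta]. *)
Lemma contact_isoK (j : cpt A) : is_jet j ->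
  tauA (kappaA j) = beta_quot_inv (kappa (E := dual_embedding A) (contact_iso j)).
Proof.
move=> ij; have [c [t [sc tt cm tm]]] := frame_ex hM hA (tag j.1).
have [y [s [x [w ->]]]] := jet_J hM hA sc tt cm tm ij erefl.
rewrite (contact_isoJ hM hA sc tt cm tm) (kappaD hM hA sc tt cm tm _ _ _ _ 0).
rewrite (tauD hM hA sc tt cm tm).
have -> : dotv w y - s = - (s + dotv (- w) y) by rewrite dotvNl; ring.
rewrite -(beta_orbitD hM hA sc tt cm tm 0) beta_quotK //.
by exists (BAc hM hA c (tag j.1) tt 0 y (- x) (- (s + dotv (- w) y)) (- w)) => //; exact: D_BA.
Qed.

(** The structures of the two quotients are those of the contact bundles of A and of its affine
    dual, carried over by [kappa] and [beta]; under these identifications [tau] becomes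
    [contact_iso]. *)
Lemma tau_dab : dab_iso (D := dab_quot2 A) (D' := dab_quot1 A) (@tauA R M A).
Proof.
have kK (j : cpt A) : is_jet j -> kappaA_inv (kappaA j) = j.
  exact: (kappa_invK hM hA okH (hull_framed hM hA)).
apply: (@dab_transport_iso R M (contact A) (flip (contact (sharp A))) (quot2 A) (quot1 A)
  (@kappaA R M A) (@kappaA_inv R M A) (fun j => beta_quot_inv (kappa (E := dual_embedding A) j))
  (fun O => kappa_inv (E := dual_embedding A) (beta_quot O)) (@contact_iso R M A)).
- exact: contact_iso_dab.
- exact: tau_diffeo.
- by move=> O /kappaA_surj[j ij ->]; rewrite kK.
- exact: contact_isoK.
- exact: contact_comb1_jet.
- exact: contact_comb2_jet.
Qed.

End Quotients.

Theorem theorem6p1 (R : realType) (M : manifold R) (A : sabundle M)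
    (hM : is_manifold M) (hA : is_sabundle A) :
  [/\ dab_iso (D := dab_quot2 A) (D' := dab_quot1 A) (@tauA R M A),
      dab_iso (D := contact A) (D' := flip (contact (sharp A)))
              (@contact_iso R M A),
      (forall j : cpt A, is_jet j ->
         contact_iso (jet_shift (A := A) 1 j) =
         jet_shift (A := sharp A) (-1) (contact_iso j)) &
      special_contact_iso (A' := adjoint A) (B := sharp A)
                          (@contact_iso R M A)].
Proof.
split; first exact: tau_dab.
- exact: contact_iso_dab.
- exact: contact_iso_shift.
- by split; [exact: contact_iso_adjoint_dab|exact: contact_iso_adjoint_shift].
Qed.
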